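(* Assume that $\rho$ has compact support and that $\nu$ satisfies $\mathrm{TI}(\tau)$ for some $\tau\in(0,\infty)$. (i) If $\nabla_2^2c(x,y)=\Sigma$ for all $x,y$, for a constant matrix $\Sigma$, then for every $\varepsilon>0$ Sinkhorn's algorithm converges exponentially fast, and for $\varepsilon\le\sqrt\tau\,\|g\|_{L^\infty(\rho)}$ it converges with rate $$1-\frac{\varepsilon^2}{\varepsilon^2+\tau\|g\|^2_{L^\infty(\rho)}},$$ where $g(x):=\nabla_2c(x,y)-\Sigma y$ (which does not depend on $y$). (ii) If $\nu$ is compactly supported and $\ell_c,\Lambda_c$ are such that $\ell_c\preceq\nabla_2^2c(x,y)\preceq\Lambda_c$ on $\mathrm{supp}(\rho)\times\mathrm{supp}(\nu)$, then for every $\varepsilon>0$ Sinkhorn's algorithm converges exponentially fast, and for $$\varepsilon\le\frac{\tau(\Lambda_c-\ell_c)+\sqrt{\tau^2(\Lambda_c-\ell_c)^2+4\tau\|\nabla_2c\|^2_{L^\infty(\rho\times\nu)}}}{2}$$ it converges with rate $$1-\frac{\varepsilon^2}{\varepsilon^2+\tau\varepsilon(\Lambda_c-\ell_c)+\tau\|\nabla_2c\|^2_{L^\infty(\rho\times\nu)}}.$$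
   Context: $\mathcal X$ is a Polish space, $\mathcal Y=\mathbb R^d$ with the Euclidean metric, $\rho\in\mathcal P(\mathcal X)$, $\nu\in\mathcal P(\mathcal Y)$, $\varepsilon>0$, $c:\mathcal X\times\mathcal Y\to\mathbb R$ twice differentiable in the second variable. $\nabla_2,\nabla_2^2$ are gradient and Hessian in the second variable; $\preceq$ is semidefinite order (a scalar stands for that multiple of the identity). $\mathscr H(p|q)=\int\log\frac{dp}{dq}dp$ ($+\infty$ if $p\not\ll q$). $\mathrm{TI}(\tau)$ for $\nu$ means $\mathbf W_2^2(\mu,\nu)\le2\tau\mathscr H(\mu|\nu)$ for all $\mu\in\mathcal P(\mathcal Y)$, where $\mathbf W_2$ is the Wasserstein distance of order two. $\pi^\nu_\varepsilon$ is the unique minimizer of $\inf_{\pi\in\Pi(\rho,\nu)}\int c\,d\pi+\varepsilon\mathscr H(\pi|\rho\otimes\nu)$, with $\Pi(\rho,\nu)$ the set of couplings; as throughout the paper, it is assumed to exist and to have $\rho\otimes\nu$-density of the form $\exp(-(c(x,y)+\varphi^\nu_\varepsilon(x)+\psi^\nu_\varepsilon(y))/\varepsilon)$. Sinkhorn's algorithm: starting from $\varphi^0_\varepsilon$ (typically $0$), for $n\ge0$, $\psi^n_\varepsilon(y)=\varepsilon\log\int e^{-(c(x,y)+\varphi^n_\varepsilon(x))/\varepsilon}\rho(dx)$ and $\varphi^{n+1}_\varepsilon(x)=\varepsilon\log\int e^{-(c(x,y)+\psi^n_\varepsilon(y))/\varepsilon}\nu(dy)$; $\pi^{n,n}$ has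 $\rho\otimes\nu$-density $e^{-(c+\varphi^n_\varepsilon(x)+\psi^n_\varepsilon(y))/\varepsilon}$. The initialization is assumed smooth enough that differentiation under the integral sign is justified along the iterates. For given $\varepsilon$: ''Sinkhorn's algorithm converges exponentially fast'' means there is $\kappa'\in(0,1)$ such that for all $n\ge1$, $\mathscr H(\pi^\nu_\varepsilon|\pi^{n+1,n+1})\le(1-\kappa')^n\mathscr H(\pi^\nu_\varepsilon|\pi^{0,0})$; ''with rate $1-\kappa$'' means this holds for all $n\ge1$ with $\kappa'=\kappa$.
   Formalization: The norms of g in (i) and of the gradient of c in (ii) are assumed finite, since compact support does not force this for a cost only measurable in x and the claim can then fail; that g does not depend on y is part of its defining hypothesis. *)

(* Defs.v *)
From HB Require Import structures.
From mathcomp Require Import all_boot all_order all_algebra.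
From mathcomp Require Import all_classical all_reals all_analysis ess_sup_inf.

Set Implicit Arguments.
Unset Strict Implicit.
Unset Printing Implicit Defensive.
Import Order.TTheory GRing.Theory Num.Theory.
Import numFieldNormedType.Exports.

Local Open Scope classical_set_scope.
Local Open Scope ring_scope.

Notation borel T := (g_sigma_algebraType (@open T)).

Definition supp (T : ptopologicalType) (R : realType)
    (mu : probability (borel T) R) : set T :=
  [set x | forall U : set T, open U -> U x -> (0 < mu U)%E].

(** Calculus on R^d. The library norm on ['rV[R]_d] is the sup norm (same
    topology and Borel sets), hence the separate Euclidean norm. *)

Definition enorm (R : realType) (d : nat) (v : 'rV[R]_d) : R :=
  Num.sqrt (\sum_(i < d) v 0 i ^+ 2).

Definition grad (R : realType) (d : nat) (f : 'rV[R]_d -> R) (y : 'rV[R]_d) :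
    'rV[R]_d :=
  \row_(i < d) 'D_(delta_mx 0 i) f y.

Definition hess (R : realType) (d : nat) (f : 'rV[R]_d -> R) (y : 'rV[R]_d) :
    'M[R]_d :=
  'J (grad f) y.

Definition twice_differentiable (R : realType) (d : nat)
    (f : 'rV[R]_d -> R) : Prop :=
  forall y, differentiable f y /\ differentiable (grad f) y.

Definition semidef_le (R : realType) (d : nat) (A B : 'M[R]_d) : Prop :=
  forall v : 'rV[R]_d, 0 <= (v *m (B - A) *m v^T) 0 0.

(** [L^oo] norm of a vector field, for the Euclidean norm; it may be [+oo]. *)
Definition Linfty_norm (disp : measure_display) (T : measurableType disp)
    (R : realType) (mu : probability T R) (d : nat) (F : T -> 'rV[R]_d) :
    \bar R :=
  ess_sup mu (fun x => (enorm (F x))%:E).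

(** [lne 0 = -oo], but the derivative vanishes only on a [p]-null set. *)
Definition rel_entropy (disp : measure_display) (T : measurableType disp)
    (R : realType) (p q : probability T R) : \bar R :=
  if `[< p `<< q >]
  then (\int[p]_x lne (Radon_Nikodym_SigmaFinite.f p q x))%E
  else +oo%E.

Definition prod_proba (disp1 disp2 : measure_display)
    (T1 : measurableType disp1) (T2 : measurableType disp2) (R : realType)
    (p : probability T1 R) (q : probability T2 R) :
    probability (T1 * T2)%type R := (p \x q)%E.

Definition coupling (disp1 disp2 : measure_display)
    (T1 : measurableType disp1) (T2 : measurableType disp2) (R : realType)
    (p : probability T1 R) (q : probability T2 R)
    (pi : probability (T1 * T2)%type R) : Prop :=
  (forall A, measurable A -> pi (fst @^-1` A) = p A) /\
  (forall B, measurable B -> pi (snd @^-1` B) = q B).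

Definition wasserstein2 (R : realType) (d : nat)
    (mu nu : probability (borel 'rV[R]_d) R) : \bar R :=
  (ereal_inf [set w | exists2 pi : probability
                        (borel 'rV[R]_d * borel 'rV[R]_d)%type R,
                      coupling mu nu pi &
                      w = \int[pi]_z ((enorm (z.1 - z.2)) ^+ 2)%:E]
   `^ 2^-1)%E.

Definition TI (R : realType) (d : nat) (tau : R)
    (nu : probability (borel 'rV[R]_d) R) : Prop :=
  forall mu : probability (borel 'rV[R]_d) R,
    (wasserstein2 mu nu ^+ 2 <= (2 * tau)%:E * rel_entropy mu nu)%E.

Section EntropicTransport.
Context {R : realType} {X : ptopologicalType} {d : nat}.
Variables (c : X -> 'rV[R]_d -> R) (eps : R).
Variables (rho : probability (borel X) R) (nu : probability (borel 'rV[R]_d) R).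

Implicit Types (pi : probability (borel X * borel 'rV[R]_d)%type R)
  (phi : X -> R) (psi : 'rV[R]_d -> R).

(** If the negative part of [c] is not [pi]-integrable, the first integral, hence
    the whole cost, is [-oo] by convention. *)
Definition eot_cost pi : \bar R :=
  (\int[pi]_z (c z.1 z.2)%:E + eps%:E * rel_entropy pi (prod_proba rho nu))%E.

(** Measures are total functions on sets, so uniqueness can only be asked on
    measurable sets. *)
Definition unique_eot_minimizer pi : Prop :=
  coupling rho nu pi /\
  forall pi', coupling rho nu pi' ->
    (eot_cost pi <= eot_cost pi')%E /\
    ((eot_cost pi' <= eot_cost pi)%E ->
      forall A, measurable A -> pi' A = pi A).

Definition gibbs phi psi (x : X) (y : 'rV[R]_d) : R :=
  expR (- ((c x y + phi x + psi y) / eps)).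

Definition has_gibbs_density phi psi pi : Prop :=
  forall A, measurable A ->
    pi A = (\int[prod_proba rho nu]_(z in A) (gibbs phi psi z.1 z.2)%:E)%E.

Definition half_gibbs_x phi (x : X) (y : 'rV[R]_d) : R :=
  expR (- ((c x y + phi x) / eps)).

Definition half_gibbs_y psi (x : X) (y : 'rV[R]_d) : R :=
  expR (- ((c x y + psi y) / eps)).

Definition psi_update phi : 'rV[R]_d -> R :=
  fun y => eps * ln (\int[rho]_x half_gibbs_x phi x y).

Definition phi_update psi : X -> R :=
  fun x => eps * ln (\int[nu]_y half_gibbs_y psi x y).

Fixpoint sinkhorn_phi (phi0 : X -> R) (n : nat) : X -> R :=
  if n is n'.+1 then phi_update (psi_update (sinkhorn_phi phi0 n')) else phi0.

Definition sinkhorn_psi (phi0 : X -> R) (n : nat) : 'rV[R]_d -> R :=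
  psi_update (sinkhorn_phi phi0 n).

(** [y |-> \int f x y rho(dx)] is twice differentiable, with gradient and
    Hessian obtained by differentiating [f] in [y] under the integral sign. *)
Definition twice_diff_under_integral (f : X -> 'rV[R]_d -> R) : Prop :=
  let F y := \int[rho]_x f x y in
  twice_differentiable F /\
  forall y,
  [/\ rho.-integrable setT (fun x => (f x y)%:E),
      forall i, rho.-integrable setT (fun x => (grad (f x) y 0 i)%:E),
      forall i j, rho.-integrable setT (fun x => (hess (f x) y i j)%:E),
      forall i, grad F y 0 i = \int[rho]_x (grad (f x) y 0 i) &
      forall i j, hess F y i j = \int[rho]_x (hess (f x) y i j)].

(** Well-posedness of the iterates ([Rintegral] is [0] on an infinite integral)
    and the standing smoothness assumption on the initialization. *)
Definition admissible_init (phi0 : X -> R) : Prop :=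
  measurable_fun (setT : set (borel X)) phi0 /\
  forall n,
    twice_diff_under_integral (half_gibbs_x (sinkhorn_phi phi0 n)) /\
    forall x, nu.-integrable setT
      (fun y => (half_gibbs_y (sinkhorn_psi phi0 n) x y)%:E).

(** [pin n] is the plan with potentials [sinkhorn_phi phi0 n] and
    [sinkhorn_psi phi0 n]; its total mass is 1 since its second marginal is
    [nu]. *)
Definition sinkhorn_plans (phi0 : X -> R)
    (pin : nat -> probability (borel X * borel 'rV[R]_d)%type R) : Prop :=
  forall n, has_gibbs_density (sinkhorn_phi phi0 n) (sinkhorn_psi phi0 n) (pin n).

End EntropicTransport.

Definition converges_with_rate (disp : measure_display)
    (T : measurableType disp) (R : realType) (pi : probability T R)
    (pin : nat -> probability T R) (r : R) : Prop :=
  forall n, (1 <= n)%N ->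
    (rel_entropy pi (pin n.+1) <= (r ^+ n)%:E * rel_entropy pi (pin 0%N))%E.

Definition converges_exponentially (disp : measure_display)
    (T : measurableType disp) (R : realType) (pi : probability T R)
    (pin : nat -> probability T R) : Prop :=
  exists2 kappa : R, 0 < kappa < 1 & converges_with_rate pi pin (1 - kappa).

(* Main.v *)
Require Import Defs.
From HB Require Import structures.
From mathcomp Require Import all_boot all_order all_algebra.
From mathcomp Require Import all_classical all_reals all_analysis ess_sup_inf.
From mathcomp Require Import measurable_realfun ring lra.
Import Order.TTheory GRing.Theory Num.Theory.
Import numFieldNormedType.Exports.
Local Open Scope classical_set_scope.
Local Open Scope ring_scope.

Set Implicit Arguments.
Unset Strict Implicit.
Unset Printing Implicit Defensive.

(** Let [E_n] be the logarithm of the density of the optimal plan with respect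
    to the [n]-th Sinkhorn plan, so that [E_n (x, y)] is the sum of
    [(phi_n - phi) x / eps] and [(psi_n - psi) y / eps], and the entropy
    [a_n] of the optimal plan is the mean of [E_n]. Two inequalities give the
    geometric decay of [a_n].

    One iteration removes two functions from the log-density:
    [E_n (x, y) = E_(n+1) (x, y) + u_n x + v_n y] with
    [u_n = (phi_n - phi_(n+1)) / eps] and [v_n = (psi_n - psi_(n+1)) / eps].
    The functions [exp (- u_n)] and [exp (- v_n)] are densities of marginals,
    hence have integral 1, so [u_n] and [v_n] have nonnegative means by
    convexity of exp. Dropping [v_n] gives [a_(n+1) <= a_n - U_n], where [U_n]
    is the mean of [u_n] (lemma [entropy_decrement]).

    Conversely [a_n <= p U_n] for all [p > 1 + K], where
    [K = tau M^2 / eps^2] and [M] bounds the Lipschitz constant of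
    [c x] up to terms that do not depend on [x] (lemma
    [entropy_le_phi_drop]). Together, [a_(n+1) <= (1 - 1 / p) a_n], and [p] may
    be taken down to [1 + K]. The second inequality rests on a strong convexity
    of the free energy
    [F h = \int nu(dy) ln (\int e^(- h x) f x y rho(dx) / \int f x y rho(dx))],
    where [f x y = exp (- (c x y + phi_n x) / eps)]. Minus the gradient of [F]
    at [h] is the first marginal [q] of the plan tilted by [e^(- h)], and its
    Hessian is the mean conditional variance. The variance under [q] is that
    mean conditional variance plus the variance of the conditional mean. When
    [y] moves by [z] the conditional law changes, up to normalization, by a
    factor between [e^(- k |z|)] and [e^(k |z|)], [k = M / eps], so the conditional mean of a
    function moves at speed at most [k] times its conditional standard
    deviation. The transport inequality, linearized at [nu], is a Poincare
    inequality with constant [tau], so the variance of the conditional mean is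
    at most [K] times the mean conditional variance (theorem [poincare_tilt]).
    Thus the Hessian of [F] dominates [1 / (1 + K)] times the variance under
    the marginal of the tilted plan. This local information integrates to the
    global inequality [F h >= p ln (\int e^(- h / p) dr)], [r] being the first
    marginal at [h = 0] (theorem [freeE_ge] for finitely many values of [x],
    theorem [kernel_free_energy_ge] in general). In dual form it bounds the
    convex conjugate of [F] by [p] times the entropy relative to [r]; it is
    proved along the segment from [r] to a target law, where the conjugate has a
    quadratic upper expansion and the entropy a quadratic lower expansion
    governed by the same chi-square quantity. Applied to
    [h = (phi - phi_n) / eps], for which [F h] is at most the mean of
    [(psi - psi_n) / eps], and with Jensen's inequality for the logarithm on the
    right, it becomes [a_n <= p U_n].

    If the Hessian of the cost in [y] is constant, [c x y' - c x y] is
    [g x . (y' - y)] plus a term independent of [x], so [M] is the norm of [g].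
    If [nu] has compact support, a bound on the gradient on the support gives
    the local Lipschitz bound by compactness; the contribution
    [tau (L - l) / eps] of the Hessian bounds is nonnegative, so that
    [p = 1 + tau (L - l) / eps + tau M^2 / eps^2] is admissible. *)

(** * Taylor inequalities for exp and ln *)

Lemma deriv_ge0_le (R : realType) (f df : R -> R) (a b : R) : a <= b ->
  (forall x, a <= x <= b -> is_derive x 1 f (df x)) ->
  (forall x, a <= x <= b -> 0 <= df x) -> f a <= f b.
Proof.
move=> ab fdf df0; have [||c] := @MVT_segment R f df a b ab.
- by move=> x /itvP xab; apply: fdf; rewrite !xab.
- apply: derivable_within_continuous => x /itvP xab.
  by have /fdf [] : a <= x <= b by rewrite !xab.
move=> /itvP cab fab; rewrite -subr_ge0 fab mulr_ge0 ?subr_ge0// df0// !cab//.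
Qed.

Lemma deriv_le0_ge (R : realType) (f df : R -> R) (a b : R) : a <= b ->
  (forall x, a <= x <= b -> is_derive x 1 f (df x)) ->
  (forall x, a <= x <= b -> df x <= 0) -> f b <= f a.
Proof.
move=> ab fdf df0; have [||c] := @MVT_segment R f df a b ab.
- by move=> x /itvP xab; apply: fdf; rewrite !xab.
- apply: derivable_within_continuous => x /itvP xab.
  by have /fdf [] : a <= x <= b by rewrite !xab.
move=> /itvP cab fab; rewrite -subr_le0 fab mulr_le0_ge0 ?subr_ge0// df0// !cab//.
Qed.

Section Elementary.
Context {R : realType}.
Implicit Types x t : R.

(** The third derivative of exp is positive, so its quadratic Taylor polynomial lies
    below it on the right of 0 and above it on the left. *)
Lemma expR_taylor2_sign x :
  (0 <= x -> 1 + x + x ^+ 2 / 2 <= expR x) /\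
  (x <= 0 -> expR x <= 1 + x + x ^+ 2 / 2).
Proof.
pose f := fun x : R => expR x - (1 + x + x ^+ 2 / 2).
pose df := fun x : R => expR x - (1 + x).
have fdf (y : R) : is_derive (y : R) (1 : R) f (df y).
  by apply: is_derive_eq; rewrite /df /GRing.scale /=; field.
have df0 (y : R) : 0 <= df y by rewrite /df subr_ge0 expR_ge1Dx.
have f0 : f 0 = 0 by rewrite /f expR0; ring.
split=> x0.
- have := @deriv_ge0_le R f df 0 x x0 (fun y _ => fdf y) (fun y _ => df0 y).
  by rewrite f0 /f subr_ge0.
- have := @deriv_ge0_le R f df x 0 x0 (fun y _ => fdf y) (fun y _ => df0 y).
  by rewrite f0 /f subr_le0.
Qed.

Lemma expR_ge_taylor3 x : 1 + x + x ^+ 2 / 2 + x ^+ 3 / 6 <= expR x.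
Proof.
pose f := fun x : R => expR x - (1 + x + x ^+ 2 / 2 + x ^+ 3 / 6).
pose df := fun x : R => expR x - (1 + x + x ^+ 2 / 2).
have fdf (y : R) : is_derive (y : R) (1 : R) f (df y).
  by apply: is_derive_eq; rewrite /df /GRing.scale /=; field.
have f0 : f 0 = 0 by rewrite /f expR0; field.
rewrite -subr_ge0 -[leRHS]/(f x) -f0; have [x0|/ltW x0] := leP 0 x.
- apply: (@deriv_ge0_le R f df) => // y /andP[y0 _].
  by rewrite /df subr_ge0; apply: (expR_taylor2_sign y).1.
- apply: (@deriv_le0_ge R f df) => // y /andP[_ y0].
  by rewrite /df subr_le0; apply: (expR_taylor2_sign y).2.
Qed.

Lemma is_derive_ln1D t : -1 < t -> is_derive t 1 (fun t : R => ln (1 + t)) (1 + t)^-1.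
Proof.
move=> t1; have t0 : 0 < 1 + t by lra.
have H := is_derive1_ln t0.
have Hf : is_derive (t : R) (1 : R) (fun t : R => 1 + t) (1 : R).
  have := @is_deriveD _ _ _ (cst (1 : R)) id t 1 0 1 _ _.
  by rewrite add0r; apply.
by have := is_derive1_comp H Hf; rewrite mulr1.
Qed.

Lemma ln1D_taylor2_sign t : -1 < t ->
  (0 <= t -> t - t ^+ 2 / 2 <= ln (1 + t)) /\
  (t <= 0 -> ln (1 + t) <= t - t ^+ 2 / 2).
Proof.
move=> t1; pose f := fun x : R => ln (1 + x) - (x - x ^+ 2 / 2).
pose df := fun x : R => (1 + x)^-1 - (1 - x).
have fdf (y : R) : -1 < y -> is_derive (y : R) (1 : R) f (df y).
  move=> y1; have H := is_derive_ln1D y1.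
  by apply: is_derive_eq; rewrite /df /GRing.scale /=; field; rewrite gt_eqF//; lra.
have df0 (y : R) : -1 < y -> 0 <= df y.
  move=> y1; have y0 : 0 < 1 + y by lra.
  rewrite (_ : df y = y ^+ 2 / (1 + y)); last first.
    by rewrite /df; field; rewrite gt_eqF.
  by rewrite divr_ge0 ?sqr_ge0// ltW.
have f0 : f 0 = 0 by rewrite /f addr0 ln1; field.
split=> x0.
- have := @deriv_ge0_le R f df 0 t x0; rewrite f0 /f subr_ge0; apply.
  + by move=> y /andP[y0 _]; apply: fdf; lra.
  + by move=> y /andP[y0 _]; apply: df0; lra.
- have := @deriv_ge0_le R f df t 0 x0; rewrite f0 /f subr_le0; apply.
  + by move=> y /andP[y0 _]; apply: fdf; lra.
  + by move=> y /andP[y0 _]; apply: df0; lra.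
Qed.

(** The cubic coefficient 2/3 is twice the Taylor coefficient: the derivative of the
    difference is then [y^2 (1 + 2 y) / (1 + y)], of constant sign from [-1/2] on. *)
Lemma ln1D_taylor3_sign t : -2^-1 <= t ->
  (0 <= t -> ln (1 + t) <= t - t ^+ 2 / 2 + 2 / 3 * t ^+ 3) /\
  (t <= 0 -> t - t ^+ 2 / 2 + 2 / 3 * t ^+ 3 <= ln (1 + t)).
Proof.
move=> t1; pose f := fun x : R => (x - x ^+ 2 / 2 + 2 / 3 * x ^+ 3) - ln (1 + x).
pose df := fun x : R => (1 - x + 2 * x ^+ 2) - (1 + x)^-1.
have fdf (y : R) : -2^-1 <= y -> is_derive (y : R) (1 : R) f (df y).
  move=> y1; have H : is_derive (y : R) (1 : R) (fun t : R => ln (1 + t)) (1 + y)^-1.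
    by apply: is_derive_ln1D; lra.
  by apply: is_derive_eq; rewrite /df /GRing.scale /=; field; rewrite gt_eqF//; lra.
have df0 (y : R) : -2^-1 <= y -> 0 <= df y.
  move=> y1; have y0 : 0 < 1 + y by lra.
  rewrite (_ : df y = y ^+ 2 * (1 + 2 * y) / (1 + y)); last first.
    by rewrite /df; field; rewrite gt_eqF.
  apply: divr_ge0; last by lra. apply: mulr_ge0; [exact: sqr_ge0|lra].
have f0 : f 0 = 0 by rewrite /f addr0 ln1; field.
split=> x0.
- have := @deriv_ge0_le R f df 0 t x0; rewrite f0 /f subr_ge0; apply.
  + by move=> y /andP[y0 _]; apply: fdf; lra.
  + by move=> y /andP[y0 _]; apply: df0; lra.
- have := @deriv_ge0_le R f df t 0 x0; rewrite f0 /f subr_le0; apply.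
  + by move=> y /andP[y0 _]; apply: fdf; lra.
  + by move=> y /andP[y0 _]; apply: df0; lra.
Qed.

Lemma xlnx_derive t : -1 < t ->
  is_derive t 1 (fun t : R => (1 + t) * ln (1 + t)) (1 + ln (1 + t)).
Proof.
move=> t1; have H := is_derive_ln1D t1.
have N0 : 1 + t != 0 by rewrite gt_eqF//; lra.
by apply: is_derive_eq; rewrite /GRing.scale /= mulfV// add0r mulr1.
Qed.

Lemma xlnx_ge t : -1 < t ->
  t + t ^+ 2 / 2 - t ^+ 3 / 6 <= (1 + t) * ln (1 + t).
Proof.
move=> t1; pose f := fun x : R => (1 + x) * ln (1 + x) - (x + x ^+ 2 / 2 - x ^+ 3 / 6).
pose df := fun x : R => ln (1 + x) - (x - x ^+ 2 / 2).
have fdf (y : R) : -1 < y -> is_derive (y : R) (1 : R) f (df y).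
  move=> y1; have H := xlnx_derive y1.
  have Hp : is_derive (y : R) (1 : R) (fun x : R => x + x ^+ 2 / 2 - x ^+ 3 / 6) (1 + (y - y ^+ 2 / 2)).
    by apply: is_derive_eq; rewrite /GRing.scale /=; field.
  have -> : df y = (1 + ln (1 + y)) - (1 + (y - y ^+ 2 / 2)) by rewrite /df; ring.
  exact: (@is_deriveB _ _ _ _ _ _ _ _ _ H Hp).
have f0 : f 0 = 0 by rewrite /f addr0 ln1; field.
rewrite -subr_ge0 -[leRHS]/(f t) -f0; have [x0|/ltW x0] := leP 0 t.
- apply: (@deriv_ge0_le R f df) => // y /andP[y0 yt]; first by apply: fdf; lra.
  by rewrite /df subr_ge0; apply: (ln1D_taylor2_sign _).1 => //; lra.
- apply: (@deriv_le0_ge R f df) => // y /andP[y0 yt]; first by apply: fdf; lra.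
  by rewrite /df subr_le0; apply: (ln1D_taylor2_sign _).2 => //; lra.
Qed.

(** The quartic error term makes this an upper bound for the entropy of a small
    perturbation [1 + t] of the density 1. *)
Lemma xlnx_le t : -2^-1 <= t ->
  (1 + t) * ln (1 + t) <= t + t ^+ 2 / 2 - t ^+ 3 / 6 + t ^+ 4 / 6.
Proof.
move=> t1; pose f := fun x : R => (x + x ^+ 2 / 2 - x ^+ 3 / 6 + x ^+ 4 / 6) - (1 + x) * ln (1 + x).
pose df := fun x : R => (x - x ^+ 2 / 2 + 2 / 3 * x ^+ 3) - ln (1 + x).
have fdf (y : R) : -2^-1 <= y -> is_derive (y : R) (1 : R) f (df y).
  move=> y1; have H : is_derive (y : R) (1 : R) (fun t : R => (1 + t) * ln (1 + t)) (1 + ln (1 + y)).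
    by apply: xlnx_derive; lra.
  have Hp : is_derive (y : R) (1 : R) (fun x : R => x + x ^+ 2 / 2 - x ^+ 3 / 6 + x ^+ 4 / 6)
      (1 + (y - y ^+ 2 / 2 + 2 / 3 * y ^+ 3)).
    by apply: is_derive_eq; rewrite /GRing.scale /=; field.
  have -> : df y = (1 + (y - y ^+ 2 / 2 + 2 / 3 * y ^+ 3)) - (1 + ln (1 + y)) by rewrite /df; ring.
  exact: (@is_deriveB _ _ _ _ _ _ _ _ _ Hp H).
have f0 : f 0 = 0 by rewrite /f addr0 ln1; field.
suff : f 0 <= f t by rewrite f0 {1}/f subr_ge0.
have dfp (y : R) : 0 <= y -> 0 <= df y.
  by move=> y0; rewrite /df subr_ge0; apply: (ln1D_taylor3_sign _).1 => //; lra.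
have dfn (y : R) : -2^-1 <= y -> y <= 0 -> df y <= 0.
  by move=> y1 y0; rewrite /df subr_le0; apply: (ln1D_taylor3_sign _).2.
clear f0; move: f df fdf dfp dfn => f df fdf dfp dfn.
have [x0|/ltW x0] := leP 0 t.
- apply: (@deriv_ge0_le R f df _ _ x0) => y /andP[y0 yt]; last exact: dfp.
  by apply: fdf; lra.
- apply: (@deriv_le0_ge R f df _ _ x0) => y /andP[y0 yt]; first by apply: fdf; lra.
  by apply: dfn => //; lra.
Qed.

End Elementary.

(** * Expectations of bounded measurable functions *)

Lemma Rintegral_gt0 dT (T : measurableType dT) (R : realType) (P : probability T R) (F : T -> R) :
  P.-integrable setT (fun x => (F x)%:E) -> (forall x, 0 < F x) -> 0 < \int[P]_x F x.
Proof.
move=> iF F0; rewrite lt_neqAle eq_sym; apply/andP; split; last first.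
  by apply: Rintegral_ge0 => x _; rewrite ltW.
apply/negP => /eqP k0.
have : (\int[P]_x `|(F x)%:E| = 0)%E.
  under eq_integral do rewrite gee0_abs ?lee_fin ?(ltW (F0 _))//.
  by rewrite -[LHS]fineK ?(integrable_fin_num measurableT iF)// -[fine _]/(\int[P]_x F x) k0.
move/(ae_eq_integral_abs P measurableT (measurable_int P iF)) => [N [mN N0 sN]].
have : P setT = 0%E.
  apply/eqP; rewrite -measure_le0 -[leRHS]N0; apply: le_measure; rewrite ?inE//.
  by move=> x _; apply: sN => /= /(_ Logic.I) [] /eqP; rewrite gt_eqF.
by rewrite probability_setT => /eqP; rewrite onee_eq0.
Qed.

Section BoundedMeasurable.
Context d (T : measurableType d) (R : realType).
Implicit Types (f g : T -> R).

(** Closed under the ring operations and integrable against every probability, so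
    that expectations of such functions can be manipulated without side conditions. *)
Definition bounded_mfun f :=
  measurable_fun setT f /\ exists B, forall x, `|f x| <= B.

Lemma bmfun_cst (r : R) : bounded_mfun (fun=> r).
Proof. by split; [exact: measurable_cst|exists `|r|]. Qed.

Lemma bmfunD f g : bounded_mfun f -> bounded_mfun g -> bounded_mfun (fun x => f x + g x).
Proof.
move=> [mf [B fB]] [mg [C gC]]; split; first exact: measurable_funD.
by exists (B + C) => x; rewrite (le_trans (ler_normD _ _))// lerD.
Qed.

Lemma bmfunN f : bounded_mfun f -> bounded_mfun (fun x => - f x).
Proof.
move=> [mf [B fB]]; split; first exact: measurableT_comp.
by exists B => x; rewrite normrN.
Qed.

Lemma bmfunB f g : bounded_mfun f -> bounded_mfun g -> bounded_mfun (fun x => f x - g x).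
Proof. by move=> bf /bmfunN; exact: bmfunD. Qed.

Lemma bmfunM f g : bounded_mfun f -> bounded_mfun g -> bounded_mfun (fun x => f x * g x).
Proof.
move=> [mf [B fB]] [mg [C gC]]; split; first exact: measurable_funM.
by exists (B * C) => x; rewrite normrM ler_pM.
Qed.

Lemma bmfunX f n : bounded_mfun f -> bounded_mfun (fun x => f x ^+ n).
Proof.
move=> bf; elim: n => [|n IH].
  by under eq_fun do rewrite expr0; exact: bmfun_cst.
by under eq_fun do rewrite exprS; exact: bmfunM.
Qed.

Lemma bmfun_sum I (s : seq I) (P : pred I) (F : I -> T -> R) :
  (forall i, bounded_mfun (F i)) -> bounded_mfun (fun x => \sum_(i <- s | P i) F i x).
Proof.
move=> bF; elim: s => [|i s IH].
  by under eq_fun do rewrite big_nil; exact: bmfun_cst.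
under eq_fun do rewrite big_cons.
by case: (P i) => //; exact: bmfunD.
Qed.

Lemma bmfun_le f (B : R) : measurable_fun setT f -> (forall x, 0 <= f x <= B) -> bounded_mfun f.
Proof.
move=> mf fB; split=> //; exists B => x; have /andP[f0 fb] := fB x.
by rewrite ger0_norm.
Qed.

Lemma measurable_fun_invr_gt0 f : measurable_fun setT f -> (forall x, 0 < f x) ->
  measurable_fun setT (fun x => (f x)^-1).
Proof.
move=> mf f0; rewrite (_ : (fun x => _) = (fun x => expR (- ln (f x)))); last first.
  by apply/funext => x; rewrite expRN lnK// posrE.
by do 2![apply: measurableT_comp => //]; exact: measurableT_comp.
Qed.

Variable P : probability T R.

Lemma bmfun_int f : bounded_mfun f -> P.-integrable setT (EFin \o f).
Proof.
move=> [mf [B fB]]; apply: measurable_bounded_integrable => //.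
  by apply: (le_lt_trans (probability_le1 _ _)); rewrite ?ltry.
exists B; split; first by rewrite num_real.
by move=> M BM x _ /=; apply: le_trans (fB x) _; exact: ltW.
Qed.

Lemma EI_cst (r : R) : \int[P]_x (fun=> r) x = r.
Proof. by rewrite Rintegral_cst//= probability_setT mulr1. Qed.

Lemma EID f g : bounded_mfun f -> bounded_mfun g ->
  \int[P]_x (f x + g x) = \int[P]_x f x + \int[P]_x g x.
Proof. by move=> bf bg; rewrite RintegralD//; exact: bmfun_int. Qed.

Lemma EIB f g : bounded_mfun f -> bounded_mfun g ->
  \int[P]_x (f x - g x) = \int[P]_x f x - \int[P]_x g x.
Proof. by move=> bf bg; rewrite RintegralB//; exact: bmfun_int. Qed.

Lemma EIZ (r : R) f : bounded_mfun f -> \int[P]_x (r * f x) = r * \int[P]_x f x.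
Proof. by move=> bf; rewrite RintegralZl//; exact: bmfun_int. Qed.

Lemma EIZr (r : R) f : bounded_mfun f -> \int[P]_x (f x * r) = (\int[P]_x f x) * r.
Proof. by move=> bf; rewrite RintegralZr//; exact: bmfun_int. Qed.

Lemma EI_le f g : bounded_mfun f -> bounded_mfun g -> (forall x, f x <= g x) ->
  \int[P]_x f x <= \int[P]_x g x.
Proof. by move=> bf bg fg; apply: le_Rintegral => //; exact: bmfun_int. Qed.

Lemma EI_sum I (s : seq I) (Q : pred I) (F : I -> T -> R) :
  (forall i, bounded_mfun (F i)) ->
  \int[P]_x (\sum_(i <- s | Q i) F i x) = \sum_(i <- s | Q i) \int[P]_x F i x.
Proof.
move=> bF; elim: s => [|i s IH].
  by under eq_Rintegral do rewrite big_nil; rewrite big_nil EI_cst.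
under eq_Rintegral do rewrite big_cons; rewrite big_cons.
case: (Q i) => //; rewrite EID// ?IH//; exact: bmfun_sum.
Qed.

Lemma EI_ge f r : bounded_mfun f -> (forall x, r <= f x) -> r <= \int[P]_x f x.
Proof.
by move=> bf rf; rewrite -[leLHS](EI_cst r); apply: EI_le => //; exact: bmfun_cst.
Qed.

Lemma EI_le_cst f r : bounded_mfun f -> (forall x, f x <= r) -> \int[P]_x f x <= r.
Proof.
by move=> bf rf; rewrite -[leRHS](EI_cst r); apply: EI_le => //; exact: bmfun_cst.
Qed.

Lemma EI_gt0 f : bounded_mfun f -> (forall x, 0 < f x) -> 0 < \int[P]_x f x.
Proof. by move=> bf; apply: Rintegral_gt0; exact: bmfun_int. Qed.

(** A positive function has small sublevel sets, by continuity of the measure along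
    the sets [f < 1 / (n + 1)], whose intersection is empty. *)
Lemma small_sublevel f (r : R) : measurable_fun setT f -> (forall x, 0 < f x) -> 0 < r ->
  exists2 e : R, 0 < e <= 1 & (P [set x | (f x < e)%R] < r%:E)%E.
Proof.
move=> mf f0 r0; pose F n : set T := [set x | f x < n.+1%:R^-1].
have mF n : measurable (F n).
  rewrite /F -[X in measurable X]setTI -preimage_itvNyo; apply: mf => //.
have F0 : \bigcap_n F n = set0.
  rewrite -subset0 => x /= Fx; have [k] := ltr_add_invr (f0 x).
  by rewrite add0r => /(lt_trans (Fx k Logic.I)); rewrite ltxx.
have : P (F n) @[n --> \oo] --> P (\bigcap_n F n).
  apply: nonincreasing_cvg_mu => //; last 2 first.
  - by rewrite F0.
  - move=> n m nm; apply/subsetPset => x; rewrite /F /= => /lt_le_trans; apply.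
    by rewrite lef_pV2 ?posrE// ler_nat.
  by apply: (le_lt_trans (probability_le1 _ _)); rewrite ?ltry.
rewrite F0 measure0 => /fine_cvgP[_] /cvgrPdist_lt /(_ _ r0)[n _ /(_ n (leqnn _))] /=.
rewrite sub0r normrN => Fr; exists n.+1%:R^-1.
  by rewrite invr_gt0 ltr0n/= invf_le1// ler1n.
rewrite -/(F n) -[ltLHS]fineK; last by rewrite fin_num_measure.
by rewrite lte_fin; apply: le_lt_trans (ler_norm _) Fr.
Qed.

End BoundedMeasurable.

(** * Finite laws and their Laplace transforms *)

Lemma eq_leW (R : realType) (x y : R) : x = y -> x <= y.
Proof. by move=> ->. Qed.

Section FiniteLaws.
Context {R : realType} (I : finType).
Implicit Types (q g : I -> R).

Definition fmean q g : R := \sum_j q j * g j.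
Definition fvar q g : R := \sum_j q j * g j ^+ 2 - fmean q g ^+ 2.
(** The exponent is negated because [g] plays the role of a potential. *)
Definition fmgf q g : R := \sum_j q j * expR (- g j).

Definition flaw q : Prop := (forall j, 0 <= q j) /\ \sum_j q j = 1.

Lemma fmeanD q g g' : fmean q (fun j => g j + g' j) = fmean q g + fmean q g'.
Proof. by rewrite /fmean -big_split; apply: eq_bigr => j _; rewrite mulrDr. Qed.

Lemma fmeanZ q (c : R) g : fmean q (fun j => c * g j) = c * fmean q g.
Proof. by rewrite /fmean mulr_sumr; apply: eq_bigr => j _; rewrite mulrCA. Qed.

Lemma fmeanN q g : fmean q (fun j => - g j) = - fmean q g.
Proof. by rewrite /fmean -sumrN; apply: eq_bigr => j _; rewrite mulrN. Qed.

Lemma fmean_cst q (c : R) : flaw q -> fmean q (fun=> c) = c.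
Proof. by move=> [_ q1]; rewrite /fmean -mulr_suml q1 mul1r. Qed.

Lemma fmean_le q g g' : flaw q -> (forall j, g j <= g' j) -> fmean q g <= fmean q g'.
Proof. by move=> [q0 _] gg'; apply: ler_sum => j _; rewrite ler_wpM2l. Qed.

Lemma fmgf_gt0 q g : flaw q -> 0 < fmgf q g.
Proof.
move=> [q0 q1]; rewrite lt_neqAle eq_sym; apply/andP; split; last first.
  by apply: sumr_ge0 => j _; rewrite mulr_ge0// expR_ge0.
apply/negP => /eqP /psumr_eq0P s0.
have : (\sum_j q j) = 0.
  apply: big1 => j _; have := s0 (fun j _ => mulr_ge0 (q0 j) (expR_ge0 (- g j))) j isT.
  by move/eqP; rewrite mulf_eq0 (gt_eqF (expR_gt0 _)) orbF => /eqP.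
by rewrite q1 => /eqP; rewrite oner_eq0.
Qed.

(** Jensen's inequality. *)
Lemma ln_fmgf_ge_mean q g : flaw q -> - fmean q g <= ln (fmgf q g).
Proof.
move=> fq; have S0 := fmgf_gt0 g fq.
set L := ln _; have SL : fmgf q g = expR L by rewrite lnK// posrE.
suff : 1 - fmean q g - L <= 1 by lra.
have e1 : fmgf q g * expR (- L) = 1 by rewrite SL -expRD subrr expR0.
rewrite -[leRHS]e1 /fmgf mulr_suml.
rewrite (_ : 1 - fmean q g - L = fmean q (fun j => 1 + (- g j - L))); last first.
  by rewrite !fmeanD !(fmean_cst _ fq) fmeanN; lra.
case: fq => q0 _; apply: ler_sum => j _.
by rewrite -mulrA -expRD ler_wpM2l// expR_ge1Dx.
Qed.

(** Convexity of the log-Laplace transform along a ray, where it vanishes at the origin. *)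
Lemma ln_fmgf_scale q g (l : R) : flaw q -> 0 <= l <= 1 ->
  ln (fmgf q (fun j => l * g j)) <= l * ln (fmgf q g).
Proof.
move=> fq /andP[l0 l1]; have S0 := fmgf_gt0 g fq.
set L := ln (fmgf q g); have SL : fmgf q g = expR L by rewrite lnK// posrE.
rewrite -ler_expR lnK; last by rewrite posrE; exact: fmgf_gt0.
have e1 : fmgf q g * expR (- L) = 1 by rewrite SL -expRD subrr expR0.
have key a : expR (l * a) <= l * expR a + (1 - l).
  have A := expR_ge1Dx (a - l * a); have B := expR_ge1Dx (- (l * a)).
  have E1 : expR (l * a) * expR (a - l * a) = expR a by rewrite -expRD subrKC.
  have E2 : expR (l * a) * expR (- (l * a)) = 1 by rewrite -expRD subrr expR0.
  have A1 := ler_wpM2l l0 (ler_wpM2l (expR_ge0 (l * a)) A); rewrite E1 in A1.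
  have l1' : 0 <= 1 - l by lra.
  have B1 := ler_wpM2l l1' (ler_wpM2l (expR_ge0 (l * a)) B); rewrite E2 mulr1 in B1.
  have := lerD A1 B1; apply: le_trans; apply: eq_leW; ring.
have : fmgf q (fun j => l * g j) * expR (- (l * L)) <= 1.
  rewrite /fmgf mulr_suml.
  apply: (@le_trans _ _ (\sum_j (l * (q j * expR (- g j)) * expR (- L) + (1 - l) * q j))).
    case: fq => q0 _; apply: ler_sum => j _.
    rewrite -mulrA -expRD.
    have -> : - (l * g j) - l * L = l * (- g j - L) by ring.
    apply: le_trans (ler_wpM2l (q0 j) (key _)) _.
    by rewrite expRD; apply: eq_leW; ring.
  case: fq => q0 q1.
  rewrite big_split -mulr_suml -mulr_sumr -/(fmgf q g) -mulrA e1 -mulr_sumr q1.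
  by rewrite /=; lra.
by rewrite expRN ler_pdivrMr ?expR_gt0// mul1r.
Qed.

Lemma fvarE q g : flaw q -> fvar q g = \sum_j q j * (g j - fmean q g) ^+ 2.
Proof.
move=> fq; have q1 := fq.2.
have -> : \sum_j q j * (g j - fmean q g) ^+ 2 =
  \sum_j (q j * g j ^+ 2 + (- 2 * fmean q g) * (q j * g j) + fmean q g ^+ 2 * q j).
  by apply: eq_bigr => j _; ring.
by rewrite !big_split /= -!mulr_sumr -/(fmean q g) q1 /fvar; ring.
Qed.

Lemma fvar_ge0 q g : flaw q -> 0 <= fvar q g.
Proof.
move=> fq; rewrite fvarE//; apply: sumr_ge0 => j _; rewrite mulr_ge0 ?sqr_ge0//.
exact: fq.1.
Qed.

Lemma fmgf_shift q g (c : R) : fmgf q (fun j => g j + c) = expR (- c) * fmgf q g.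
Proof.
by rewrite /fmgf mulr_sumr; apply: eq_bigr => j _; rewrite opprD expRD; ring.
Qed.

Lemma fmean_norm_le q g (b : R) : flaw q -> (forall j, `|g j| <= b) -> `|fmean q g| <= b.
Proof.
move=> fq gb; rewrite ler_norml; apply/andP; split.
  rewrite -(fmean_cst (- b) fq); apply: fmean_le => // j.
  by have := gb j; rewrite ler_norml => /andP[].
rewrite -(fmean_cst b fq); apply: fmean_le => // j.
by have := gb j; rewrite ler_norml => /andP[].
Qed.

(** The log-Laplace transform of a centered function is half its variance to second
    order; a small uniform bound on the function controls the relative error. *)
Lemma ln_fmgf_lower q g (b : R) : flaw q -> 0 <= b <= 1 / 4 ->
  (forall j, `|g j| <= b) ->
  - fmean q g + 2^-1 * (1 - 4 * b) * fvar q g <= ln (fmgf q g).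
Proof.
move=> fq /andP[b0 b1] gb; have q0 := fq.1; have q1 := fq.2.
set m := fmean q g; set V := fvar q g.
have V0 : 0 <= V by exact: fvar_ge0.
have mb : `|m| <= b by exact: fmean_norm_le.
have x2b j : `|g j - m| <= 2 * b.
  by rewrite (le_trans (ler_normB _ _))//; have := gb j; lra.
have sq j : (g j - m) ^+ 2 <= 4 * b ^+ 2.
  rewrite -real_normK ?num_real// (_ : 4 * b ^+ 2 = (2 * b) ^+ 2); last by ring.
  by rewrite lerXn2r ?nnegrE ?mulr_ge0.
have V4 : V <= 4 * b ^+ 2.
  rewrite /V fvarE// -[leRHS]mul1r -[X in _ <= X * _]q1 mulr_suml; apply: ler_sum => j _.
  by rewrite ler_wpM2l.
pose t := 2^-1 * (1 - 2 * b) * V.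
have t0 : 0 <= t by rewrite /t !mulr_ge0//; lra.
have lnt : 2^-1 * (1 - 4 * b) * V <= ln (1 + t).
  have [+ _] := @ln1D_taylor2_sign R t ltac:(lra).
  move=> /(_ t0); apply: le_trans.
  have tb : t <= 2 * b ^+ 2.
    have : 2^-1 * (1 - 2 * b) * V <= 2^-1 * V by rewrite ler_wpM2r//; lra.
    by rewrite /t; lra.
  have : t * (2 * b ^+ 2 - t) >= 0 by rewrite mulr_ge0// subr_ge0.
  have : b * b * b * V >= 0 by rewrite !mulr_ge0.
  have : V * b * (1 - b) >= 0 by rewrite !mulr_ge0//; lra.
  have : V * b >= 0 by rewrite !mulr_ge0//; lra.
  rewrite /t; nra.
have Sm : fmgf q g = expR (- m) * fmgf q (fun j => g j - m).
  rewrite -fmgf_shift; apply: eq_bigr => j _; congr (_ * expR _); ring.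
have S0 := fmgf_gt0 (fun j => g j - m) fq.
rewrite Sm lnM ?posrE ?expR_gt0// expRK lerD2l.
apply: le_trans lnt _; rewrite ler_ln ?posrE//; last by lra.
have -> : 1 + t = \sum_j (q j * (1 - (g j - m) + 2^-1 * (1 - 2 * b) * (g j - m) ^+ 2)).
  have -> : \sum_j (q j * (1 - (g j - m) + 2^-1 * (1 - 2 * b) * (g j - m) ^+ 2)) =
    \sum_j (q j - (q j * g j) + m * q j + 2^-1 * (1 - 2 * b) * (q j * (g j - m) ^+ 2)).
    by apply: eq_bigr => j _; ring.
  rewrite !big_split /= sumrN -!mulr_sumr q1 -/(fmean q g) -fvarE// -/m /t -/V.
  by ring.
apply: ler_sum => j _; apply: ler_wpM2l => //.
apply: le_trans (expR_ge_taylor3 _).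
have := x2b j; rewrite ler_norml => /andP[xl xr].
set x := g j - m in xl xr *.
have : 0 <= x ^+ 2 * (2 * b - x) by rewrite mulr_ge0 ?sqr_ge0// subr_ge0.
have : 0 <= x ^+ 2 * b by rewrite mulr_ge0 ?sqr_ge0.
nra.
Qed.

(** A crude quadratic upper bound, from [e^(- x) <= 1 - x + x^2] on [[-1, 1]]. *)
Lemma ln_fmgf_upper q g : flaw q -> (forall j, `|g j| <= 1) ->
  ln (fmgf q g) <= - fmean q g + \sum_j q j * g j ^+ 2.
Proof.
move=> fq g1; have q1 := fq.2; have S0 := fmgf_gt0 g fq.
have : ln (1 + (fmgf q g - 1)) <= fmgf q g - 1 by apply: le_ln1Dx; lra.
rewrite addrC subrK => /le_trans; apply.
have -> : - fmean q g + \sum_j q j * g j ^+ 2 = \sum_j q j * (1 - g j + g j ^+ 2) - 1.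
  rewrite -[X in _ - X]q1 -sumrN -sumrN -!big_split /=; apply: eq_bigr => j _; ring.
rewrite lerD2r; apply: ler_sum => j _; apply: ler_wpM2l; first exact: fq.1.
have /ler_normlP[xl xr] := g1 j; move: (g j) xl xr => x xl xr.
have A := expR_ge_taylor3 x.
have x3 : 0 <= x ^+ 2 * (1 + x) by rewrite mulr_ge0 ?sqr_ge0//; lra.
have P0 : 0 < 1 + x + x ^+ 2 / 2 + x ^+ 3 / 6 by nra.
rewrite expRN; apply: (@le_trans _ _ (1 + x + x ^+ 2 / 2 + x ^+ 3 / 6)^-1).
  by rewrite lef_pV2 ?posrE// expR_gt0.
rewrite -[leLHS]mul1r ler_pdivrMr//.
have x4 : 0 <= x ^+ 2 * (1 - x) by rewrite mulr_ge0 ?sqr_ge0//; lra.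
have := sqr_ge0 x; have := sqr_ge0 (x ^+ 2).
have : (1 - x + x ^+ 2) * (1 + x + x ^+ 2 / 2 + x ^+ 3 / 6) - 1 =
  x ^+ 2 / 2 + x ^+ 3 * (2/3) + x ^+ 4 / 3 + x ^+ 5 / 6 by field.
have : x ^+ 2 / 2 + x ^+ 3 * (2/3) + x ^+ 4 / 3 + x ^+ 5 / 6 =
  x ^+ 2 * (2^-1 + x * (2/3) + x ^+ 2 / 3 + x ^+ 3 / 6) by ring.
move=> -> E ? ?.
suff : 0 <= 2^-1 + x * (2/3) + x ^+ 2 / 3 + x ^+ 3 / 6 => [H|].
  have : 0 <= x ^+ 2 * (2^-1 + x * (2/3) + x ^+ 2 / 3 + x ^+ 3 / 6) by rewrite mulr_ge0.
  by rewrite -E; lra.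
by nra.
Qed.

End FiniteLaws.

(** * The free energy of a finite family of weights *)

Section Core.
Context d (Y : measurableType d) (R : realType) (nu : probability Y R) (N : nat).
Variable w : 'I_N -> Y -> R.
Hypothesis mw : forall j, measurable_fun setT (w j).
Hypothesis w_gt0 : forall j y, 0 < w j y.
Hypothesis w_sum : forall y, \sum_j w j y = 1.
Implicit Types (h g q : 'I_N -> R) (y : Y).

Let flaw_w y : flaw (fun j => w j y).
Proof. by split => // j; exact: ltW. Qed.

(** The law on indices given [y], reweighted by [e^(- h)]. *)
Definition tilt h j y : R := w j y * expR (- h j) / fmgf (fun j => w j y) h.
(** The mean over [y] of the log-Laplace transform of the conditional weights. *)
Definition freeE h : R := \int[nu]_y ln (fmgf (fun j => w j y) h).
(** The index marginal of the tilted plan; it is minus the gradient of the free energy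
    at [h]. *)
Definition marg h j : R := \int[nu]_y tilt h j y.

Lemma bmfun_w j : bounded_mfun (w j).
Proof.
apply: (@bmfun_le _ _ _ _ 1) => // y; rewrite ltW//= -(w_sum y) (bigD1 j)//= lerDl.
by apply: sumr_ge0 => i _; exact: ltW.
Qed.

Let S_gt0 h y : 0 < fmgf (fun j => w j y) h.
Proof. exact: fmgf_gt0. Qed.

Lemma tilt_gt0 h j y : 0 < tilt h j y.
Proof. by rewrite /tilt divr_gt0// mulr_gt0// expR_gt0. Qed.

Lemma tilt_flaw h y : flaw (fun j => tilt h j y).
Proof.
split; first by move=> j; exact/ltW/tilt_gt0.
by rewrite /tilt -mulr_suml mulfV// gt_eqF//; exact: S_gt0.
Qed.

Lemma measurable_fmgf h : measurable_fun setT (fun y => fmgf (fun j => w j y) h).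
Proof.
by apply: measurable_sum => j; apply: measurable_funM => //; exact: measurable_cst.
Qed.

Lemma tilt_le1 h j y : tilt h j y <= 1.
Proof.
have [_ <-] := tilt_flaw h y; rewrite (bigD1 j)//= lerDl.
by apply: sumr_ge0 => i _; exact/ltW/tilt_gt0.
Qed.

Lemma bmfun_tilt h j : bounded_mfun (tilt h j).
Proof.
apply: (@bmfun_le _ _ _ _ 1); last by move=> y; rewrite tilt_le1 ltW// tilt_gt0.
apply: measurable_funM; first by apply: measurable_funM => //; exact: measurable_cst.
apply: measurable_fun_invr_gt0; [exact: measurable_fmgf|by move=> y; exact: S_gt0].
Qed.

Lemma fmgf_bounds h (a b : R) : (forall j, a <= h j <= b) ->
  forall y, - b <= ln (fmgf (fun j => w j y) h) <= - a.
Proof.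
move=> hab y; have S0 := S_gt0 h y; have [w0 w1] := flaw_w y.
rewrite -(ler_expR _ (- a)) -(ler_expR (- b)) lnK ?posrE//.
apply/andP; split; rewrite -[X in X <= _]mul1r -[X in _ <= X]mul1r.
  rewrite -[X in X * _]w1 mul1r mulr_suml; apply: ler_sum => j _.
  by rewrite ler_wpM2l// ler_expR lerN2; have /andP[] := hab j.
rewrite -[X in _ <= X * _]w1 mul1r mulr_suml; apply: ler_sum => j _.
by rewrite ler_wpM2l// ler_expR lerN2; have /andP[] := hab j.
Qed.

Lemma finite_fun_bounded h : exists2 b : R, 0 <= b & forall j, `|h j| <= b.
Proof.
exists (\sum_j `|h j|); first exact: sumr_ge0.
by move=> j; rewrite (bigD1 j)//= lerDl sumr_ge0.
Qed.

Lemma bmfun_ln_fmgf h : bounded_mfun (fun y => ln (fmgf (fun j => w j y) h)).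
Proof.
split.
  by apply: measurableT_comp => //; exact: measurable_fmgf.
have [b b0 hb] := finite_fun_bounded h; exists b => y.
rewrite ler_norml; have := @fmgf_bounds h (- b) b _ y; rewrite opprK; apply.
by move=> j; rewrite -ler_norml.
Qed.

Lemma marg_gt0 h j : 0 < marg h j.
Proof. by apply: EI_gt0; [exact: bmfun_tilt|move=> y; exact: tilt_gt0]. Qed.

Lemma marg_flaw h : flaw (marg h).
Proof.
split; first by move=> j; exact/ltW/marg_gt0.
rewrite /marg -EI_sum//; last by move=> j; exact: bmfun_tilt.
under eq_Rintegral do rewrite (tilt_flaw h _).2.
by rewrite EI_cst.
Qed.

Lemma EI_fmean_tilt h g : \int[nu]_y fmean (fun j => tilt h j y) g = fmean (marg h) g.
Proof.
rewrite /fmean EI_sum; last by move=> j; apply: bmfunM; [exact: bmfun_tilt|exact: bmfun_cst].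
by apply: eq_bigr => j _; rewrite EIZr//; exact: bmfun_tilt.
Qed.

Lemma bmfun_fmean_tilt h g : bounded_mfun (fun y => fmean (fun j => tilt h j y) g).
Proof. by apply: bmfun_sum => j; apply: bmfunM; [exact: bmfun_tilt|exact: bmfun_cst]. Qed.

Lemma bmfun_fvar_tilt h g : bounded_mfun (fun y => fvar (fun j => tilt h j y) g).
Proof. by apply: bmfunB; [exact: bmfun_fmean_tilt|apply: bmfunX; exact: bmfun_fmean_tilt]. Qed.

Lemma fmgf_tilt h g y : fmgf (fun j => w j y) (fun j => h j + g j) =
  fmgf (fun j => w j y) h * fmgf (fun j => tilt h j y) g.
Proof.
rewrite /fmgf mulr_sumr; apply: eq_bigr => j _.
rewrite /tilt opprD expRD -/(fmgf _ _); field.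
by rewrite gt_eqF.
Qed.

Lemma bmfun_ln_fmgf_tilt h g : bounded_mfun (fun y => ln (fmgf (fun j => tilt h j y) g)).
Proof.
have -> : (fun y => ln (fmgf (fun j => tilt h j y) g)) = fun y =>
  ln (fmgf (fun j => w j y) (fun j => h j + g j)) - ln (fmgf (fun j => w j y) h).
  apply/funext => y; rewrite fmgf_tilt lnM ?posrE//; first by rewrite addrC addKr.
  by apply: fmgf_gt0; exact: tilt_flaw.
by apply: bmfunB; exact: bmfun_ln_fmgf.
Qed.

(** Increments of the free energy from [h] are the free energy of the tilted weights. *)
Lemma freeED h g : freeE (fun j => h j + g j) - freeE h =
  \int[nu]_y ln (fmgf (fun j => tilt h j y) g).
Proof.
rewrite /freeE -EIB; [|exact: bmfun_ln_fmgf..].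
apply: eq_Rintegral => y _; rewrite fmgf_tilt lnM ?posrE//; first by rewrite addrC addKr.
by apply: fmgf_gt0; exact: tilt_flaw.
Qed.

(** The Bregman divergence of the free energy: its excess over the tangent at [h]. *)
Definition bregman h g := freeE (fun j => h j + g j) - freeE h + fmean (marg h) g.

Lemma bregmanE h g : bregman h g =
  \int[nu]_y ln (fmgf (fun j => tilt h j y) g) + fmean (marg h) g.
Proof. by congr (_ + _); exact: freeED. Qed.

Lemma bregman_ge0 h g : 0 <= bregman h g.
Proof.
rewrite bregmanE -EI_fmean_tilt -EID; [|exact: bmfun_ln_fmgf_tilt|exact: bmfun_fmean_tilt].
apply: EI_ge; first by apply: bmfunD; [exact: bmfun_ln_fmgf_tilt|exact: bmfun_fmean_tilt].
by move=> y; have := ln_fmgf_ge_mean g (tilt_flaw h y); lra.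
Qed.

Lemma bregman_shift h g (c : R) : bregman h (fun j => g j + c) = bregman h g.
Proof.
rewrite !bregmanE fmeanD fmean_cst; last exact: marg_flaw.
have -> : (fun y => ln (fmgf (fun j => tilt h j y) (fun j => g j + c))) =
    fun y => - c + ln (fmgf (fun j => tilt h j y) g).
  apply/funext => y; rewrite fmgf_shift lnM ?posrE ?expR_gt0// ?expRK//.
  by apply: fmgf_gt0; exact: tilt_flaw.
rewrite EID ?EI_cst; [|exact: bmfun_cst|exact: bmfun_ln_fmgf_tilt].
by move: (Rintegral _ _ _) (fmean _ _) => A B; ring.
Qed.

(** Convexity along rays, used to transfer a bound for small [g] to all [g]. *)
Lemma bregman_scale h g (l : R) : 0 <= l <= 1 -> bregman h (fun j => l * g j) <= l * bregman h g.
Proof.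
move=> l01; rewrite !bregmanE fmeanZ mulrDr lerD2r -EIZ; last exact: bmfun_ln_fmgf_tilt.
apply: EI_le; first exact: bmfun_ln_fmgf_tilt.
  by apply: bmfunM; [exact: bmfun_cst|exact: bmfun_ln_fmgf_tilt].
by move=> y; apply: ln_fmgf_scale => //; exact: tilt_flaw.
Qed.

Variable K : R.
Hypothesis K0 : 0 <= K.
Hypothesis poincare : forall h g,
  \int[nu]_y (fmean (fun j => tilt h j y) g ^+ 2) -
    (\int[nu]_y fmean (fun j => tilt h j y) g) ^+ 2 <=
  K * \int[nu]_y fvar (fun j => tilt h j y) g.

(** The law of total variance: the Poincare inequality absorbs the variance of the
    conditional mean into the mean conditional variance. *)
Lemma fvar_marg h g :
  fvar (marg h) g <= (1 + K) * \int[nu]_y fvar (fun j => tilt h j y) g.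
Proof.
have bE := bmfun_fmean_tilt h g.
have := poincare h g; rewrite EI_fmean_tilt mulrDl mul1r => P; apply: le_trans (lerD (lexx _) P).
rewrite /fvar EIB; [|exact: bmfun_fmean_tilt|exact: bmfunX].
by rewrite (EI_fmean_tilt h (fun j => g j ^+ 2)) /fmean; lra.
Qed.

(** Near [h] the Bregman divergence is half the mean conditional variance, which
    dominates the variance under the marginal up to the factor [1 + K]. *)
Lemma bregman_ge_fvar h g (b : R) : 0 <= b <= 1 / 4 -> (forall j, `|g j| <= b) ->
  2^-1 * (1 - 4 * b) / (1 + K) * fvar (marg h) g <= bregman h g.
Proof.
move=> b01 gb; have K1 : 0 < 1 + K by rewrite (lt_le_trans ltr01)// lerDl.
have c0 : 0 <= 2^-1 * (1 - 4 * b) by move: b01 => /andP[]; lra.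
have cK : 0 <= 2^-1 * (1 - 4 * b) / (1 + K) by rewrite divr_ge0// ltW.
apply: le_trans (ler_wpM2l cK (fvar_marg h g)) _.
rewrite mulrA divfK ?gt_eqF// bregmanE -EI_fmean_tilt -EIZ; last exact: bmfun_fvar_tilt.
rewrite -EID; [|exact: bmfun_ln_fmgf_tilt|exact: bmfun_fmean_tilt].
apply: EI_le.
- by apply: bmfunM; [exact: bmfun_cst|exact: bmfun_fvar_tilt].
- by apply: bmfunD; [exact: bmfun_ln_fmgf_tilt|exact: bmfun_fmean_tilt].
by move=> y; have := ln_fmgf_lower (tilt_flaw h y) b01 gb; lra.
Qed.

Lemma finite_fun_gt0_lbound (q : 'I_N -> R) : (forall j, 0 < q j) -> exists2 m, 0 < m & forall j, m <= q j.
Proof.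
move=> q0; exists (\big[Order.min/1]_j q j); last first.
  by move=> j; rewrite (bigD1 j)//= ge_min lexx.
elim/big_ind : _ => //.
by move=> x y x0 y0; rewrite lt_min x0 y0.
Qed.

Lemma fmean_center h g : fmean (marg h) (fun j => g j - fmean (marg h) g) = 0.
Proof.
rewrite (fmeanD _ g (fun=> - _)) fmean_cst ?subrr//; exact: marg_flaw.
Qed.

(** Moving the marginal by [T eta] raises the conjugate of the free energy above its
    tangent by at most half of [p' T^2] times the chi-square size of [eta]. For small [g] this is the
    quadratic lower bound of the divergence and completion of squares; for large [g]
    the divergence grows at least linearly, by convexity, and beats the linear term
    when [T] is small. *)
Lemma bregman_local_bound h (eta : 'I_N -> R) (p' : R) : 1 + K < p' -> \sum_j eta j = 0 ->
  exists2 T0, 0 < T0 & forall T g, `|T| <= T0 ->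
    - (2^-1 * p' * T ^+ 2 * \sum_j eta j ^+ 2 / marg h j) <=
      bregman h g + T * \sum_j eta j * g j.
Proof.
move=> Kp eta0; have mf := marg_flaw h.
have [m m0 mq] := finite_fun_gt0_lbound (marg_gt0 h).
have [E E0 eE] : exists2 E : R, 0 <= E & forall g r, (forall j, `|g j| <= r) ->
    `|\sum_j eta j * g j| <= E * r.
  exists (\sum_j `|eta j|) => [|g r gr]; first exact: sumr_ge0.
  rewrite (le_trans (ler_norm_sum _ _ _))// mulr_suml; apply: ler_sum => j _.
  by rewrite normrM ler_wpM2l.
have K1 : 0 < 1 + K by rewrite (lt_le_trans ltr01)// lerDl.
have p0 : 0 < p' by exact: lt_trans Kp.
pose b := (1 - (1 + K) / p') / 4.
have Kp1 : (1 + K) / p' < 1 by rewrite ltr_pdivrMr// mul1r.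
have Kp0 : 0 < (1 + K) / p' by rewrite divr_gt0.
have b0 : 0 < b by rewrite /b divr_gt0// subr_gt0.
have b1 : b <= 1 / 4 by rewrite /b; lra.
have cE : 2^-1 * (1 - 4 * b) / (1 + K) = 2^-1 / p'.
  by rewrite /b; field; rewrite !gt_eqF.
have low g : (forall j, `|g j| <= b) -> 2^-1 / p' * fvar (marg h) g <= bregman h g.
  by move=> gb; rewrite -cE; apply: bregman_ge_fvar => //; rewrite ltW.
clearbody b.
pose T0 := m * b / (2 * p' * (E + 1)).
have T00 : 0 < T0 by rewrite /T0 divr_gt0 ?mulr_gt0//; lra.
exists T0 => // T g TT.
pose c := fmean (marg h) g; pose g' j := g j - c.
have -> : bregman h g = bregman h g' by rewrite /g' bregman_shift.
have -> : \sum_j eta j * g j = \sum_j eta j * g' j.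
  by rewrite /g'; under [RHS]eq_bigr do rewrite mulrBr; rewrite sumrB -mulr_suml eta0 mul0r subr0.
have g'0 : fmean (marg h) g' = 0 by exact: fmean_center.
move: g' g'0 => {c} g' g'0.
have var' (l : R) : fvar (marg h) (fun j => l * g' j) = l ^+ 2 * \sum_j marg h j * g' j ^+ 2.
  rewrite /fvar fmeanZ g'0 mulr0 expr0n subr0 mulr_sumr; apply: eq_bigr => j _; ring.
(* small [g']: complete the square termwise *)
have [g'b|] := pselect (forall j, `|g' j| <= b).
  apply: (@le_trans _ _ (2^-1 / p' * fvar (marg h) g' + T * \sum_j eta j * g' j)); last first.
    by rewrite lerD2r; exact: low.
  have -> : fvar (marg h) g' = \sum_j marg h j * g' j ^+ 2.
    by have := var' 1; under eq_fun do rewrite mul1r; rewrite expr1n mul1r.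
  rewrite !mulr_sumr -subr_ge0 opprK -!big_split; apply: sumr_ge0 => j _ /=.
  have q0 := marg_gt0 h j; set q := marg h j in q0 *.
  rewrite (_ : _ + _ + _ = (q * g' j + p' * T * eta j) ^+ 2 / (2 * p' * q)); last first.
    by field; rewrite !gt_eqF.
  by rewrite divr_ge0 ?sqr_ge0// !mulr_ge0// ltW.
(* large [g']: rescale by [l] so that the largest entry has modulus [b] *)
move=> /existsNP[j0 /negP]; rewrite -ltNge => bg.
pose j1 := [arg max_(j > j0) `|g' j|]%O.
have [maxj rb] : (forall j, `|g' j| <= `|g' j1|) /\ b < `|g' j1|.
  rewrite /j1; case: arg_maxP => // j _ H; split; first by move=> k; exact: H.
  by apply: lt_le_trans bg _; exact: H.
set r := `|g' j1| in maxj rb.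
have r0 : 0 < r by exact: lt_trans rb.
pose l := b / r.
have l0 : 0 < l by rewrite divr_gt0.
have l1 : l <= 1 by rewrite ler_pdivrMr// mul1r ltW.
have lg j : `|l * g' j| <= b.
  rewrite normrM (gtr0_norm l0); apply: le_trans (ler_wpM2l (ltW l0) (maxj j)) _.
  by rewrite /l divfK// gt_eqF.
have D1 : 2^-1 / p' * (m * b ^+ 2) <= bregman h (fun j => l * g' j).
  apply: le_trans (low _ lg); rewrite ler_wpM2l//.
    by rewrite mulr_ge0// invr_ge0// ltW.
  rewrite var' (bigD1 j1)//= mulrDr.
  apply: (@le_trans _ _ (l ^+ 2 * (marg h j1 * g' j1 ^+ 2))); last first.
    rewrite lerDl mulr_ge0 ?sqr_ge0// sumr_ge0// => j _.
    by rewrite mulr_ge0 ?sqr_ge0// ltW// marg_gt0.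
  have -> : l ^+ 2 * (marg h j1 * g' j1 ^+ 2) = marg h j1 * (`|l * g' j1|) ^+ 2.
    by rewrite real_normK ?num_real//; ring.
  rewrite normrM (gtr0_norm l0) -/r /l divfK ?gt_eqF// ler_wpM2r ?sqr_ge0//.
have D2 : - (T0 * (E * b)) <= T * \sum_j eta j * (l * g' j).
  rewrite lerNl; apply: le_trans (ler_norm _) _; rewrite normrN normrM.
  by apply: ler_pM => //; exact: eE.
have D3 : T0 * (E * b) <= 2^-1 / p' * (m * b ^+ 2).
  have E1 : 0 < E + 1 by rewrite ltr_wpDl.
  have -> : T0 * (E * b) = 2^-1 / p' * (m * b ^+ 2) * (E / (E + 1)).
    by rewrite /T0; field; rewrite !gt_eqF.
  rewrite -[leRHS]mulr1; apply: ler_wpM2l.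
    by rewrite !mulr_ge0 ?exprn_ge0 ?invr_ge0 ?ler0n ?(ltW b0) ?(ltW p0) ?(ltW m0).
  by rewrite ler_pdivrMr// mul1r lerDl.
have D4 : 0 <= l * (bregman h g' + T * \sum_j eta j * g' j).
  have l01 : 0 <= l <= 1 by rewrite l1 ltW.
  have := bregman_scale h g' l01.
  have -> : l * (bregman h g' + T * \sum_j eta j * g' j) = l * bregman h g' + T * \sum_j eta j * (l * g' j).
    rewrite mulrDr; congr (_ + _); rewrite !mulr_sumr; apply: eq_bigr => j _; ring.
  by lra.
have := D4; rewrite pmulr_rge0//; apply: le_trans.
rewrite oppr_le0 mulr_ge0//; first by rewrite mulr_ge0 ?sqr_ge0// mulr_ge0 ?invr_ge0 ?(ltW p0).
by apply: sumr_ge0 => j _; rewrite divr_ge0 ?sqr_ge0// ltW// marg_gt0.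
Qed.

Lemma freeE_bound h (b : R) : (forall j, `|h j| <= b) -> `|freeE h| <= b.
Proof.
move=> hb; have B y : - b <= ln (fmgf (fun j => w j y) h) <= b.
  by have := @fmgf_bounds h (- b) b _ y; rewrite opprK; apply => j; rewrite -ler_norml.
rewrite ler_norml EI_ge ?EI_le_cst//; try exact: bmfun_ln_fmgf;
  by move=> y; have /andP[] := B y.
Qed.

Lemma freeE_lipschitz h g (b : R) : (forall j, `|g j - h j| <= b) -> `|freeE g - freeE h| <= b.
Proof.
move=> ghb.
have B y : - b <= ln (fmgf (fun j => tilt h j y) (fun j => g j - h j)) <= b.
  have fl := tilt_flaw h y; apply/andP; split.
    apply: le_trans (ln_fmgf_ge_mean _ fl); rewrite lerN2.
    by have := fmean_norm_le fl ghb; rewrite ler_norml => /andP[].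
  rewrite -ler_expR lnK ?posrE ?fmgf_gt0// -[leRHS]mul1r -[X in _ <= X * _]fl.2 mulr_suml.
  apply: ler_sum => j _; rewrite ler_wpM2l ?fl.1// ler_expR lerNl.
  by have := ghb j; rewrite ler_norml => /andP[].
have -> : g = (fun j => h j + (g j - h j)) by apply/funext => j; rewrite addrC subrK.
rewrite (freeED h (fun j => g j - h j)) ler_norml EI_ge ?EI_le_cst//; try exact: bmfun_ln_fmgf_tilt;
  by move=> y; have /andP[] := B y.
Qed.

Lemma freeE_shift h (c : R) : freeE (fun j => h j + c) = freeE h - c.
Proof.
rewrite /freeE.
have -> : (fun y => ln (fmgf (fun j => w j y) (fun j => h j + c))) =
    fun y => ln (fmgf (fun j => w j y) h) - c.
  by apply/funext => y; rewrite fmgf_shift lnM ?posrE ?expR_gt0// ?expRK// addrC.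
by rewrite EIB ?EI_cst//; [exact: bmfun_ln_fmgf|exact: bmfun_cst].
Qed.

(** Every weight is positive, so outside a set of measure [m] all weights exceed some
    [e > 0]; there the index with [h = 0] keeps the log-Laplace transform above [ln e],
    and elsewhere it is at least [- H]. *)
Lemma freeE_coercive (m : R) : 0 < m -> exists C, forall h i (H : R),
  h i = 0 -> (forall j, 0 <= h j <= H) -> C - H * m <= freeE h.
Proof.
move=> m0; pose f y : R := (1 + \sum_j (w j y)^-1)^-1.
have s0 y : 0 <= \sum_j (w j y)^-1.
  by apply: sumr_ge0 => j _; rewrite invr_ge0 ltW.
have f1 y : 0 < 1 + \sum_j (w j y)^-1 by rewrite (lt_le_trans ltr01)// lerDl.
have f0 y : 0 < f y by rewrite invr_gt0.
have fw j y : f y <= w j y.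
  rewrite /f -[leRHS]invrK lef_pV2 ?posrE ?invr_gt0//.
  rewrite (bigD1 j)//= addrCA lerDl addr_ge0// sumr_ge0// => k _.
  by rewrite invr_ge0 ltW.
have mf : measurable_fun setT f.
  apply: measurable_fun_invr_gt0 => //; apply: measurable_funD; first exact: measurable_cst.
  by apply: measurable_sum => j; exact: measurable_fun_invr_gt0.
have [e /andP[e0 e1] Pe] := small_sublevel nu mf f0 m0.
have mA : measurable [set y | f y < e].
  by rewrite -[X in measurable X]setTI -preimage_itvNyo; apply: mf.
exists (ln e) => h i H hi hH; set A := [set y | f y < e] in Pe mA *.
have H0 : 0 <= H by have /andP[a b] := hH i; exact: le_trans b.
have bA : bounded_mfun (\1_A : Y -> R).
  apply: (@bmfun_le _ _ _ _ 1); first exact: measurable_indic.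
  by move=> y; rewrite indicE; case: (_ \in _) => /=; rewrite ?lexx ler01.
have IA : \int[nu]_y (\1_A y : R) <= m.
  by rewrite /Rintegral integral_indic// setIT -lee_fin fineK ?fin_num_measure// ltW.
apply: (@le_trans _ _ (\int[nu]_y (ln e - H * \1_A y))).
  rewrite EIB ?EI_cst; [|exact: bmfun_cst|by apply: bmfunM => //; exact: bmfun_cst].
  by rewrite EIZ// lerB// ler_wpM2l.
apply: EI_le.
- by apply: bmfunB; [exact: bmfun_cst|apply: bmfunM => //; exact: bmfun_cst].
- exact: bmfun_ln_fmgf.
move=> y; rewrite indicE; case: (boolP (y \in A)) => /=; last first.
  rewrite notin_setE /A /= => /negP; rewrite -leNgt => ey.
  rewrite mulr0 subr0 ler_ln ?posrE//.
  apply: (le_trans ey); apply: (le_trans (fw i y)).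
  rewrite /fmgf (bigD1 i)//= hi oppr0 expR0 mulr1 lerDl sumr_ge0// => j _.
  by rewrite mulr_ge0 ?expR_ge0// ltW.
move=> _; have /andP[+ _] := fmgf_bounds hH y.
by apply: le_trans; rewrite mulr1 gerDr ln_le0.
Qed.

(** The potential is a minimizer of [freeE h + fmean q h], which exists by coercivity
    modulo constants; stationarity says that its marginal is [q]. *)
Lemma marg_surj q : (forall j, 0 < q j) -> \sum_j q j = 1 ->
  exists h, forall j, marg h j = q j.
Proof.
move=> q0 q1; have fq : flaw q by split => // j; exact: ltW.
have [m m0 mq] := finite_fun_gt0_lbound q0.
have m2 : 0 < m / 2 by rewrite divr_gt0.
have [C CH] := freeE_coercive m2.
pose G h := freeE h + fmean q h.
have Gshift h c : G (fun j => h j + c) = G h.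
  by rewrite /G freeE_shift fmeanD fmean_cst// addrACA addNr addr0.
have G0 : G (fun=> 0) = 0.
  rewrite /G fmean_cst// addr0; apply/eqP; rewrite -normr_le0.
  by apply: freeE_bound => j; rewrite normr0.
(* beyond [H0] coercivity makes [G] nonnegative, that is at least [G 0] *)
pose H0 := 2 * `|C| / m + 1.
have H00 : 0 <= H0 by rewrite addr_ge0// divr_ge0 ?mulr_ge0// ltW.
have Gbig h i H : h i = 0 -> (forall j, 0 <= h j <= H) -> (exists j, h j = H) -> H0 <= H -> 0 <= G h.
  move=> hi hH [j hj] HH; have := CH h i H hi hH.
  have : m * H <= fmean q h.
    rewrite /fmean (bigD1 j)//= hj; apply: (@le_trans _ _ (q j * H)).
      by rewrite ler_wpM2r ?mq// (le_trans _ HH).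
    rewrite lerDl sumr_ge0// => k _; rewrite mulr_ge0 ?(ltW (q0 _))//.
    by have /andP[] := hH k.
  have : m / 2 * H0 <= m / 2 * H by rewrite ler_wpM2l// ltW.
  have -> : m / 2 * H0 = `|C| + m / 2 by rewrite /H0; field; rewrite gt_eqF.
  have : 0 <= `|C| + C by have := ler_norm (- C); rewrite normrN; lra.
  rewrite /G; lra.
pose A : set 'rV[R]_N := [set v | forall i, [set` `[0, H0]] (v ord0 i)].
have cA : compact A := @rV_compact R N (fun=> [set` `[0, H0]]) (fun _ => @segment_compact R 0 H0).
pose G' (v : 'rV[R]_N) := G (fun i => v ord0 i).
have cG : continuous G'.
  move=> v; have FF := @nbhs_filter _ v.
  apply/(@cvgrPdist_le R R _ (nbhs v) FF G' (G' v)) => e e0.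
  have e2 : 0 < e / 2 by rewrite divr_gt0.
  near=> u.
  have : ball v (e / 2) u by near: u; exact: nbhsx_ballx.
  move=> [_ bu].
  have vu i : `|v ord0 i - u ord0 i| <= e / 2.
    by have := bu ord0 i; rewrite /ball /= => /ltW.
  have -> : G' v - G' u = (freeE (fun i => v ord0 i) - freeE (fun i => u ord0 i)) +
     fmean q (fun i => v ord0 i - u ord0 i).
    by rewrite /G' /G fmeanD fmeanN opprD addrACA.
  rewrite (le_trans (ler_normD _ _))// (splitr e) lerD//.
    exact: freeE_lipschitz.
  exact: fmean_norm_le.
have A0 : A !=set0.
  by exists 0 => i; rewrite mxE /= in_itv /= lexx.
have [v vA vmin] := EVT_min_rV A0 cA (continuous_subspaceT cG).
pose h0 i := v ord0 i.
have h0min h : G h0 <= G h.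
  have [i0 _] : exists i : 'I_N, True.
    case: (pickP 'I_N) => [i _|none]; first by exists i.
    by move: q1; rewrite big_pred0// => /esym/eqP; rewrite oner_eq0.
  pose i := [arg min_(j < i0) h j]%O; pose k := [arg max_(j > i0) h j]%O.
  have hi j : h i <= h j by rewrite /i; case: arg_minP => // l _; apply.
  have hk j : h j <= h k by rewrite /k; case: arg_maxP => // l _; apply.
  rewrite -(Gshift h (- h i)).
  set h' := fun j => h j - h i.
  have h'i : h' i = 0 by rewrite /h' subrr.
  have h'0 j : 0 <= h' j <= h' k by rewrite /h' subr_ge0 hi lerD2r hk.
  have [H0k|kH0] := leP H0 (h' k).
    have := Gbig h' i (h' k) h'i h'0 (ex_intro _ k erefl) H0k.
    apply: le_trans; rewrite -G0.
    have <- : G' 0 = G (fun=> 0).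
      by rewrite /G'; congr G; apply/funext => j; rewrite mxE.
    apply: (vmin 0); rewrite inE => j; rewrite mxE /= in_itv /= lexx.
    exact: H00.
  have <- : G' (\row_j h' j) = G h'.
    by rewrite /G'; congr G; apply/funext => j; rewrite mxE.
  apply: vmin; rewrite inE => j; rewrite mxE /= in_itv /=.
  by have /andP[-> /= /le_trans] := h'0 j; apply; exact: ltW.
exists h0; have ml := marg_flaw h0.
pose g j := q j - marg h0 j.
have m1 q' j : flaw q' -> q' j <= 1.
  by move=> [q'0 <-]; rewrite (bigD1 j)//= lerDl sumr_ge0.
have g1 j : `|g j| <= 1.
  rewrite ler_norml; have := m1 _ j fq; have := m1 _ j ml.
  by have := q0 j; have := marg_gt0 h0 j; rewrite /g; lra.
(* testing minimality at [h0 - t g] costs at most [t^2] and gains [t] times the sum *)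
have key (t : R) : 0 < t <= 1 -> \sum_j g j ^+ 2 <= t.
  move=> /andP[t0 t1].
  have := h0min (fun j => h0 j + - t * g j).
  have : bregman h0 (fun j => - t * g j) <= t ^+ 2.
    rewrite bregmanE -EI_fmean_tilt -EID; [|exact: bmfun_ln_fmgf_tilt|exact: bmfun_fmean_tilt].
    apply: EI_le_cst; first by apply: bmfunD; [exact: bmfun_ln_fmgf_tilt|exact: bmfun_fmean_tilt].
    move=> y; have fl := tilt_flaw h0 y.
    have tg j : `|- t * g j| <= t.
        by rewrite normrM normrN (gtr0_norm t0) ler_piMr// ltW.
    have tg1 j : `|- t * g j| <= 1 by exact: le_trans (tg j) t1.
    have := ln_fmgf_upper fl tg1.
    have : fmean (fun j => tilt h0 j y) (fun j => (- t * g j) ^+ 2) <= t ^+ 2.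
      rewrite -[leRHS](fmean_cst (t ^+ 2) fl); apply: fmean_le => // j.
      by rewrite -real_normK ?num_real// lerXn2r// nnegrE// ltW.
    by rewrite {1}/fmean; lra.
  rewrite /G fmeanD => B1 B2.
  have B3 : 0 <= bregman h0 (fun j => - t * g j) + - t * \sum_j g j ^+ 2.
    have -> : - t * \sum_j g j ^+ 2 =
      fmean q (fun j => - t * g j) - fmean (marg h0) (fun j => - t * g j).
      rewrite !fmeanZ -mulrBr; congr (_ * _); rewrite /fmean -sumrB; apply: eq_bigr => j _.
      by rewrite -mulrBl -/(g j) expr2.
    rewrite /bregman addrA addrAC addrK addrAC subr_ge0 -(lerD2r (fmean q h0)).
    by apply: le_trans B2 _; rewrite -addrA [X in _ + X]addrC.
  have : t * \sum_j g j ^+ 2 <= t * t.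
    rewrite -expr2; apply: le_trans B1; move: B3.
    by rewrite mulNr subr_ge0.
  by rewrite ler_pM2l.
have S0 : \sum_j g j ^+ 2 = 0.
  apply/eqP; rewrite eq_le sumr_ge0 ?andbT; last by move=> j _; exact: sqr_ge0.
  rewrite leNgt; apply/negP => S0.
  set s := \sum_j _ in S0 key.
  have := key (Num.min 1 (s / 2)); rewrite lt_min ltr01 divr_gt0// ge_min lexx/= => /(_ isT).
  by rewrite le_min => /andP[_]; lra.
move=> j; have /psumr_eq0P := S0 => /(_ (fun j _ => sqr_ge0 (g j)) j isT).
by move/eqP; rewrite sqrf_eq0 subr_eq0 => /eqP.
Unshelve. all: by end_near. Qed.

End Core.

(** * One-dimensional functions with strict local support lines *)

Section SupportedFunctions.
Context {R : realType}.
Implicit Types (a k s : R -> R).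

(** The slopes are monotone, hence lie between [s 0] and [s 1]. *)
Lemma subgradient_lipschitz a s :
  (forall x y : R, 0 <= x <= 1 -> 0 <= y <= 1 -> a x + (y - x) * s x <= a y) ->
  exists C : R, forall x y : R, 0 <= x <= 1 -> 0 <= y <= 1 -> `|a y - a x| <= C * `|y - x|.
Proof.
move=> sub; exists (`|s 0| + `|s 1|).
have i0 : ((0 : R) <= 0) && ((0 : R) <= 1) by apply/andP; split; lra.
have i1 : ((0 : R) <= 1) && ((1 : R) <= 1) by apply/andP; split; lra.
have mono (x y : R) : 0 <= x <= 1 -> 0 <= y <= 1 -> x < y -> s x <= s y.
  move=> xi yi xy; have := lerD (sub _ _ xi yi) (sub _ _ yi xi).
  move=> H; have : (y - x) * (s x - s y) <= 0 by lra.
  by rewrite pmulr_rle0 ?subr_gt0// subr_le0.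
have monole (x y : R) : 0 <= x <= 1 -> 0 <= y <= 1 -> x <= y -> s x <= s y.
  by move=> xi yi; rewrite le_eqVlt => /orP[/eqP ->//|]; exact: mono.
have sb (x : R) : 0 <= x <= 1 -> `|s x| <= `|s 0| + `|s 1|.
  move=> xi; have /andP[x0 x1] := xi.
  have A := monole _ _ i0 xi x0; have B := monole _ _ xi i1 x1.
  have := ler_norm (s 1); have := ler_norm (- s 0); rewrite normrN.
  have := normr_ge0 (s 0); have := normr_ge0 (s 1).
  by move=> ? ? ? ?; rewrite ler_norml; apply/andP; split; lra.
have one (x y : R) : 0 <= x <= 1 -> 0 <= y <= 1 ->
    a x - a y <= (`|s 0| + `|s 1|) * `|y - x|.
  move=> xi yi; have := sub _ _ xi yi.
  have : - ((y - x) * s x) <= (`|s 0| + `|s 1|) * `|y - x|.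
    apply: le_trans (ler_norm _) _; rewrite normrN normrM mulrC.
    by rewrite ler_wpM2r// sb.
  by lra.
move=> x y xi yi; rewrite ler_norml; apply/andP; split.
  by have := one _ _ xi yi; lra.
by have := one _ _ yi xi; rewrite distrC; lra.
Qed.

(** The function is extended to the line by clamping its argument, so that the extreme
    value theorem applies. *)
Lemma lipschitz_argmax k (C : R) :
  (forall x y : R, 0 <= x <= 1 -> 0 <= y <= 1 -> `|k y - k x| <= C * `|y - x|) ->
  exists2 c : R, 0 <= c <= 1 & forall t : R, 0 <= t <= 1 -> k t <= k c.
Proof.
move=> lip; pose cl (x : R) := Num.max 0 (Num.min 1 x).
have cli (x : R) : 0 <= cl x <= 1 by rewrite le_max lexx/= ge_max ler01 ge_min lexx.
have clid (x : R) : 0 <= x <= 1 -> cl x = x.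
  by move=> /andP[x0 x1]; rewrite /cl (min_idPr x1) (max_idPr x0).
have cl1 (x y : R) : `|cl y - cl x| <= `|y - x|.
  have : - `|y - x| <= y - x <= `|y - x| by rewrite -ler_norml.
  have := normr_ge0 (y - x).
  move: (`|y - x|) => D D0 /andP[Dl Dr]; rewrite ler_norml /cl.
  have [x1|x1] := leP 1 x; have [y1|y1] := leP 1 y.
  - by apply/andP; split; lra.
  - by have [y0|y0] := leP 0 y; rewrite ?(max_idPr ler01); apply/andP; split; lra.
  - by have [x0|x0] := leP 0 x; rewrite ?(max_idPr ler01); apply/andP; split; lra.
  - by have [x0|x0] := leP 0 x; have [y0|y0] := leP 0 y; apply/andP; split; lra.
have cont : continuous (fun x => k (cl x)).
  move=> x; have FF := @nbhs_filter _ x.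
  apply/(@cvgrPdist_le R R _ (nbhs x) FF) => e e0.
  have C0 : 0 < `|C| + 1 by rewrite ltr_wpDl.
  near=> y.
  have : `|x - y| <= e / (`|C| + 1).
    near: y; apply: cvgr_dist_le => //; by rewrite divr_gt0.
  move=> xy; apply: (le_trans (lip _ _ (cli _) (cli _))).
  apply: (@le_trans _ _ ((`|C| + 1) * (e / (`|C| + 1)))); last first.
    by rewrite mulrCA mulfV ?mulr1// gt_eqF.
  apply: le_trans (_ : `|C| * `|cl x - cl y| <= _); first by rewrite ler_wpM2r// ler_norm.
  rewrite ler_pM//; first by rewrite lerDl.
  exact: le_trans (cl1 _ _) xy.
have [c ci cmax] := @EVT_max R (fun x => k (cl x)) 0 1 ler01 (continuous_subspaceT cont).
exists c; first by move: ci; rewrite in_itv.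
move=> t ti; have := cmax t; rewrite in_itv /= => /(_ ti).
by rewrite !clid//; move: ci; rewrite in_itv.
Unshelve. all: by end_near. Qed.

(** If [k 1 < 0], subtract the chord: [k t - t k 1] is positive somewhere on [[0, 1]],
    so it attains a positive maximum at an interior point [c]. There a local
    minorant with strictly convex quadratic part forces a larger value at [c + T] or
    [c - T]. *)
Lemma locally_supported_ge0 k (C : R) :
  (forall x y : R, 0 <= x <= 1 -> 0 <= y <= 1 -> `|k y - k x| <= C * `|y - x|) ->
  k 0 = 0 ->
  (forall x : R, 0 <= x < 1 -> exists s a T0 : R, [/\ 0 < a, 0 < T0, x = 0 -> s = 0 &
    forall T : R, `|T| <= T0 -> 0 <= x + T <= 1 -> k x + s * T + a * T ^+ 2 <= k (x + T)]) ->
  0 <= k 1.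
Proof.
move=> lip k0 loc; rewrite leNgt; apply/negP => k1.
pose m x := k x - x * k 1.
have [c ci cmax] : exists2 c : R, 0 <= c <= 1 & forall t : R, 0 <= t <= 1 -> m t <= m c.
  apply: (@lipschitz_argmax m (C + `|k 1|)) => x y xi yi.
  rewrite (_ : m y - m x = (k y - k x) + - ((y - x) * k 1)); last by rewrite /m; ring.
  apply: le_trans (ler_normD _ _) _.
  by rewrite normrN normrM (mulrC _ `|k 1|) mulrDl lerD2r; exact: lip.
have mpos : 0 < m c.
  have [|s [a [T0 [a0 T00 s0 H]]]] := loc 0; first by rewrite lexx ltr01.
  pose T := Num.min T0 1.
  have Tp : 0 < T by rewrite lt_min T00 ltr01.
  have T1 : T <= 1 by rewrite ge_min lexx orbT.
  have Ti : 0 <= 0 + T <= 1 by rewrite add0r T1 ltW.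
  have := H T; rewrite gtr0_norm// ge_min lexx => /(_ isT Ti).
  rewrite s0// k0 add0r => HT; apply: lt_le_trans (cmax _ Ti).
  rewrite /m; have : 0 < a * T ^+ 2 by rewrite mulr_gt0// exprn_gt0.
  have : (0 + T) * k 1 < 0 by rewrite add0r pmulr_rlt0.
  by move: HT; rewrite add0r; lra.
have c0 : 0 < c.
  rewrite lt_neqAle eq_sym; have /andP[-> _] := ci; rewrite andbT; apply/eqP => c0.
  by move: mpos; rewrite /m c0 k0 mul0r subr0 ltxx.
have c1 : c < 1.
  rewrite lt_neqAle; have /andP[_ ->] := ci; rewrite andbT; apply/eqP => c1.
  by move: mpos; rewrite /m c1 mul1r subrr ltxx.
have [|s [a [T0 [a0 T00 _ H]]]] := loc c; first by rewrite c1 ltW.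
pose T := Num.min T0 (Num.min c (1 - c)).
have Tp : 0 < T by rewrite !lt_min T00 c0 subr_gt0 c1.
have [TT0 Tc T1c] : [/\ T <= T0, T <= c & T <= 1 - c].
  by rewrite !ge_min !lexx !orbT.
have i1 : 0 <= c + T <= 1 by apply/andP; split; lra.
have i2 : 0 <= c + - T <= 1 by apply/andP; split; lra.
have := H T; rewrite gtr0_norm// => /(_ TT0 i1).
have := H (- T); rewrite normrN gtr0_norm// => /(_ TT0 i2).
have := cmax _ i1; have := cmax _ i2; rewrite /m sqrrN.
have : 0 < a * T ^+ 2 by rewrite mulr_gt0// exprn_gt0.
move: (k (c + T)) (k (c + - T)) (k c) (k 1) (a * T ^+ 2) => *; lra.
Qed.

Lemma xlnx_ge_id (x : R) : -1 < x -> x <= (1 + x) * ln (1 + x).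
Proof.
move=> x1; have x0 : 0 < 1 + x by lra.
have H : ln (1 + ((1 + x)^-1 - 1)) <= (1 + x)^-1 - 1.
  by apply: le_ln1Dx; have : 0 < (1 + x)^-1 by [rewrite invr_gt0]; lra.
move: H; rewrite addrC subrK lnV ?posrE// => H.
have := ler_wpM2l (ltW x0) H; rewrite mulrBr mulfV ?gt_eqF//; lra.
Qed.

(** Writing [u + T v = u (1 + T v / u)] separates the affine part in [T] from the
    remainder [(1 + x) ln (1 + x)], [x = T v / u]. *)
Lemma xlnx_shift (u v T c : R) : 0 < u -> 0 < c -> 0 < u + T * v ->
  -1 < T * v / u /\
  (u + T * v) * ln ((u + T * v) / c) =
    u * ln (u / c) + T * (v * ln (u / c)) + u * ((1 + T * v / u) * ln (1 + T * v / u)).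
Proof.
move=> u0 c0 v0.
have E : u + T * v = u * (1 + T * v / u) by field; rewrite gt_eqF.
have P : 0 < 1 + T * v / u by move: v0; rewrite E pmulr_rgt0.
split; first by lra.
have -> : (u + T * v) / c = (u / c) * (1 + T * v / u) by rewrite E mulrAC.
rewrite lnM ?posrE ?divr_gt0// mulrDr mulrDl !mulrA -E; congr (_ + _).
Qed.

Lemma xlnx_shift_ge (u v T c : R) : 0 < u -> 0 < c -> 0 < u + T * v ->
  u * ln (u / c) + T * (v * ln (u / c)) + T * v <= (u + T * v) * ln ((u + T * v) / c).
Proof.
move=> u0 c0 v0; have [x1 ->] := xlnx_shift u0 c0 v0.
rewrite lerD2l; have := ler_wpM2l (ltW u0) (xlnx_ge_id x1).
by rewrite mulrCA mulfV ?gt_eqF// mulr1.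
Qed.

Lemma xlnx_shift_ge2 (u v T c l : R) : 0 < u -> 0 < c -> 0 < u + T * v ->
  `|T * v / u| <= l ->
  u * ln (u / c) + T * (v * ln (u / c)) + T * v + 2^-1 * (1 - l) * T ^+ 2 * (v ^+ 2 / u) <=
  (u + T * v) * ln ((u + T * v) / c).
Proof.
move=> u0 c0 v0 xl; have [x1 ->] := xlnx_shift u0 c0 v0.
rewrite -addrA lerD2l; set x := T * v / u in xl x1 *.
have Tv : T * v = u * x by rewrite /x mulrCA mulfV ?gt_eqF// mulr1.
have -> : T * v + 2^-1 * (1 - l) * T ^+ 2 * (v ^+ 2 / u) =
  u * (x + 2^-1 * (1 - l) * x ^+ 2).
  have -> : 2^-1 * (1 - l) * T ^+ 2 * (v ^+ 2 / u) = 2^-1 * (1 - l) * (T * v) ^+ 2 / u.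
    by rewrite exprMn !mulrA.
  by rewrite Tv; field; rewrite gt_eqF.
rewrite ler_wpM2l ?(ltW u0)//; apply: le_trans (xlnx_ge x1).
have := ler_norm x; have : 0 <= x ^+ 2 by exact: sqr_ge0.
move=> x2 xn; have : 0 <= x ^+ 2 * (l - x) by rewrite mulr_ge0// subr_ge0; lra.
have : 0 <= x ^+ 2 * l by rewrite mulr_ge0// (le_trans _ xl).
by rewrite exprS; nra.
Qed.

End SupportedFunctions.

(** * Free energy bound from a Poincare inequality *)

Section CoreTheorem.
Context d (Y : measurableType d) (R : realType) (nu : probability Y R) (N : nat).
Variable w : 'I_N -> Y -> R.
Hypothesis mw : forall j, measurable_fun setT (w j).
Hypothesis w_gt0 : forall j y, 0 < w j y.
Hypothesis w_sum : forall y, \sum_j w j y = 1.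
Variable K : R.
Hypothesis K0 : 0 <= K.
Hypothesis poincare : forall h g : 'I_N -> R,
  \int[nu]_y (fmean (fun j => tilt w h j y) g ^+ 2) -
    (\int[nu]_y fmean (fun j => tilt w h j y) g) ^+ 2 <=
  K * \int[nu]_y fvar (fun j => tilt w h j y) g.

Let margf := marg_flaw nu mw w_gt0 w_sum.
Let brg := bregman_ge0 nu mw w_gt0 w_sum.
Let brl := bregman_local_bound mw w_gt0 w_sum K0 poincare.
Let msurj := marg_surj nu mw w_gt0 w_sum.

Let r := marg nu w (fun=> 0).

Lemma tilt0 j y : tilt w (fun=> 0) j y = w j y.
Proof.
rewrite /tilt /fmgf oppr0 expR0 mulr1; under eq_bigr do rewrite mulr1.
by rewrite w_sum divr1.
Qed.

Lemma marg0E j : r j = \int[nu]_y w j y.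
Proof. by apply: eq_Rintegral => y _; rewrite tilt0. Qed.

Let r0 j : 0 < r j. Proof. exact: marg_gt0. Qed.

Section Target.
Variables (p : R) (q : 'I_N -> R).
Hypothesis Kp : 1 + K < p.
Hypothesis q0 : forall j, 0 < q j.
Hypothesis q1 : \sum_j q j = 1.

Let eta j := q j - r j.
Let qt (t : R) j := r j + t * eta j.

Let eta0 : \sum_j eta j = 0.
Proof. by rewrite /eta sumrB q1 (margf _).2 subrr. Qed.

Let qt0 (t : R) j : 0 <= t <= 1 -> 0 < qt t j.
Proof.
move=> /andP[t0 t1]; rewrite /qt /eta.
have := q0 j; have := r0 j; move: (q j) (r j) => a b b0 a0.
have [->|tn] := eqVneq t 0; first by rewrite mul0r addr0.
have tp : 0 < t by rewrite lt_neqAle eq_sym tn.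
have : 0 < t * a by rewrite mulr_gt0.
have : 0 <= (1 - t) * b by rewrite mulr_ge0// ?subr_ge0// ltW.
lra.
Qed.

Let qt1 t : \sum_j qt t j = 1.
Proof. by rewrite /qt big_split /= -mulr_sumr eta0 mulr0 addr0 (margf _).2. Qed.

Let potentials : exists hs : R -> 'I_N -> R, hs 0 = (fun=> 0) /\
  forall t : R, 0 <= t <= 1 -> forall j, marg nu w (hs t) j = qt t j.
Proof.
suff /choice[hs hsP] : forall t : R, exists h : 'I_N -> R, (t = 0 -> h = fun=> 0) /\
    (0 <= t <= 1 -> forall j, marg nu w h j = qt t j).
  by exists hs; split; [apply: (hsP 0).1|move=> t; apply: (hsP t).2].
move=> t; have [->|tn] := eqVneq t 0.
  by exists (fun=> 0); split => // _ j; rewrite /qt mul0r addr0.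
have [t01|] := boolP (0 <= t <= 1).
  by have [h hq] := msurj (fun j => qt0 j t01) (qt1 t); exists h; split => // t0; rewrite t0 eqxx in tn.
by exists (fun=> 0); split => // t0; rewrite t0 eqxx in tn.
Qed.

(** In dual form: the convex conjugate of the free energy at the law [q] is at most
    [p] times the entropy of [q] relative to [r]. Along the segment [qt] from [r] to [q]
    let [jf] be the conjugate, [e] the entropy and [chi] the chi-square size of the
    direction. Locally [jf] grows at most like [p' / 2 chi T^2] and [e] at least like
    [(1 - l) / 2 chi T^2], up to affine terms whose slopes vanish at [t = 0]. As [p' < p (1 - l)],
    the function [p e - jf] vanishes at 0 and has strict local support lines, so it is
    nonnegative at the end point. *)
Lemma freeE_dual_bound (h : 'I_N -> R) :
  - fmean q h - p * \sum_j q j * ln (q j / r j) <= freeE nu w h.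
Proof.
have [hs [hs0 hsP]] := potentials.
pose sg (t : R) := - \sum_j eta j * hs t j.
pose jf (t : R) := - freeE nu w (hs t) - fmean (qt t) (hs t).
have fmqt (s t : R) g : fmean (qt s) g = fmean (qt t) g + (s - t) * \sum_j eta j * g j.
  rewrite /fmean mulr_sumr -big_split; apply: eq_bigr => j _ /=; rewrite /qt.
  by move: (r j) (eta j) (g j) => *; ring.
have mE (t : R) : 0 <= t <= 1 -> marg nu w (hs t) = qt t.
  by move=> ti; apply/funext => j; exact: hsP.
have bregs (t : R) g : 0 <= t <= 1 -> bregman nu w (hs t) (fun j => g j - hs t j) =
    freeE nu w g - freeE nu w (hs t) + (fmean (qt t) g - fmean (qt t) (hs t)).
  move=> ti; rewrite /bregman mE// fmeanD fmeanN.
  have -> : (fun j => hs t j + (g j - hs t j)) = g by apply/funext => j; rewrite subrKC.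
  by [].
have subg (s t : R) : 0 <= s <= 1 -> 0 <= t <= 1 -> jf s + (t - s) * sg s <= jf t.
  move=> si ti; have := brg (hs t) (fun j => hs s j - hs t j).
  rewrite bregs// (fmqt t s (hs s)) /jf /sg mulrN.
  have gen (a b c e f : R) : 0 <= a - b + (e + c - f) -> - a - e - c <= - b - f by move=> H; lra.
  exact: gen.
(* [jf] is convex with subgradient [sg]; its upper expansion has curvature [p' chi] *)
pose chi (t : R) := \sum_j eta j ^+ 2 / qt t j.
have [p' Kp' p'p] : exists2 p' : R, 1 + K < p' & p' < p.
  by exists ((1 + K + p) / 2); rewrite (midf_lt Kp).
have K1 : 0 < 1 + K by rewrite (lt_le_trans ltr01)// lerDl.
have p'0 : 0 < p' by exact: lt_trans Kp'.
have p0 : 0 < p by exact: lt_trans p'p.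
have jloc (t : R) : 0 <= t <= 1 -> exists2 T0, 0 < T0 & forall T : R, `|T| <= T0 -> 0 <= t + T <= 1 ->
    jf (t + T) <= jf t + T * sg t + 2^-1 * p' * T ^+ 2 * chi t.
  move=> ti; have [T0 T00 H] := brl (hs t) Kp' eta0; exists T0 => // T TT tTi.
  have := H T (fun j => hs (t + T) j - hs t j) TT.
  rewrite bregs// mE// -/(chi t).
  have -> : \sum_j eta j * (hs (t + T) j - hs t j) =
    \sum_j eta j * hs (t + T) j + sg t.
    by rewrite /sg -sumrB; apply: eq_bigr => j _; rewrite mulrBr.
  rewrite /jf (fmqt (t + T) t (hs (t + T))) (addrC t) addrK.
  have gen (a b c e f g u : R) : - u <= a - b + (e - f) + T * (c + g) ->
    - a - (e + T * c) <= - b - f + T * g + u by move=> *; lra.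
  exact: gen.
pose e (t : R) := \sum_j qt t j * ln (qt t j / r j).
pose de (t : R) := \sum_j eta j * ln (qt t j / r j).
have qtD (t T : R) j : qt (t + T) j = qt t j + T * eta j by rewrite /qt mulrDl addrA.
have esub (s t : R) : 0 <= s <= 1 -> 0 <= t <= 1 -> e s + (t - s) * de s <= e t.
  move=> si ti; rewrite /e /de mulr_sumr -big_split /=.
  have -> : \sum_j (qt s j * ln (qt s j / r j) + (t - s) * (eta j * ln (qt s j / r j))) =
    \sum_j (qt s j * ln (qt s j / r j) + (t - s) * (eta j * ln (qt s j / r j)) + (t - s) * eta j).
    by rewrite [in RHS]big_split /= -mulr_sumr eta0 mulr0 addr0.
  apply: ler_sum => j _.
  have -> : qt t j = qt s j + (t - s) * eta j by rewrite -qtD addrC subrK.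
  by apply: xlnx_shift_ge => //; rewrite ?qt0// -qtD addrC subrK qt0.
(* [l] is the relative loss allowed in the curvature of the entropy *)
pose l := (p - p') / (2 * p).
have l0 : 0 < l by rewrite divr_gt0 ?mulr_gt0// subr_gt0.
have pl : p' < p * (1 - l).
  rewrite /l (_ : p * _ = (p + p') / 2); last by field; rewrite gt_eqF.
  by lra.
have eloc (t : R) : 0 <= t <= 1 -> exists2 T0, 0 < T0 & forall T : R, `|T| <= T0 -> 0 <= t + T <= 1 ->
    e t + T * de t + 2^-1 * (1 - l) * T ^+ 2 * chi t <= e (t + T).
  move=> ti; have [m m0 mq] := finite_fun_gt0_lbound (fun j => qt0 j ti).
  pose E := 1 + \sum_j `|eta j|.
  have E0 : 0 < E by rewrite ltr_pwDl// sumr_ge0.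
  have etaE j : `|eta j| <= E.
    by rewrite /E (bigD1 j)//= addrCA lerDl addr_ge0// sumr_ge0.
  exists (l * m / E); first by rewrite divr_gt0// mulr_gt0.
  move=> T TT tTi; rewrite /e /de /chi mulr_sumr mulr_sumr -!big_split /=.
  have -> : \sum_j (qt t j * ln (qt t j / r j) + T * (eta j * ln (qt t j / r j)) +
      2^-1 * (1 - l) * T ^+ 2 * (eta j ^+ 2 / qt t j)) =
    \sum_j (qt t j * ln (qt t j / r j) + T * (eta j * ln (qt t j / r j)) + T * eta j +
      2^-1 * (1 - l) * T ^+ 2 * (eta j ^+ 2 / qt t j)).
    have Z : \sum_j T * eta j = 0 by rewrite -mulr_sumr eta0 mulr0.
    by rewrite !big_split /= Z addr0.
  apply: ler_sum => j _; rewrite qtD; apply: xlnx_shift_ge2 => //.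
  - exact: qt0.
  - by rewrite -qtD qt0.
  have u0 := qt0 j ti.
  rewrite normrM normfV (gtr0_norm u0) ler_pdivrMr// normrM.
  apply: (@le_trans _ _ (l * m / E * E)); first by rewrite ler_pM.
  by rewrite divfK ?gt_eqF// ler_wpM2l// ltW.
have i0 : ((0 : R) <= 0) && ((0 : R) <= 1) by apply/andP; split; lra.
have i1 : ((0 : R) <= 1) && ((1 : R) <= 1) by apply/andP; split; lra.
have qt_1 : qt 1 = q by apply/funext => j; rewrite /qt mul1r /eta addrC subrK.
have jf1 : - fmean q h - freeE nu w h <= jf 1.
  have := brg (hs 1) (fun j => h j - hs 1 j); rewrite bregs// qt_1 /jf qt_1.
  have gen (a b c v : R) : 0 <= a - b + (c - v) -> - c - a <= - b - v by move=> *; lra.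
  exact: gen.
suff H : jf 1 <= p * e 1.
  have -> : \sum_j q j * ln (q j / r j) = e 1 by rewrite /e qt_1.
  have gen (a b c u : R) : - a - b <= u -> u <= c -> - a - c <= b by move=> *; lra.
  exact: gen jf1 H.
have qt_0 : qt 0 = r by apply/funext => j; rewrite /qt mul0r addr0.
have sg0 : sg 0 = 0.
  by rewrite /sg hs0 big1 ?oppr0// => j _; rewrite mulr0.
have e0 : e 0 = 0.
  by rewrite /e qt_0 big1// => j _; rewrite mulfV ?gt_eqF// ln1 mulr0.
have de0 : de 0 = 0.
  by rewrite /de qt_0 big1// => j _; rewrite mulfV ?gt_eqF// ln1 mulr0.
have j0 : jf 0 = 0.
  rewrite /jf hs0 qt_0 (fmean_cst _ (margf _)) subr0.
  have -> : freeE nu w (fun=> 0) = 0.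
    apply/eqP; rewrite -normr_le0; apply: freeE_bound => // j; by rewrite normr0.
  by rewrite oppr0.
have [eta_z|[j0' etaj]] : (forall j, eta j = 0) \/ exists j, eta j != 0.
  by have [|/existsNP[j /eqP]] := pselect (forall j, eta j = 0); [left|right; exists j].
  have := subg 1 0 i1 i0.
  have -> : sg 1 = 0 by rewrite /sg big1 ?oppr0// => j _; rewrite eta_z mul0r.
  rewrite mulr0 addr0 j0.
  have -> : e 1 = 0.
    rewrite /e big1// => j _; rewrite /qt eta_z mulr0 addr0 mulfV ?gt_eqF// ln1 mulr0 //.
  by rewrite mulr0.
have chi0 (t : R) : 0 <= t <= 1 -> 0 < chi t.
  move=> ti; rewrite /chi (bigD1 j0')//= ltr_pwDl//.
    by rewrite divr_gt0 ?qt0// exprn_even_gt0.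
  by apply: sumr_ge0 => j _; rewrite divr_ge0 ?sqr_ge0// ltW// qt0.
have [C1 lip1] := subgradient_lipschitz subg.
have [C2 lip2] := subgradient_lipschitz esub.
rewrite -subr_ge0.
apply: (@locally_supported_ge0 R (fun t => p * e t - jf t) (p * C2 + C1)).
- move=> x y xi yi.
  rewrite (_ : _ - _ = p * (e y - e x) + - (jf y - jf x)); last first.
    have gen (a b c u : R) : p * a - b - (p * c - u) = p * (a - c) + - (b - u) by ring.
    exact: gen.
  rewrite (le_trans (ler_normD _ _))// normrN normrM (gtr0_norm p0) mulrDl.
  by rewrite lerD ?lip1// -mulrA ler_wpM2l ?lip2// ltW.
- by rewrite e0 j0 mulr0 subr0.
move=> x /andP[x0 x1]; have xi : 0 <= x <= 1 by rewrite x0 ltW.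
have [T1 T10 H1] := jloc x xi; have [T2 T20 H2] := eloc x xi.
exists (p * de x - sg x), (2^-1 * (p * (1 - l) - p') * chi x), (Num.min T1 T2); split.
- by rewrite !mulr_gt0 ?chi0// ?invr_gt0// subr_gt0.
- by rewrite lt_min T10.
- by move=> ->; rewrite de0 sg0 mulr0 subr0.
move=> T; rewrite le_min => /andP[TT1 TT2] Ti.
have A1 := H1 T TT1 Ti; have := ler_wpM2l (ltW p0) (H2 T TT2 Ti).
have gen (a b c u v z k : R) : u <= c + T * z + 2^-1 * p' * T ^+ 2 * k ->
    p * (a + T * v + 2^-1 * (1 - l) * T ^+ 2 * k) <= p * b ->
    p * a - c + (p * v - z) * T + 2^-1 * (p * (1 - l) - p') * k * T ^+ 2 <= p * b - u.
  by move=> *; lra.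
by move=> A2; exact: gen A1 A2.
Qed.

End Target.

(** The dual bound at the law proportional to [r e^(- h / p)], where the Gibbs
    variational formula for the right-hand side is attained. *)
Theorem freeE_ge (p : R) (h : 'I_N -> R) : 1 + K < p ->
  p * ln (\sum_j (\int[nu]_y w j y) * expR (- (h j / p))) <= freeE nu w h.
Proof.
move=> Kp; have K1 : 0 < 1 + K by rewrite (lt_le_trans ltr01)// lerDl.
have p0 : 0 < p by exact: lt_trans Kp.
have -> : \sum_j (\int[nu]_y w j y) * expR (- (h j / p)) = fmgf r (fun j => h j / p).
  by apply: eq_bigr => j _; rewrite marg0E.
set Z := fmgf r _; have Z0 : 0 < Z by apply: fmgf_gt0; exact: margf.
pose q j := r j * expR (- (h j / p)) / Z.
have q0 j : 0 < q j by rewrite divr_gt0// mulr_gt0// expR_gt0.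
have q1 : \sum_j q j = 1 by rewrite /q -mulr_suml mulfV// gt_eqF.
apply: le_trans (freeE_dual_bound Kp q0 q1 h).
have -> : \sum_j q j * ln (q j / r j) = - (fmean q h / p) - ln Z.
  have -> : - (fmean q h / p) - ln Z = \sum_j (q j * (- (h j / p)) + q j * - ln Z).
    rewrite big_split /= -mulr_suml q1 mul1r; congr (_ + _).
    by rewrite /fmean mulr_suml -sumrN; apply: eq_bigr => j _; rewrite mulrN mulrA.
  apply: eq_bigr => j _; rewrite -mulrDr; congr (_ * _).
  rewrite (_ : q j / r j = expR (- (h j / p)) / Z); last first.
    by rewrite /q mulrAC (mulrC (r j)) mulfK ?gt_eqF.
  by rewrite ln_div ?posrE ?expR_gt0// expRK.
rewrite mulrBr mulrN mulrCA mulfV ?gt_eqF// mulr1.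
by move: (ln Z) (fmean q h) => *; lra.
Qed.

End CoreTheorem.

(** * Densities, relative entropy and couplings *)

Section Density.
Context d (T : measurableType d) (R : realType).
Implicit Types (p q : probability T R) (g : T -> R).

Definition has_density p q g :=
  forall A, measurable A -> p A = (\int[q]_(x in A) (g x)%:E)%E.

Variables (p q : probability T R) (g : T -> R).
Hypotheses (mg : measurable_fun setT g) (g0 : forall x, 0 <= g x).
Hypothesis pg : has_density p q g.

Let mge : measurable_fun setT (EFin \o g).
Proof. exact/measurable_EFinP. Qed.

Lemma density_dominates : p `<< q.
Proof.
apply/null_content_dominatesP => A mA qA0; rewrite pg//.
apply: null_set_integral => //.
apply: measurable_funTS; exact: mge.
Qed.

Lemma density_RN : ae_eq q setT (Radon_Nikodym_SigmaFinite.f p q) (EFin \o g).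
Proof.
have pq := density_dominates.
apply: integral_ae_eq => //.
  exact: Radon_Nikodym_SigmaFinite.f_integrable.
by move=> A _ mA; rewrite -(Radon_Nikodym_SigmaFinite.f_integral pq mA); exact: pg.
Qed.

Lemma ge0_integral_density (f : T -> \bar R) : measurable_fun setT f -> (forall x, 0 <= f x)%E ->
  (\int[p]_x f x = \int[q]_x (f x * (g x)%:E))%E.
Proof.
have pq := density_dominates; move=> mf f0.
rewrite -(Radon_Nikodym_SigmaFinite.change_of_variables pq)//.
apply: ae_eq_integral => //.
- apply: emeasurable_funM => //.
  exact: measurable_int (Radon_Nikodym_SigmaFinite.f_integrable density_dominates).
- exact: emeasurable_funM.
- by apply: ae_eqe_mul2l; exact: density_RN.
Qed.

Lemma density_rel_entropy : (forall x, 0 < g x) ->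
  rel_entropy p q = (\int[p]_x (ln (g x))%:E)%E.
Proof.
move=> gp; rewrite /rel_entropy; have pq := density_dominates; case: asboolP => // _.
have mRN := measurable_int _ (Radon_Nikodym_SigmaFinite.f_integrable pq).
apply: ae_eq_integral => //.
- pose f := Radon_Nikodym_SigmaFinite.f p q.
  rewrite (_ : (fun x => _) = fun x => if fine (f x) <= 0 then -oo%E else (ln (fine (f x)))%:E).
    have mf : measurable_fun setT (fun x => fine (f x)) by exact: measurableT_comp.
    apply: measurable_fun_ifT => //.
      exact: measurable_fun_ler.
    by apply/measurable_EFinP; exact: measurableT_comp.
  apply/funext => x; have := Radon_Nikodym_SigmaFinite.f_fin_num pq x.
  by rewrite /lne -/(f x); case: (f x).
- by apply/measurable_EFinP; exact: measurableT_comp.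
apply: (null_dominates_ae_eq measurableT pq).
move: density_RN => [N [mN N0 sN]]; exists N; split => // x /= H; apply: sN => /= H'.
by apply: H => _; rewrite (H' Logic.I) -[LHS]/(lne (g x)%:E) lne_EFin.
Qed.

End Density.

Section DensityProbability.
Context d (T : measurableType d) (R : realType) (P : probability T R) (g : T -> R).

Definition density_fun (A : set T) : \bar R := (\int[P]_(x in A) (g x)%:E)%E.

Lemma density_prob_exists : measurable_fun setT g -> (forall x, 0 <= g x) ->
  (\int[P]_x (g x)%:E = 1)%E -> exists Q : probability T R, has_density Q P g.
Proof.
move=> mg g0 g1.
have m0 : density_fun set0 = 0%E by rewrite /density_fun integral_set0.
have mge A : (0 <= density_fun A)%E.
  by apply: integral_ge0 => x _; rewrite lee_fin.
have mA : semi_sigma_additive density_fun.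
  move=> /= A mA tA mUA; rewrite /density_fun ge0_integral_bigcup//.
  - apply: is_cvg_ereal_nneg_natsum_cond => n _ _.
    by apply: integral_ge0 => /= x ?; rewrite lee_fin.
  - by apply: measurable_funTS; exact/measurable_EFinP.
  - by move=> x _; rewrite lee_fin.
pose m := isMeasure.Build _ _ _ density_fun m0 mge mA.
pose M : {measure set T -> \bar R} := HB.pack density_fun m.
have M1 : M setT = 1%E by [].
pose pm := Measure_isProbability.Build _ _ _ M M1.
pose Q : probability T R := HB.pack density_fun m pm.
by exists Q.
Qed.

End DensityProbability.

Section Coupling.
Context d1 d2 (T1 : measurableType d1) (T2 : measurableType d2) (R : realType).
Variables (p : probability T1 R) (q : probability T2 R) (c : probability (T1 * T2)%type R).
Hypothesis pqc : coupling p q c.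

Lemma ge0_integral_coupling1 (f : T1 -> \bar R) : measurable_fun setT f ->
  (forall x, 0 <= f x)%E -> (\int[c]_z f z.1 = \int[p]_x f x)%E.
Proof.
move=> mf f0.
have := @ge0_integral_pushforward _ _ _ _ R fst measurable_fst c setT f measurableT mf.
rewrite preimage_setT => <-; last by move=> x _.
by apply: eq_measure_integral => A mA _; exact: pqc.1.
Qed.

Lemma ge0_integral_coupling2 (f : T2 -> \bar R) : measurable_fun setT f ->
  (forall x, 0 <= f x)%E -> (\int[c]_z f z.2 = \int[q]_x f x)%E.
Proof.
move=> mf f0.
have := @ge0_integral_pushforward _ _ _ _ R snd measurable_snd c setT f measurableT mf.
rewrite preimage_setT => <-; last by move=> x _.
by apply: eq_measure_integral => A mA _; exact: pqc.2.
Qed.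

End Coupling.

(** * The transport inequality and ratio bounds *)

Lemma measurable_borel_continuous (T : ptopologicalType) (R : realType) (f : T -> R) :
  continuous f -> measurable_fun (setT : set (borel T)) (f : borel T -> R).
Proof.
move=> cf; apply: (measurability (@RGenOInfty.G R) (@RGenOInfty.measurableE R)).
move=> _ [_ [x ->] <-]; rewrite setTI; apply: sub_sigma_algebra.
have := @open_comp T R f `]x, +oo[%classic (fun y _ => cf y).
by apply; exact: interval_open.
Qed.

Lemma measurable_enorm_sqr (R : realType) (d : nat) :
  measurable_fun setT (fun z : borel 'rV[R]_d * borel 'rV[R]_d => enorm (z.1 - z.2) ^+ 2).
Proof.
rewrite (_ : (fun z => _) = fun z : borel 'rV[R]_d * borel 'rV[R]_d =>
   \sum_(i < d) (z.1 0 i - z.2 0 i) ^+ 2); last first.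
  apply/funext => z; rewrite /enorm sqr_sqrtr; last by apply: sumr_ge0 => i _; exact: sqr_ge0.
  by apply: eq_bigr => i _; rewrite !mxE.
have mc i : measurable_fun (setT : set (borel 'rV[R]_d)) (fun y : borel 'rV[R]_d => (y : 'rV[R]_d) 0 i).
  apply: (@measurable_borel_continuous 'rV[R]_d R (fun y => y 0 i)).
  by move=> y; exact: coord_continuous.
apply: measurable_sum => i; apply: measurable_funX; apply: measurable_funB.
  exact: (measurableT_comp (mc i) measurable_fst).
exact: (measurableT_comp (mc i) measurable_snd).
Qed.

Lemma wasserstein2_sqr (R : realType) (d : nat) (mu nu : probability (borel 'rV[R]_d) R) :
  (wasserstein2 mu nu ^+ 2)%E = ereal_inf [set w | exists2 pi : probability
                        (borel 'rV[R]_d * borel 'rV[R]_d)%type R,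
                      coupling mu nu pi &
                      w = (\int[pi]_z ((enorm (z.1 - z.2)) ^+ 2)%:E)%E].
Proof.
rewrite /wasserstein2; set I := ereal_inf _.
have I0 : (0 <= I)%E.
  apply: le_ereal_inf_tmp => _ [pi _ ->]; apply: integral_ge0 => z _.
  by rewrite lee_fin sqr_ge0.
rewrite poweR12_sqrt//; case: I I0 => [x x0| |//].
  by rewrite -[sqrte _]/((Num.sqrt x)%:E) -EFin_expe sqr_sqrtr.
by move=> _; rewrite -[sqrte _]/(+oo%E) expe2 mulyy.
Qed.

(** The Wasserstein distance is an infimum, so any strict upper bound for it is realized
    by a coupling. *)
Lemma TI_coupling (R : realType) (d : nat) (tau : R) (mu nu : probability (borel 'rV[R]_d) R) (H b : R) :
  TI tau nu -> (rel_entropy mu nu <= H%:E)%E -> 0 < tau -> 2 * tau * H < b ->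
  exists2 pi : probability (borel 'rV[R]_d * borel 'rV[R]_d)%type R, coupling mu nu pi &
    (\int[pi]_z ((enorm (z.1 - z.2)) ^+ 2)%:E < b%:E)%E.
Proof.
move=> /(_ mu) T HH tau0 Hb; move: T; rewrite wasserstein2_sqr => T.
have t0 : (0 <= (2 * tau)%:E)%E by rewrite lee_fin mulr_ge0// ltW.
have Tb := le_trans T (lee_wpmul2l t0 HH).
have : ((2 * tau)%:E * H%:E < b%:E)%E by rewrite -EFinM lte_fin.
move=> /(le_lt_trans Tb) /ereal_inf_lt[_ [pi cpi ->] cb].
by exists pi.
Qed.

Section RealDensity.
Context d (T : measurableType d) (R : realType) (p q : probability T R) (g : T -> R).
Hypotheses (bg : bounded_mfun g) (g0 : forall x, 0 <= g x).
Hypothesis pg : has_density p q g.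

Lemma EI_density (f : T -> R) : bounded_mfun f ->
  \int[p]_x f x = \int[q]_x (f x * g x).
Proof.
move=> bf; have [mf [B fB]] := bf; have [mg _] := bg.
have g1 : \int[q]_x g x = 1.
  rewrite /Rintegral -(pg measurableT) probability_setT//.
have fB0 x : 0 <= f x + B by have := fB x; rewrite ler_norml => /andP[]; lra.
have bfB : bounded_mfun (fun x => f x + B) by apply: bmfunD => //; exact: bmfun_cst.
have : \int[p]_x (f x + B) = \int[q]_x ((f x + B) * g x).
  rewrite /Rintegral; congr fine.
  rewrite (ge0_integral_density mg pg)//.
  by apply/measurable_EFinP; case: bfB.
rewrite EID// ?EI_cst; last exact: bmfun_cst.
under [RHS]eq_Rintegral do rewrite mulrDl.
rewrite EID; [|exact: bmfunM|by apply: bmfunM => //; exact: bmfun_cst].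
by rewrite EIZ// g1 mulr1 => /addIr.
Qed.

End RealDensity.

Section RatioBound.
Context {R : realType} (I : finType).

(** With [m] the mean under [a], the change of mean is the sum of
    [(b j - C a j) (g j - m)] over the total mass of [b], and [|b j - C a j|] is at most
    [(e^k - 1) C a j]; then [x y <= al / 2 x^2 + y^2 / (2 al)] termwise. *)
Lemma fmean_ratio_bound (a b g : I -> R) (k C al : R) :
  (forall j, 0 < a j) -> 0 <= k -> 0 < C -> 0 < al -> \sum_j a j = 1 ->
  0 < \sum_j b j ->
  (forall j, expR (- k) * C * a j <= b j <= expR k * C * a j) ->
  fmean (fun j => b j / \sum_j b j) g - fmean a g <=
    al / 2 * fvar a g + ((expR k - 1) * expR k) ^+ 2 / (2 * al).
Proof.
move=> a0 k0 C0 al0 a1 b0 ab; have fa : flaw a by split => // j; exact: ltW.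
set m := fmean a g; set Z := \sum_j b j; set D := (expR k - 1) * expR k.
have ek : 1 <= expR k by rewrite -expR0 ler_expR.
have ek0 := expR_gt0 k.
have eN : expR k * expR (- k) = 1 by rewrite -expRD subrr expR0.
have ZC : expR (- k) * C <= Z.
  rewrite -[leLHS]mulr1 -[X in _ * X <= _]a1 mulr_sumr; apply: ler_sum => j _.
  by have /andP[] := ab j.
have CZ : C / Z <= expR k.
  rewrite ler_pdivrMr//; have := ler_wpM2l (ltW ek0) ZC.
  by rewrite mulrA eN mul1r.
have -> : fmean (fun j => b j / Z) g - m = (\sum_j (b j - C * a j) * (g j - m)) / Z.
  have -> : \sum_j (b j - C * a j) * (g j - m) = \sum_j (b j * g j - m * b j - C * (a j * g j) + C * m * a j).
    by apply: eq_bigr => j _; ring.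
  rewrite big_split /= sumrB sumrB -!mulr_sumr a1 -/(fmean a g) -/m -/Z.
  have -> : fmean (fun j => b j / Z) g = (\sum_j b j * g j) / Z.
    by rewrite /fmean mulr_suml; apply: eq_bigr => j _; rewrite mulrAC.
  by field; rewrite gt_eqF.
have D0 : 0 <= D by rewrite mulr_ge0 ?(ltW ek0)// subr_ge0.
rewrite fvarE// -/m mulr_suml.
have -> : al / 2 * (\sum_j a j * (g j - m) ^+ 2) + D ^+ 2 / (2 * al) =
    \sum_j a j * (al / 2 * (g j - m) ^+ 2 + D ^+ 2 / (2 * al)).
  rewrite -[X in _ + X]mul1r -[X in _ + X * _]a1 mulr_sumr mulr_suml -big_split.
  by apply: eq_bigr => j _ /=; ring.
apply: ler_sum => j _.
have bC : `|b j - C * a j| <= (expR k - 1) * (C * a j).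
  have Ca : 0 <= C * a j by rewrite mulr_ge0 ?ltW.
  have : 1 - expR (- k) <= expR k - 1.
    by have := sqr_ge0 (expR k - 1); have := ltW (expR_gt0 (- k)) => e0 sq;
       have := mulr_ge0 e0 sq; rewrite expr2 mulrBl !mulrBr; nra.
  have /andP[l u] := ab j; move: l u; rewrite -!mulrA => l u H.
  have := ler_wpM2r Ca H; rewrite mulrBl ler_norml => H'.
  by apply/andP; split; lra.
have aj := a0 j.
apply: (@le_trans _ _ ((D * a j) * `|g j - m|)).
  apply: le_trans (ler_norm _) _; rewrite !normrM normfV (gtr0_norm b0).
  rewrite mulrAC ler_wpM2r//.
  apply: (@le_trans _ _ ((expR k - 1) * (C * a j) / Z)).
    by rewrite ler_wpM2r// invr_ge0 ltW.
  rewrite (_ : _ / Z = (expR k - 1) * (C / Z) * a j); last by ring.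
  by rewrite /D ler_wpM2r ?(ltW aj)// ler_wpM2l// subr_ge0.
rewrite mulrAC mulrC ler_wpM2l ?(ltW aj)//.
have -> : (g j - m) ^+ 2 = `|g j - m| ^+ 2 by rewrite real_normK ?num_real.
move: (`|g j - m|) => x.
rewrite -subr_ge0 (_ : _ - _ = (al * x - D) ^+ 2 / (2 * al)).
  by rewrite divr_ge0 ?sqr_ge0// mulr_ge0// ltW.
by field; rewrite gt_eqF.
Qed.

End RatioBound.

(** * The transport inequality implies the Poincare inequality *)

Lemma le_of_le_addM (R : realType) (x y Q s0 : R) : 0 < s0 ->
  (forall s, 0 < s <= s0 -> x <= y + s * Q) -> x <= y.
Proof.
move=> s00 H; apply/ler_addgt0Pr => e e0.
pose s := Num.min s0 (e / (`|Q| + 1)).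
have Q1 : 0 < `|Q| + 1 by rewrite ltr_wpDl.
have s1 : 0 < s by rewrite lt_min s00 divr_gt0.
have s2 : s <= s0 by rewrite ge_min lexx.
have s3 : s <= e / (`|Q| + 1) by rewrite ge_min lexx orbT.
have := H s; rewrite s1 s2 => /(_ isT) /le_trans; apply; rewrite lerD2l.
apply: (@le_trans _ _ (s * (`|Q| + 1))).
  by rewrite ler_wpM2l ?(ltW s1)// (le_trans (ler_norm _))// lerDl.
by rewrite -ler_pdivlMr.
Qed.

Section Poincare.
Context (R : realType) (d : nat) (nu : probability (borel 'rV[R]_d) R) (tau : R).
Hypotheses (tau0 : 0 < tau) (hnu : TI tau nu).
Context (N : nat) (w : 'I_N -> borel 'rV[R]_d -> R) (S : set (borel 'rV[R]_d)) (kappa r : R).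
Hypothesis mw : forall j, measurable_fun setT (w j).
Hypothesis w_gt0 : forall j y, 0 < w j y.
Hypothesis w_sum : forall y, \sum_j w j y = 1.
Hypotheses (mS : measurable S) (nuS : nu S = 1%E).
Hypotheses (kappa0 : 0 < kappa) (r0 : 0 < r).
Hypothesis ratio : forall y y', S y -> S y' -> enorm (y' - y : 'rV[R]_d) < r ->
  exists2 C : R, 0 < C & forall j,
    expR (- (kappa * enorm (y' - y : 'rV[R]_d))) * C * w j y <= w j y' <=
      expR (kappa * enorm (y' - y : 'rV[R]_d)) * C * w j y.

Variables h g : 'I_N -> R.
Let u y := fmean (fun j => tilt w h j y) g.
Let V y := fvar (fun j => tilt w h j y) g.

Let bu : bounded_mfun u. Proof. exact: bmfun_fmean_tilt. Qed.
Let bV : bounded_mfun V. Proof. exact: bmfun_fvar_tilt. Qed.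
Let V0 y : 0 <= V y. Proof. by apply: fvar_ge0; exact: tilt_flaw. Qed.

(** The conditional laws at nearby points have bounded ratio after normalization, and
    the reweighting by [e^(- h)] preserves this. *)
Lemma tilt_mean_near y y' (al : R) : S y -> S y' -> enorm (y' - y : 'rV[R]_d) < r -> 0 < al ->
  u y' - u y <= al / 2 * V y +
    ((expR (kappa * enorm (y' - y : 'rV[R]_d)) - 1) * expR (kappa * enorm (y' - y : 'rV[R]_d))) ^+ 2 / (2 * al).
Proof.
move=> Sy Sy' yr al0; have [C C0 HC] := ratio Sy Sy' yr.
have fl y0 : flaw (fun j => w j y0) by split => // j; exact: ltW.
have S0 y0 : 0 < fmgf (fun j => w j y0) h by exact: fmgf_gt0.
have := @fmean_ratio_bound R 'I_N (fun j => tilt w h j y) (fun j => w j y' * expR (- h j)) g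
  (kappa * enorm (y' - y : 'rV[R]_d)) (C * fmgf (fun j => w j y) h) al.
apply => //.
- by move=> j; exact: tilt_gt0.
- by rewrite mulr_ge0 ?sqrtr_ge0// ltW.
- by rewrite mulr_gt0.
- exact: (tilt_flaw w_gt0 w_sum h y).2.
- exact: S0.
move=> j; have /andP[l1 l2] := HC j.
have E (x : R) : x * (C * fmgf (fun j => w j y) h) * tilt w h j y = x * C * w j y * expR (- h j).
  by rewrite /tilt; field; rewrite gt_eqF.
by rewrite !E !ler_wpM2r ?expR_ge0.
Qed.

(** For short displacements the factor [((e^k - 1) e^k)^2] is [k^2] up to [1 + de]; for
    long ones the boundedness of [u] is absorbed in the constant [C]. *)
Lemma tilt_mean_quadratic (de : R) : 0 < de -> exists2 C : R, 0 <= C & forall y y' (al : R),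
  S y -> S y' -> 0 < al ->
  u y' - u y <= al / 2 * V y + (kappa ^+ 2 * (1 + de) / (2 * al) + C) * enorm (y' - y : 'rV[R]_d) ^+ 2.
Proof.
move=> de0; have [B B0 gB] := finite_fun_bounded g.
have uB y : `|u y| <= B by apply: fmean_norm_le => //; exact: tilt_flaw.
have L0 : 0 < ln (1 + de) by rewrite ln_gt0// ltrDl.
(* below this scale [e^(4 kappa z) <= 1 + de] *)
pose rho := Num.min r (ln (1 + de) / (4 * kappa)).
have rho0 : 0 < rho by rewrite lt_min r0 divr_gt0// mulr_gt0.
exists (2 * B / rho ^+ 2); first by rewrite divr_ge0 ?sqr_ge0// mulr_ge0.
move=> y y' al Sy Sy' al0; set z := enorm _.
have z0 : 0 <= z by exact: sqrtr_ge0.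
have C0 : 0 <= 2 * B / rho ^+ 2 * z ^+ 2.
  by rewrite mulr_ge0 ?sqr_ge0// divr_ge0 ?sqr_ge0// mulr_ge0.
have K0 : 0 <= kappa ^+ 2 * (1 + de) / (2 * al) * z ^+ 2.
  rewrite mulr_ge0 ?sqr_ge0// divr_ge0//; last by rewrite mulr_ge0// ltW.
  by rewrite mulr_ge0 ?sqr_ge0//; lra.
have A0 : 0 <= al / 2 * V y by rewrite mulr_ge0// divr_ge0// ltW.
rewrite [X in _ <= _ + X]mulrDl.
have [zr|rz] := ltP z rho; last first.
  have : 2 * B <= 2 * B / rho ^+ 2 * z ^+ 2.
    rewrite mulrAC ler_pdivlMr ?exprn_gt0// ler_wpM2l ?mulr_ge0//.
    by rewrite lerXn2r ?nnegrE ?(ltW rho0).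
  have := uB y; have := uB y'; rewrite !ler_norml => /andP[_ u1] /andP[u2 _].
  move: (al / 2 * V y) (2 * B / rho ^+ 2 * z ^+ 2) (_ * z ^+ 2) A0 C0 K0 => *; lra.
have zr1 : z < r by apply: lt_le_trans zr _; rewrite ge_min lexx.
have zr2 : kappa * z * 4 <= ln (1 + de).
  have : z <= ln (1 + de) / (4 * kappa) by apply: (le_trans (ltW zr)); rewrite ge_min lexx orbT.
  by rewrite ler_pdivlMr ?mulr_gt0//; lra.
have := tilt_mean_near Sy Sy' zr1 al0; rewrite -/z => H; apply: le_trans H _.
rewrite lerD2l.
have kz0 : 0 <= kappa * z by rewrite mulr_ge0// ltW.
set k := kappa * z in zr2 kz0 *.
have e1 : expR k - 1 <= k * expR k.
  have := ler_wpM2l (expR_ge0 k) (expR_ge1Dx (- k)).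
  by rewrite -expRD subrr expR0; lra.
have e0 : 0 <= expR k - 1 by rewrite subr_ge0 -expR0 ler_expR.
have D2 : ((expR k - 1) * expR k) ^+ 2 <= k ^+ 2 * (1 + de).
  apply: (@le_trans _ _ (k ^+ 2 * expR (k * 4))); last first.
    rewrite ler_wpM2l ?sqr_ge0//; apply: (@le_trans _ _ (expR (ln (1 + de)))).
      by rewrite ler_expR.
    by rewrite lnK// posrE; lra.
  have -> : k ^+ 2 * expR (k * 4) = ((k * expR k) * expR k) ^+ 2.
    have -> : k * 4 = k + k + (k + k) by ring.
    by rewrite !expRD; ring.
  have ek := expR_ge0 k.
  have p1 : 0 <= (expR k - 1) * expR k by rewrite mulr_ge0.
  have p2 : 0 <= k * expR k * expR k := mulr_ge0 (mulr_ge0 kz0 ek) ek.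
  by rewrite lerXn2r// ler_wpM2r.
apply: (@le_trans _ _ (kappa ^+ 2 * (1 + de) / (2 * al) * z ^+ 2)); last by rewrite lerDl.
rewrite [leRHS]mulrAC ler_wpM2r ?invr_ge0 ?mulr_ge0 ?(ltW al0)//.
by apply: (le_trans D2); rewrite /k exprMn mulrAC.
Qed.

Let ubar := \int[nu]_y u y.
Let VarU := \int[nu]_y (u y ^+ 2) - ubar ^+ 2.
Let EV := \int[nu]_y V y.

Lemma var_centered : VarU = \int[nu]_y ((u y - ubar) ^+ 2).
Proof.
have bu2 : bounded_mfun (fun y => u y ^+ 2) by exact: bmfunX.
have -> : \int[nu]_y ((u y - ubar) ^+ 2) =
   \int[nu]_y (u y ^+ 2 - 2 * ubar * u y + ubar ^+ 2).
  by apply: eq_Rintegral => y _; ring.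
have b1 : bounded_mfun (fun y => 2 * ubar * u y) by apply: bmfunM => //; exact: bmfun_cst.
rewrite EID ?EI_cst; [|exact: bmfunB|exact: bmfun_cst].
rewrite EIB// EIZ// -/ubar /VarU; ring.
Qed.

Lemma var_ge0 : 0 <= VarU.
Proof.
rewrite var_centered; apply: EI_ge; last by move=> y; exact: sqr_ge0.
by apply: bmfunX; apply: bmfunB => //; exact: bmfun_cst.
Qed.

(** The law with density [1 + s (u - ubar)] has entropy [s^2 / 2 VarU] up to [O(s^3)],
    so the transport inequality gives a coupling of cost [tau s^2 VarU + O(s^3)], while
    the mean of [u] moves by [s VarU]. *)
Lemma perturbed_coupling : exists C s0 : R, [/\ 0 <= C, 0 < s0 &
  forall s, 0 < s <= s0 -> exists mu : probability (borel 'rV[R]_d) R,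
  exists2 pi : probability (borel 'rV[R]_d * borel 'rV[R]_d)%type R,
  coupling mu nu pi &
  [/\ mu `<< nu, (\int[pi]_z ((enorm (z.1 - z.2)) ^+ 2)%:E < (tau * s ^+ 2 * VarU + C * s ^+ 3)%:E)%E &
      \int[mu]_y u y = ubar + s * VarU]].
Proof.
have [_ [B0 uB0]] := bu; pose B : R := `|B0| + 1.
have Bp : 0 < B by rewrite /B ltr_wpDl.
have uB y : `|u y| <= B.
  by rewrite (le_trans (uB0 y))// /B (le_trans (ler_norm _))// lerDl.
have ubB : `|ubar| <= B.
  rewrite ler_norml EI_ge ?EI_le_cst// => y; have := uB y; by rewrite ler_norml => /andP[].
pose v y := u y - ubar.
have bv : bounded_mfun v by apply: bmfunB => //; exact: bmfun_cst.
have vB y : `|v y| <= 2 * B.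
  by rewrite (le_trans (ler_normB _ _))//; have := uB y; lra.
have Ev : \int[nu]_y v y = 0 by rewrite EIB ?EI_cst ?subrr//; exact: bmfun_cst.
(* [2 tau] times the cubic error [8 B^3 s^3] of the entropy, and 1 for a strict bound *)
exists (16 * tau * B ^+ 3 + 1), (4 * B)^-1; split.
- by rewrite addr_ge0// !mulr_ge0 ?exprn_ge0 ?ltW.
- by rewrite invr_gt0 mulr_gt0.
move=> s /andP[s0 sB].
have sv y : `|s * v y| <= 2^-1.
  rewrite normrM gtr0_norm//.
  apply: (@le_trans _ _ ((4 * B)^-1 * (2 * B))); first by apply: ler_pM => //; exact: ltW.
  by rewrite (_ : _ * _ = 2^-1)//; field; rewrite gt_eqF.
pose D y := 1 + s * v y.
have bsv : bounded_mfun (fun y => s * v y) by apply: bmfunM => //; exact: bmfun_cst.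
have bD : bounded_mfun D by apply: bmfunD => //; exact: bmfun_cst.
have D0 y : 0 < D y by have := sv y; rewrite /D ler_norml => /andP[]; lra.
have D0' y : 0 <= D y by exact: ltW.
have ED : \int[nu]_y D y = 1.
  by rewrite EID ?EI_cst ?EIZ ?Ev ?mulr0 ?addr0//; exact: bmfun_cst.
have EDe : (\int[nu]_y (D y)%:E = 1)%E.
  rewrite -[LHS]fineK; last exact: integrable_fin_num (bmfun_int nu bD).
  by rewrite -[fine _]/(\int[nu]_y D y) ED.
have [mu muD] := density_prob_exists bD.1 D0' EDe.
have mudom := density_dominates bD.1 muD.
have bln : bounded_mfun (fun y => ln (D y)).
  split; first by apply: measurableT_comp => //; exact: bD.1.
  exists (ln 2) => y; have := sv y; rewrite ler_norml => /andP[l1 l2].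
  rewrite ler_norml; apply/andP; split.
    by rewrite -lnV ?posrE// ler_ln ?posrE ?invr_gt0// /D; lra.
  by rewrite ler_ln ?posrE// /D; lra.
have HE : rel_entropy mu nu = (\int[nu]_y (ln (D y) * D y))%:E.
  rewrite (density_rel_entropy bD.1 muD)// -(EI_density bD muD bln).
  by rewrite /Rintegral fineK//; exact: integrable_fin_num (bmfun_int mu bln).
have bv2 : bounded_mfun (fun y => v y ^+ 2) by exact: bmfunX.
have HB : \int[nu]_y (ln (D y) * D y) <= s ^+ 2 / 2 * VarU + 8 * B ^+ 3 * s ^+ 3.
  apply: (@le_trans _ _ (\int[nu]_y (s * v y + s ^+ 2 / 2 * v y ^+ 2 + 8 * B ^+ 3 * s ^+ 3))).
    have bsv2 : bounded_mfun (fun y => s ^+ 2 / 2 * v y ^+ 2) by apply: bmfunM => //; exact: bmfun_cst.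
    apply: EI_le; first exact: bmfunM.
      by apply: bmfunD; [exact: bmfunD|exact: bmfun_cst].
    move=> y; rewrite mulrC /D.
    have := sv y; rewrite ler_norml => /andP[l1 l2].
    apply: (le_trans (xlnx_le _)); first by lra.
    have -> : s ^+ 2 / 2 * v y ^+ 2 = (s * v y) ^+ 2 / 2 by rewrite exprMn; ring.
    have : `|s * v y| ^+ 3 <= (s * (2 * B)) ^+ 3.
      rewrite lerXn2r ?nnegrE ?mulr_ge0 ?(ltW s0) ?(ltW Bp)//.
      by rewrite normrM gtr0_norm// ler_pM2l.
    have -> : (s * (2 * B)) ^+ 3 = 8 * B ^+ 3 * s ^+ 3 by ring.
    move=> X; move: (8 * B ^+ 3 * s ^+ 3) X => X H.
    have : - (s * v y) ^+ 3 / 6 + (s * v y) ^+ 4 / 6 <= `|s * v y| ^+ 3.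
      have := sv y; have n0 := normr_ge0 (s * v y).
      have -> : (s * v y) ^+ 4 = `|s * v y| ^+ 4.
        by rewrite -[in RHS]normrX ger0_norm// exprn_even_ge0.
      have : - (s * v y) ^+ 3 <= `|s * v y| ^+ 3 by rewrite -normrX -normrN ler_norm.
      move: (`|s * v y|) (- (s * v y) ^+ 3) n0 => x c x0 cx x2.
      have : 0 <= x ^+ 3 by rewrite exprn_ge0.
      have : 0 <= x ^+ 3 * (1 - x) by rewrite mulr_ge0 ?exprn_ge0//; lra.
      by rewrite (exprS x 3); lra.
    by lra.
  have bsv2 : bounded_mfun (fun y => s ^+ 2 / 2 * v y ^+ 2) by apply: bmfunM => //; exact: bmfun_cst.
  rewrite EID ?EI_cst; [|exact: bmfunD|exact: bmfun_cst].
  by rewrite EID// !EIZ// Ev mulr0 add0r var_centered.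
have HE' : (rel_entropy mu nu <= (s ^+ 2 / 2 * VarU + 8 * B ^+ 3 * s ^+ 3)%:E)%E.
  by rewrite HE lee_fin.
have [|pi cpi picost] := @TI_coupling _ _ tau mu nu _
  (tau * s ^+ 2 * VarU + (16 * tau * B ^+ 3 + 1) * s ^+ 3) hnu HE' tau0.
  have : 0 < s ^+ 3 by rewrite exprn_gt0.
  by move: (B ^+ 3) (s ^+ 3) (s ^+ 2) VarU => *; lra.
exists mu, pi => //; split => //.
rewrite (EI_density bD muD bu).
have -> : \int[nu]_y (u y * D y) = \int[nu]_y (u y + s * (u y ^+ 2 - ubar * u y)).
  by apply: eq_Rintegral => y _; rewrite /D /v; ring.
have bu2 : bounded_mfun (fun y => u y ^+ 2) by exact: bmfunX.
have bub : bounded_mfun (fun y => ubar * u y) by apply: bmfunM => //; exact: bmfun_cst.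
rewrite EID//; last by apply: bmfunM; [exact: bmfun_cst|exact: bmfunB].
by rewrite EIZ ?EIB ?EIZ//; exact: bmfunB.
Qed.

(** Integration of the pointwise inequality against the coupling, whose two marginals
    both live on [S]. *)
Lemma transport_gap (mu : probability (borel 'rV[R]_d) R)
    (pi : probability (borel 'rV[R]_d * borel 'rV[R]_d)%type R) (al c b : R) :
  coupling mu nu pi -> mu `<< nu -> 0 < al -> 0 <= c ->
  (forall y y', S y -> S y' -> u y' - u y <= al / 2 * V y + c * enorm (y' - y : 'rV[R]_d) ^+ 2) ->
  (\int[pi]_z ((enorm (z.1 - z.2)) ^+ 2)%:E <= b%:E)%E ->
  \int[mu]_y u y <= ubar + al / 2 * EV + c * b.
Proof.
move=> cpi dom al0 c0 H cost; have [_ [B uB]] := bu.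
have uB0 y : 0 <= u y + B by have := uB y; rewrite ler_norml => /andP[]; lra.
have bu' : bounded_mfun (fun y => u y + B) by apply: bmfunD => //; exact: bmfun_cst.
have bR : bounded_mfun (fun y => u y + B + al / 2 * V y).
  by apply: bmfunD => //; apply: bmfunM => //; exact: bmfun_cst.
have R0 y : 0 <= u y + B + al / 2 * V y.
  by rewrite addr_ge0// mulr_ge0// divr_ge0// ltW.
have finI (P : probability (borel 'rV[R]_d) R) (f : borel 'rV[R]_d -> R) : bounded_mfun f ->
    (\int[P]_y (f y)%:E = (\int[P]_y f y)%:E)%E.
  by move=> bf; rewrite /Rintegral fineK//; exact: integrable_fin_num (bmfun_int P bf).
have I1 : (\int[pi]_z (u z.1 + B)%:E = (\int[mu]_y u y + B)%:E)%E.
  rewrite (ge0_integral_coupling1 cpi (f := fun y => (u y + B)%:E)).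
  - by rewrite finI// EID ?EI_cst//; exact: bmfun_cst.
  - by apply/measurable_EFinP; case: bu'.
  - by move=> y; rewrite lee_fin.
have I2 : (\int[pi]_z (u z.2 + B + al / 2 * V z.2)%:E = (ubar + B + al / 2 * EV)%:E)%E.
  rewrite (ge0_integral_coupling2 cpi (f := fun y => (u y + B + al / 2 * V y)%:E)).
  - rewrite finI// EID//; last by apply: bmfunM => //; exact: bmfun_cst.
    by rewrite EID ?EI_cst ?EIZ//; exact: bmfun_cst.
  - by apply/measurable_EFinP; case: bR.
  - by move=> y; rewrite lee_fin.
have msq := @measurable_enorm_sqr R d.
have mL : measurable_fun setT (fun z : borel 'rV[R]_d * borel 'rV[R]_d => (u z.1 + B)%:E).
  apply/measurable_EFinP; apply: (measurableT_comp bu'.1 measurable_fst).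
have mR2 : measurable_fun setT (fun z : borel 'rV[R]_d * borel 'rV[R]_d => (u z.2 + B + al / 2 * V z.2)%:E).
  apply/measurable_EFinP; apply: (measurableT_comp bR.1 measurable_snd).
have mR3 : measurable_fun setT (fun z : borel 'rV[R]_d * borel 'rV[R]_d => (c * enorm (z.1 - z.2) ^+ 2)%:E).
  by apply/measurable_EFinP; apply: measurable_funM => //; exact: measurable_cst.
have piS : pi (fst @^-1` (~` S)) = 0%E /\ pi (snd @^-1` (~` S)) = 0%E.
  have nuC : nu (~` S) = 0%E by rewrite probability_setC// nuS subee.
  split; last by rewrite cpi.2//; exact: measurableC.
  rewrite cpi.1; last exact: measurableC.
  by have /null_content_dominatesP := dom; apply => //; exact: measurableC.
have : (\int[pi]_z (u z.1 + B)%:E <=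
    \int[pi]_z ((u z.2 + B + al / 2 * V z.2)%:E + (c * enorm (z.1 - z.2) ^+ 2)%:E))%E.
  apply: ae_ge0_le_integral => //.
  - by move=> z _; rewrite lee_fin.
  - move=> z _; rewrite -EFinD lee_fin addr_ge0// mulr_ge0//; exact: sqr_ge0.
  - exact: emeasurable_funD.
  exists ((fst @^-1` (~` S)) `|` (snd @^-1` (~` S))); split.
  - apply: measurableU; rewrite -[X in measurable X]setTI.
      by apply: measurable_fst => //; exact: measurableC.
    by apply: measurable_snd => //; exact: measurableC.
  - have [p1 p2] := piS; apply/eqP; rewrite -measure_le0.
    apply: le_trans (measureU2 _ _ _) _.
    + by rewrite -[X in measurable X]setTI; apply: measurable_fst => //; exact: measurableC.
    + by rewrite -[X in measurable X]setTI; apply: measurable_snd => //; exact: measurableC.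
    by rewrite [X in (X + _ <= _)%E]p1 [X in (_ + X <= _)%E]p2 adde0.
  move=> z /= Hz; apply: contrapT => /not_orP[/contrapT S1 /contrapT S2].
  apply: Hz => _; rewrite -EFinD lee_fin.
  by have := H _ _ S2 S1; lra.
rewrite I1 ge0_integralD//; last 2 first.
- by move=> z _; rewrite lee_fin.
- by move=> z _; rewrite lee_fin mulr_ge0// sqr_ge0.
rewrite I2 => /le_trans H1.
have : (\int[pi]_z (c * enorm (z.1 - z.2) ^+ 2)%:E <= (c * b)%:E)%E.
  under eq_integral do rewrite EFinM.
  rewrite ge0_integralZl//.
  - by rewrite EFinM lee_wpmul2l// lee_fin.
  - by apply/measurable_EFinP.
  - by move=> z _; rewrite lee_fin sqr_ge0.
move=> H2; have := H1 _ (leeD (lexx _) H2).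
by rewrite -EFinD lee_fin; lra.
Qed.

(** Along the perturbation of size [s], the gain [s VarU] of the mean of [u] is at most
    [al / 2 EV] plus a multiple of the transport cost. With [al = s kappa^2 tau] both
    terms are linear in [s]: the transport term returns half of [s VarU], and dividing
    by [s] and letting [s] tend to 0 gives the constant [kappa^2 tau]. *)
Theorem poincare_tilt : VarU <= kappa ^+ 2 * tau * EV.
Proof.
have EV0 : 0 <= EV by exact: EI_ge.
suff H (de : R) : 0 < de -> VarU <= kappa ^+ 2 * tau * (1 + de) * EV.
  apply: (@le_of_le_addM R _ _ (kappa ^+ 2 * tau * EV) 1) => // s /andP[s0 _].
  by have := H _ s0; lra.
move=> de0; have [C C0 lipu] := tilt_mean_quadratic de0.
have [C' [s0 [C'0 s00 Hs]]] := perturbed_coupling.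
pose a := kappa ^+ 2 * tau * (1 + de).
have de1 : 0 < 1 + de by lra.
have a0 : 0 < a by rewrite !mulr_gt0// exprn_gt0.
have VU0 := var_ge0.
pose Q := C' / tau + 2 * (C * (tau * VarU + C' * s0)).
rewrite -/a; apply: (@le_of_le_addM R _ _ Q s0) => // s /andP[sp ss0].
have [mu [pi cpi [dom cost Emu]]] : exists mu : probability (borel 'rV[R]_d) R,
  exists2 pi : probability (borel 'rV[R]_d * borel 'rV[R]_d)%type R,
  coupling mu nu pi &
  [/\ mu `<< nu, (\int[pi]_z ((enorm (z.1 - z.2)) ^+ 2)%:E < (tau * s ^+ 2 * VarU + C' * s ^+ 3)%:E)%E &
      \int[mu]_y u y = ubar + s * VarU] by apply: Hs; rewrite sp.
(* this [al] gives the transport cost the coefficient [1 / (2 s tau)] *)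
pose al := s * a; have al0 : 0 < al by rewrite mulr_gt0.
pose c := kappa ^+ 2 * (1 + de) / (2 * al) + C.
have c0 : 0 <= c.
  apply: addr_ge0 => //; apply: divr_ge0; last by rewrite mulr_ge0// ltW.
  by rewrite mulr_ge0 ?sqr_ge0// ltW.
have := transport_gap cpi dom al0 c0 _ (ltW cost); rewrite Emu => T.
have {}T := T (fun y y' Sy Sy' => lipu y y' al Sy Sy' al0).
have ct : kappa ^+ 2 * (1 + de) / (2 * al) = (2 * s * tau)^-1.
  by rewrite /al /a; field; rewrite !gt_eqF.
have T1 : s * VarU <= s * (a / 2 * EV + 2^-1 * VarU + s * (C' / (2 * tau)) +
     s * (C * (tau * VarU + C' * s))).
  have -> : s * (a / 2 * EV + 2^-1 * VarU + s * (C' / (2 * tau)) +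
     s * (C * (tau * VarU + C' * s))) =
    al / 2 * EV + c * (tau * s ^+ 2 * VarU + C' * s ^+ 3).
    rewrite /c ct /al.
    have gen (x y z : R) : s * (z / 2 * y + 2^-1 * x + s * (C' / (2 * tau)) + s * (C * (tau * x + C' * s))) =
      s * z / 2 * y + ((2 * s * tau)^-1 + C) * (tau * s ^+ 2 * x + C' * s ^+ 3).
      by field; rewrite !gt_eqF.
    exact: gen.
  by move: T; move: (c * _) (al / 2 * EV) (s * VarU) => *; lra.
move: T1; rewrite ler_pM2l// => T1.
have : s * (C * (tau * VarU + C' * s)) <= s * (C * (tau * VarU + C' * s0)).
  by rewrite ler_pM2l// ler_wpM2l// lerD2l ler_wpM2l.
have E1 : C' / (2 * tau) = 2^-1 * (C' / tau) by field; rewrite gt_eqF.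
rewrite /Q; move: T1; rewrite E1.
have gen (A1 B1 C1 D1 X : R) : X <= a / 2 * D1 + 2^-1 * X + s * (2^-1 * C1) + A1 ->
    A1 <= s * B1 -> X <= a * D1 + s * (C1 + 2 * B1) by move=> *; lra.
exact: gen.
Qed.

End Poincare.

(** * Averages against a positive kernel *)

Lemma EI_cvg d (T : measurableType d) (R : realType) (P : probability T R)
    (F : nat -> T -> R) (G : T -> R) (B : R) :
  (forall n, measurable_fun setT (F n)) -> measurable_fun setT G ->
  (forall n x, `|F n x| <= B) -> (forall x, F n x @[n --> \oo] --> G x) ->
  \int[P]_x F n x @[n --> \oo] --> \int[P]_x G x.
Proof.
move=> mF mG FB FG.
have GB x : `|G x| <= B.
  by apply: (ler_cvg_to (cvg_norm (FG x)) (cvg_cst B)); apply: nearW.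
have bG : bounded_mfun G by split=> //; exists B.
have /fine_cvgP[_ H] : (\int[P]_x (F n x)%:E)%E @[n --> \oo] --> (\int[P]_x G x)%:E.
  rewrite /Rintegral fineK; last exact: integrable_fin_num (bmfun_int P bG).
  apply: (@dominated_cvg _ _ _ _ _ measurableT (fun n x => (F n x)%:E) _ (fun=> B%:E)).
  - by move=> n; apply/measurable_EFinP.
  - by move=> x _; apply/fine_cvgP; split; [exact: nearW|exact: FG].
  - by [].
  - exact: (bmfun_int P (bmfun_cst _ B)).
  - by move=> n x _; rewrite /= lee_fin.
exact: H.
Qed.

Section Kernel.
Context dX dY (X : measurableType dX) (Y : measurableType dY) (R : realType).
Variables (rho : probability X R) (f : X -> Y -> R).
Hypothesis mf : measurable_fun setT (fun z : X * Y => f z.1 z.2).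
Hypothesis f0 : forall x y, 0 < f x y.
Hypothesis fi : forall y, rho.-integrable setT (fun x => (f x y)%:E).
Implicit Types G : X -> R.

Definition kint G (y : Y) : R := \int[rho]_x (G x * f x y).

Let mfy y : measurable_fun setT (fun x => f x y).
Proof. by apply/measurable_EFinP; exact: measurable_int (fi y). Qed.

Lemma kint_integrable G y : bounded_mfun G -> rho.-integrable setT (fun x => (G x * f x y)%:E).
Proof.
move=> [mG [B GB]].
apply: (@le_integrable _ _ _ rho _ measurableT _ (fun x => (B%:E * (f x y)%:E)%E)).
- by apply/measurable_EFinP; exact: measurable_funM.
- move=> x _; rewrite -EFinM /= lee_fin !normrM ler_wpM2r//.
  by apply: le_trans (GB x) (ler_norm _).
- exact: integrableZl.
Qed.

Lemma kintE G y : bounded_mfun G -> (\int[rho]_x (G x * f x y)%:E = (kint G y)%:E)%E.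
Proof.
by move=> bG; rewrite /kint /Rintegral fineK//; exact: integrable_fin_num (kint_integrable y bG).
Qed.

Lemma kint_le G G' y : bounded_mfun G -> bounded_mfun G' -> (forall x, G x <= G' x) ->
  kint G y <= kint G' y.
Proof.
move=> bG bG' GG'; apply: le_Rintegral => //; [exact: kint_integrable..|].
by move=> x _; rewrite ler_wpM2r ?(ltW (f0 _ _)).
Qed.

Lemma kintZ (r : R) G y : bounded_mfun G -> kint (fun x => r * G x) y = r * kint G y.
Proof.
move=> bG; rewrite /kint -RintegralZl//; last exact: kint_integrable.
by apply: eq_Rintegral => x _; rewrite mulrA.
Qed.

Lemma kint0 y : kint (fun=> 0) y = 0.
Proof. by rewrite /kint; under eq_Rintegral do rewrite mul0r; exact: EI_cst. Qed.

Lemma kintD G G' y : bounded_mfun G -> bounded_mfun G' ->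
  kint (fun x => G x + G' x) y = kint G y + kint G' y.
Proof.
move=> bG bG'; rewrite /kint; under eq_Rintegral do rewrite mulrDl.
by rewrite RintegralD//; exact: kint_integrable.
Qed.

Lemma kint_sum (I : Type) (s : seq I) (P : pred I) (F : I -> X -> R) y :
  (forall i, bounded_mfun (F i)) ->
  kint (fun x => \sum_(i <- s | P i) F i x) y = \sum_(i <- s | P i) kint (F i) y.
Proof.
move=> bF; elim: s => [|i s IH].
  by under [X in kint X]eq_fun do rewrite big_nil; rewrite big_nil kint0.
under [X in kint X]eq_fun do rewrite big_cons; rewrite big_cons.
by case: (P i) => //; rewrite kintD// ?IH//; exact: bmfun_sum.
Qed.

Lemma measurable_kint G : bounded_mfun G -> (forall x, 0 <= G x) ->
  measurable_fun setT (kint G).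
Proof.
move=> [mG _] G0; apply: measurableT_comp => //.
have mGf : measurable_fun setT (fun z : X * Y => (G z.1 * f z.1 z.2)%:E).
  apply/measurable_EFinP; apply: measurable_funM => //.
  exact: (measurableT_comp mG measurable_fst).
apply: (@measurable_fun_fubini_tonelli_G _ _ X Y R rho _ mGf).
by move=> z; rewrite lee_fin mulr_ge0// ltW.
Qed.

Lemma kint_eq0 (A : set X) G y : measurable A -> bounded_mfun G -> rho A = 0%E ->
  kint (fun x => \1_A x * G x) y = 0.
Proof.
move=> mA bG A0; rewrite /kint /Rintegral.
have -> : (\int[rho]_x (\1_A x * G x * f x y)%:E = \int[rho]_(x in A) (G x * f x y)%:E)%E.
  rewrite [RHS]integral_mkcond; apply: eq_integral => x _.
  by rewrite patchE indicE; case: ifPn; rewrite ?mul1r// !mul0r.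
rewrite null_set_integral//; apply: measurable_funTS.
exact: measurable_int (kint_integrable y bG).
Qed.

Lemma kint_gt0 (A : set X) y : measurable A -> rho A != 0%E -> 0 < kint (\1_A) y.
Proof.
move=> mA A0; rewrite lt_neqAle eq_sym; apply/andP; split; last first.
  by apply: Rintegral_ge0 => x _; rewrite mulr_ge0 ?indicE ?ler0n// ltW.
apply/negP => /eqP k0.
have bA : bounded_mfun (\1_A : X -> R).
  apply: (@bmfun_le _ _ _ _ 1); first exact: measurable_indic.
  by move=> x; rewrite indicE; case: (_ \in _) => /=; rewrite ?lexx ler01.
have mAf : measurable_fun setT (fun x => (\1_A x * f x y)%:E).
  by apply/measurable_EFinP; apply: measurable_funM => //; exact: measurable_indic.
have : (\int[rho]_x `|(\1_A x * f x y)%:E| = 0)%E.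
  rewrite -[RHS]/(0%:E) -k0 -kintE//; apply: eq_integral => x _.
  by rewrite gee0_abs// lee_fin mulr_ge0 ?indicE ?ler0n// ltW.
move/(ae_eq_integral_abs rho measurableT mAf) => [N0 [mN N00 sN]].
move/eqP: A0; apply; apply/eqP; rewrite -measure_le0 -N00; apply: le_measure; rewrite ?inE//.
move=> x Ax; apply: sN => /= /(_ Logic.I) [] /eqP.
by rewrite indicE mem_set// mul1r gt_eqF.
Qed.

Lemma kint_cvg (A : nat -> set X) G y : (forall n, measurable (A n)) -> bounded_mfun G ->
  (forall m n, (m <= n)%N -> A m `<=` A n) -> rho (\bigcup_n A n) = 1%E ->
  kint (fun x => \1_(A n) x * G x) y @[n --> \oo] --> kint G y.
Proof.
move=> mA bG ndA A1; have mU : measurable (\bigcup_n A n) by exact: bigcupT_measurable.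
have bA n : bounded_mfun (fun x => \1_(A n) x * G x).
  apply: bmfunM => //; apply: (@bmfun_le _ _ _ _ 1); first exact: measurable_indic.
  by move=> x; rewrite indicE; case: (_ \in _) => /=; rewrite ?lexx ler01.
have /fine_cvgP[_ H] : (\int[rho]_x (\1_(A n) x * G x * f x y)%:E)%E @[n --> \oo] --> (kint G y)%:E.
  rewrite -kintE//.
  have [] := @dominated_convergence _ _ _ rho _ measurableT
    (fun n x => (\1_(A n) x * G x * f x y)%:E) (fun x => (G x * f x y)%:E) (fun x => `|(G x * f x y)%:E|%E).
  - by move=> n; exact: measurable_int (kint_integrable y (bA n)).
  - exact: measurable_int (kint_integrable y bG).
  - exists (~` (\bigcup_n A n)); split.
    + exact: measurableC.
    + by have E := probability_setC rho mU; rewrite A1 subee// in E; exact: E.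
    move=> x /= Hx Ux; apply: Hx => _; case: Ux => k _ Akx.
    apply: cvg_near_cst; exists k => // n /= kn.
    by rewrite indicE mem_set ?mul1r//; exact: ndA kn _ Akx.
  - by apply: integrable_abse; exact: kint_integrable.
  - apply: nearW => x n _; rewrite /= lee_fin !normrM -mulrA -[leRHS]mul1r.
    rewrite ler_wpM2r ?mulr_ge0// indicE; case: (_ \in _); rewrite /= ?normr1// normr0; exact: ler01.
  by [].
exact: H.
Qed.

End Kernel.

Section RestrictedAverage.
Context dX dY (X : measurableType dX) (Y : measurableType dY) (R : realType).
Variables (rho : probability X R) (f : X -> Y -> R).
Hypothesis mf : measurable_fun setT (fun z : X * Y => f z.1 z.2).
Hypothesis f0 : forall x y, 0 < f x y.
Hypothesis fi : forall y, rho.-integrable setT (fun x => (f x y)%:E).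
Implicit Types (G : X -> R) (A : set X).

(** The mean of [G] over [A] for the law proportional to [f x y rho(dx)]. *)
Definition kavg A G y := kint rho f (fun x => \1_A x * G x) y / kint rho f (\1_A) y.

Lemma bmfun_indic A : measurable A -> bounded_mfun (\1_A : X -> R).
Proof.
move=> mA; apply: (@bmfun_le _ _ _ _ 1); first exact: measurable_indic.
by move=> x; rewrite indicE; case: (_ \in _) => /=; rewrite ?lexx ler01.
Qed.

Section OnSet.
Variable A : set X.
Hypotheses (mA : measurable A) (A0 : rho A != 0%E).

Let bA := bmfun_indic mA.
Let Z0 y : 0 < kint rho f (\1_A) y. Proof. exact: kint_gt0. Qed.
Let ind0 x : 0 <= (\1_A x : R). Proof. by rewrite indicE ler0n. Qed.

Lemma kavg_le G G' y : bounded_mfun G -> bounded_mfun G' ->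
  (forall x, A x -> G x <= G' x) -> kavg A G y <= kavg A G' y.
Proof.
move=> bG bG' GG'; rewrite /kavg ler_wpM2r ?invr_ge0 ?(ltW (Z0 y))//.
apply: kint_le => //; [exact: bmfunM..|move=> x].
rewrite indicE; case: (boolP (x \in A)) => [|_]; last by rewrite !mul0r.
by rewrite inE => Ax; rewrite !mul1r GG'.
Qed.

Lemma kavgZ (r : R) G y : bounded_mfun G -> kavg A (fun x => r * G x) y = r * kavg A G y.
Proof.
move=> bG; rewrite /kavg mulrA -kintZ//; last exact: bmfunM.
by congr (kint _ _ _ _ / _); apply/funext => x; rewrite mulrCA.
Qed.

Lemma kavg_cst (r : R) y : kavg A (fun=> r) y = r.
Proof.
rewrite /kavg (_ : (fun x => _) = fun x => r * \1_A x); last first.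
  by apply/funext => x; rewrite mulrC.
by rewrite kintZ// mulfK// gt_eqF.
Qed.

Lemma kavg_bounds G (a b : R) y : bounded_mfun G -> (forall x, a <= G x <= b) ->
  a <= kavg A G y <= b.
Proof.
move=> bG Gab; apply/andP; split; [rewrite -(kavg_cst a y)|rewrite -(kavg_cst b y)];
  by apply: kavg_le => //; [exact: bmfun_cst|move=> x _; have /andP[] := Gab x].
Qed.

Lemma measurable_kavg G : bounded_mfun G -> (forall x, 0 <= G x) ->
  measurable_fun setT (kavg A G).
Proof.
move=> bG G0; apply: measurable_funM.
  apply: measurable_kint => //; first exact: bmfunM.
  by move=> x; rewrite mulr_ge0.
by apply: measurable_fun_invr_gt0 => //; exact: measurable_kint.
Qed.

End OnSet.
End RestrictedAverage.

Lemma bmfun_expR d (T : measurableType d) (R : realType) (h : T -> R) (l : R) :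
  bounded_mfun h -> bounded_mfun (fun x => expR (l * h x)).
Proof.
move=> [mh [B hB]]; apply: (@bmfun_le _ _ _ _ (expR (`|l| * B))).
  by apply: measurableT_comp => //; apply: measurable_funM => //; exact: measurable_cst.
move=> x; rewrite expR_ge0/= ler_expR (le_trans (ler_norm _))// normrM.
by rewrite ler_wpM2l.
Qed.

Section KernelFreeEnergy.
Context (R : realType) (d : nat) (nu : probability (borel 'rV[R]_d) R) (tau : R).
Hypotheses (tau0 : 0 < tau) (hnu : TI tau nu).
Context dX (X : measurableType dX) (rho : probability X R) (f : X -> borel 'rV[R]_d -> R).
Hypothesis mf : measurable_fun setT (fun z : X * borel 'rV[R]_d => f z.1 z.2).
Hypothesis f0 : forall x y, 0 < f x y.
Hypothesis fi : forall y, rho.-integrable setT (fun x => (f x y)%:E).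
Variables (S : set (borel 'rV[R]_d)) (kappa : R).
Hypotheses (mS : measurable S) (nuS : nu S = 1%E) (kappa0 : 0 < kappa).

(** The constant [C] depends on [y] and [y'] but not on [x]: it disappears when the
    conditional laws are normalized. *)
Definition ratio_controlled (A : set X) := exists2 r : R, 0 < r &
  forall y y', S y -> S y' -> enorm (y' - y : 'rV[R]_d) < r ->
  exists2 C : R, 0 < C & forall x, A x ->
    expR (- (kappa * enorm (y' - y : 'rV[R]_d))) * C * f x y <= f x y' <=
      expR (kappa * enorm (y' - y : 'rV[R]_d)) * C * f x y.

Section Cells.
Variables (A : set X) (M : nat) (C : 'I_M -> set X).
Hypotheses (mA : measurable A) (A0 : rho A != 0%E) (rA : ratio_controlled A).
Hypotheses (mC : forall k, measurable (C k)) (CA : forall k, C k `<=` A).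
Hypothesis C_part : forall x, \sum_k (\1_(C k) x : R) = \1_A x.

Let P : pred 'I_M := [pred k | rho (C k) != 0%E].
Let w (j : 'I_#|P|) y := kint rho f (\1_(C (enum_val j))) y / kint rho f (\1_A) y.
Let Z0 y : 0 < kint rho f (\1_A) y. Proof. exact: kint_gt0. Qed.
Let bC k := bmfun_indic R (mC k).

Let w_gt0 j y : 0 < w j y.
Proof. by rewrite /w divr_gt0//; apply: kint_gt0 => //; have := enum_valP j. Qed.

Let mw j : measurable_fun setT (w j).
Proof.
have i0 B x : 0 <= (\1_B x : R) by rewrite indicE ler0n.
apply: measurable_funM; first exact: measurable_kint.
apply: measurable_fun_invr_gt0 => //; apply: measurable_kint => //.
exact: bmfun_indic.
Qed.

Let kavg_cells (F : 'I_M -> R) y : kavg rho f A (fun x => \sum_k F k * \1_(C k) x) y =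
  \sum_k F k * (kint rho f (\1_(C k)) y / kint rho f (\1_A) y).
Proof.
rewrite /kavg (_ : (fun x => \1_A x * _) = fun x => \sum_k F k * \1_(C k) x); last first.
  apply/funext => x; rewrite mulr_sumr; apply: eq_bigr => k _.
  rewrite !indicE; case: (boolP (x \in C k)) => [|_]; last by rewrite !mulr0.
  by rewrite inE => /CA Ax; rewrite mem_set// mul1r.
rewrite kint_sum//; last by move=> k; apply: bmfunM => //; exact: bmfun_cst.
by rewrite mulr_suml; apply: eq_bigr => k _; rewrite kintZ// mulrA.
Qed.

Let w_avg (F : 'I_M -> R) y : \sum_j w j y * F (enum_val j) =
  kavg rho f A (fun x => \sum_k F k * \1_(C k) x) y.
Proof.
rewrite kavg_cells.
rewrite -(@big_enum_val _ _ _ _ P (fun k => kint rho f (\1_(C k)) y / kint rho f (\1_A) y * F k)).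
rewrite [RHS](bigID (mem P)) /= [X in _ = _ + X]big1 ?addr0.
  by apply: eq_bigr => k _; rewrite mulrC.
move=> k; rewrite unfold_in /= negbK => /eqP Ck0.
have := @kint_eq0 _ _ X _ R rho f fi (C k) (fun=> 1) y (mC k) (bmfun_cst _ 1) Ck0.
by under [X in kint _ _ X]eq_fun do rewrite mulr1; move=> ->; rewrite mul0r mulr0.
Qed.

Let w_sum y : \sum_j w j y = 1.
Proof.
have := w_avg (fun=> 1) y; under eq_bigr do rewrite mulr1; move=> ->.
rewrite -[RHS](kavg_cst f0 fi mA A0 1 y) /kavg; congr (kint _ _ _ _ / _).
apply/funext => x; under eq_bigr do rewrite mul1r.
by rewrite C_part mulr1 indicE; case: (_ \in _); rewrite /= ?mul1r ?mul0r.
Qed.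

Let w_ratio : exists2 r : R, 0 < r & forall y y', S y -> S y' -> enorm (y' - y : 'rV[R]_d) < r ->
  exists2 D : R, 0 < D & forall j,
    expR (- (kappa * enorm (y' - y : 'rV[R]_d))) * D * w j y <= w j y' <=
      expR (kappa * enorm (y' - y : 'rV[R]_d)) * D * w j y.
Proof.
have [r r0 rP] := rA; exists r => // y y' Sy Sy' yr.
have [D D0 DP] := rP _ _ Sy Sy' yr.
exists (D * (kint rho f (\1_A) y / kint rho f (\1_A) y')).
  by rewrite mulr_gt0// divr_gt0.
move=> j; have E (x : R) : x * (D * (kint rho f (\1_A) y / kint rho f (\1_A) y')) * w j y =
    (x * D * kint rho f (\1_(C (enum_val j))) y) / kint rho f (\1_A) y'.
  by rewrite /w; field; rewrite !gt_eqF.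
rewrite !E /w; set k := enum_val j.
have bf y0 : rho.-integrable setT (fun x => (\1_(C k) x * f x y0)%:E).
  by apply: kint_integrable => //.
have bound (x : R) : kint rho f (\1_(C k)) y * x = \int[rho]_z (\1_(C k) z * f z y * x).
  by rewrite [RHS]RintegralZr//; exact: bf.
have bfx (x : R) y0 : rho.-integrable setT (fun z => (\1_(C k) z * f z y0 * x)%:E).
  by under eq_fun do rewrite EFinM; exact: integrableZr.
apply/andP; split; rewrite ler_pM2r ?invr_gt0// mulrC bound.
  apply: le_Rintegral; [by []|exact: bfx|exact: bf|move=> x _].
  rewrite indicE; case: (boolP (x \in C k)) => [|_]; last by rewrite !mul0r.
  by rewrite inE => /CA/DP/andP[l _]; rewrite !mul1r mulrC.
apply: le_Rintegral; [by []|exact: bf|exact: bfx|move=> x _].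
rewrite indicE; case: (boolP (x \in C k)) => [|_]; last by rewrite !mul0r.
by rewrite inE => /CA/DP/andP[_ l]; rewrite !mul1r mulrC.
Qed.

(** A function constant on the cells of a partition sees only the conditional masses of
    the cells, so this is the finite case; null cells are discarded to keep the weights
    positive. *)
Lemma free_energy_ge_simple (p : R) (a : 'I_M -> R) : 1 + kappa ^+ 2 * tau < p ->
  p * ln (\int[nu]_y kavg rho f A (fun x => \sum_k expR (- (a k / p)) * \1_(C k) x) y) <=
  \int[nu]_y ln (kavg rho f A (fun x => \sum_k expR (- a k) * \1_(C k) x) y).
Proof.
move=> Kp; have [r r0 rP] := w_ratio.
have K0 : 0 <= kappa ^+ 2 * tau by rewrite mulr_ge0 ?sqr_ge0// ltW.
have := @freeE_ge _ _ R nu _ w mw w_gt0 w_sum (kappa ^+ 2 * tau) K0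
  (fun h g => poincare_tilt tau0 hnu mw w_gt0 w_sum mS nuS kappa0 r0 rP h g)
  p (fun j => a (enum_val j)) Kp.
have -> : \sum_j \int[nu]_y w j y * expR (- (a (enum_val j) / p)) =
    \int[nu]_y kavg rho f A (fun x => \sum_k expR (- (a k / p)) * \1_(C k) x) y.
  transitivity (\int[nu]_y (\sum_j w j y * expR (- (a (enum_val j) / p)))).
    rewrite EI_sum.
      by apply: eq_bigr => j _; rewrite EIZr//; exact: bmfun_w.
    by move=> j; apply: bmfunM; [exact: bmfun_w|exact: bmfun_cst].
  by apply: eq_Rintegral => y _; rewrite (w_avg (fun k => expR (- (a k / p)))).
congr (_ <= _); apply: eq_Rintegral => y _; congr ln.
by rewrite -(w_avg (fun k => expR (- a k))).
Qed.

End Cells.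
End KernelFreeEnergy.

(** * Free energy bound for a positive kernel *)

Lemma bmfun_expRN d (T : measurableType d) (R : realType) (h : T -> R) :
  bounded_mfun h -> bounded_mfun (fun x => expR (- h x)).
Proof. by move=> /(bmfun_expR (-1)); under eq_fun do rewrite mulN1r. Qed.

Section KernelFreeEnergy.
Context (R : realType) (d : nat) (nu : probability (borel 'rV[R]_d) R) (tau : R).
Hypotheses (tau0 : 0 < tau) (hnu : TI tau nu).
Context dX (X : measurableType dX) (rho : probability X R) (f : X -> borel 'rV[R]_d -> R).
Hypothesis mf : measurable_fun setT (fun z : X * borel 'rV[R]_d => f z.1 z.2).
Hypothesis f0 : forall x y, 0 < f x y.
Hypothesis fi : forall y, rho.-integrable setT (fun x => (f x y)%:E).
Variables (S : set (borel 'rV[R]_d)) (kappa : R).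
Hypotheses (mS : measurable S) (nuS : nu S = 1%E) (kappa0 : 0 < kappa).

Variables (p : R) (h : X -> R).
Hypotheses (Kp : 1 + kappa ^+ 2 * tau < p) (bh : bounded_mfun h).

Let p0 : 0 < p.
Proof.
apply: lt_trans Kp; rewrite (lt_le_trans ltr01)// lerDl mulr_ge0 ?sqr_ge0//.
exact: ltW.
Qed.

Let bhp : bounded_mfun (fun x => h x / p).
Proof. by apply: bmfunM => //; exact: bmfun_cst. Qed.

Section OnSet.
Variable A : set X.
Hypotheses (mA : measurable A) (A0 : rho A != 0%E) (rA : ratio_controlled f S kappa A).

Let kavg_pos (G : X -> R) y : bounded_mfun G -> (exists2 a : R, 0 < a & forall x, a <= G x) ->
  0 < kavg rho f A G y.
Proof.
move=> bG [a a0 aG]; apply: lt_le_trans a0 _.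
rewrite -(kavg_cst f0 fi mA A0 a y); apply: kavg_le => //; exact: bmfun_cst.
Qed.

Let bm_kavg (G : X -> R) : bounded_mfun G -> (forall x, 0 <= G x) ->
  bounded_mfun (kavg rho f A G).
Proof.
move=> bG G0; have [mG [b Gb]] := bG.
apply: (@bmfun_le _ _ _ _ b); first exact: measurable_kavg.
by move=> y; apply: kavg_bounds => // x; rewrite G0 (le_trans (ler_norm _)).
Qed.

Let bm_ln_kavg (G : X -> R) : bounded_mfun G -> (exists2 a : R, 0 < a & forall x, a <= G x) ->
  bounded_mfun (fun y => ln (kavg rho f A G y)).
Proof.
move=> bG [a a0 aG]; have [mG [b Gb]] := bG.
have G0 x : 0 <= G x by apply: le_trans (aG x); exact: ltW.
split; first by apply: measurableT_comp => //; exact: measurable_kavg.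
exists (`|ln a| + `|ln b|) => y.
have /andP[l u] : a <= kavg rho f A G y <= b.
  by apply: kavg_bounds => // x; rewrite aG (le_trans (ler_norm _)).
have k0 := lt_le_trans a0 l.
have L : ln a <= ln (kavg rho f A G y) by rewrite ler_ln ?posrE.
have U : ln (kavg rho f A G y) <= ln b by rewrite ler_ln ?posrE// (lt_le_trans k0).
move: (ln (kavg _ _ _ _ _)) L U => v L U.
have := ler_norm (- ln a); have := ler_norm (ln b); rewrite normrN.
have := normr_ge0 (ln a); have := normr_ge0 (ln b).
move: (`|ln a|) (`|ln b|) (ln a) (ln b) L U => c1 c2 c3 c4 *.
by rewrite ler_norml; apply/andP; split; lra.
Qed.

Let expRN_lbound (g : X -> R) : bounded_mfun g ->
  exists2 a : R, 0 < a & forall x, a <= expR (- g x).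
Proof.
move=> [_ [B gB]]; exists (expR (- B)); first exact: expR_gt0.
by move=> x; rewrite ler_expR lerN2 (le_trans (ler_norm _)).
Qed.

(** The function [h] is rounded down to a grid of step [de], which changes the free
    energy by at most [de]. *)
Lemma free_energy_ge_approx (de : R) : 0 < de ->
  p * ln (\int[nu]_y kavg rho f A (fun x => expR (- (h x / p))) y) <=
  \int[nu]_y ln (kavg rho f A (fun x => expR (- h x)) y) + de.
Proof.
move=> de0; have [mh [B hB]] := bh.
pose t x := (h x + B) / de.
have t0 x : 0 <= t x.
  by rewrite divr_ge0 ?(ltW de0)//; have := hB x; rewrite ler_norml => /andP[]; lra.
pose M := (Num.truncn (2 * B / de)).+1.
have tM x : (Num.truncn (t x) < M)%N.
  rewrite ltnS; apply: le_truncn; rewrite /t ler_wpM2r ?invr_ge0 ?(ltW de0)//.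
  by have := hB x; rewrite ler_norml => /andP[]; lra.
pose a (k : 'I_M) := - B + k%:R * de.
pose C (k : 'I_M) := A `&` (h @^-1` `[a k, a k + de[%classic).
have mC k : measurable (C k).
  by apply: measurableI => //; rewrite -[X in measurable X]setTI; apply: mh.
have CA k : C k `<=` A by move=> x [].
have CE x (k : 'I_M) : A x -> (x \in C k) = (k == Ordinal (tM x)).
  move=> Ax; have [k0 k1] := andP (truncn_itv (t0 x)).
  apply/idP/eqP => [|->]; rewrite inE /C /=.
    move=> [_]; rewrite in_itv /= /a => /andP[l u]; apply/val_inj => /=.
    apply/esym/truncn_def; rewrite /t ler_pdivlMr// ltr_pdivrMr//.
    by apply/andP; split; rewrite -?natr1; lra.
  split => //; rewrite in_itv /= /a /=.
  move: k0 k1; rewrite {2}/t {3}/t ler_pdivlMr// ltr_pdivrMr// -natr1 => k0 k1.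
  by apply/andP; split; lra.
have Cpart x : \sum_k (\1_(C k) x : R) = \1_A x.
  rewrite [RHS]indicE; case: (boolP (x \in A)) => [|nA].
    rewrite inE => Ax; rewrite (bigD1 (Ordinal (tM x)))//= indicE CE// eqxx big1 ?addr0// => k kn.
    by rewrite indicE CE// (negbTE kn).
  by rewrite big1// => k _; rewrite indicE memNset//; move: nA; rewrite notin_setE => nA /CA.
have sumC (F : 'I_M -> R) x : A x -> \sum_k F k * \1_(C k) x = F (Ordinal (tM x)).
  move=> Ax; rewrite (bigD1 (Ordinal (tM x)))//= indicE CE// eqxx mulr1 big1 ?addr0// => k kn.
  by rewrite indicE CE// (negbTE kn) mulr0.
have ah x : A x -> a (Ordinal (tM x)) <= h x < a (Ordinal (tM x)) + de.
  move=> Ax; have : x \in C (Ordinal (tM x)) by rewrite CE.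
  by rewrite inE => -[_]; rewrite /= in_itv.
have H := free_energy_ge_simple tau0 hnu mf f0 fi mS nuS kappa0 mA A0 rA mC CA Cpart a Kp.
have bS (F : 'I_M -> R) : bounded_mfun (fun x => \sum_k F k * \1_(C k) x).
  by apply: bmfun_sum => k; apply: bmfunM; [exact: bmfun_cst|exact: bmfun_indic].
have S0 (F : 'I_M -> R) x : (forall k, 0 <= F k) -> 0 <= \sum_k F k * \1_(C k) x.
  by move=> F0; apply: sumr_ge0 => k _; rewrite mulr_ge0// indicE ler0n.
have bE := bmfun_expRN bh; have bEp := bmfun_expRN bhp.
have L : p * ln (\int[nu]_y kavg rho f A (fun x => expR (- (h x / p))) y) <=
    p * ln (\int[nu]_y kavg rho f A (fun x => \sum_k expR (- (a k / p)) * \1_(C k) x) y).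
  have pos : 0 < \int[nu]_y kavg rho f A (fun x => expR (- (h x / p))) y.
    apply: EI_gt0; first by apply: bm_kavg => // x; exact: expR_ge0.
    by move=> y; apply: kavg_pos => //; exact: expRN_lbound.
  have le : \int[nu]_y kavg rho f A (fun x => expR (- (h x / p))) y <=
      \int[nu]_y kavg rho f A (fun x => \sum_k expR (- (a k / p)) * \1_(C k) x) y.
    apply: EI_le.
    - by apply: bm_kavg => // x; exact: expR_ge0.
    - by apply: bm_kavg => // x; apply: S0 => k; exact: expR_ge0.
    move=> y; apply: kavg_le => // x Ax; rewrite sumC//.
    by rewrite ler_expR lerN2 ler_wpM2r ?invr_ge0 ?(ltW p0)//; have /andP[] := ah _ Ax.
  have gen (u v : R) : 0 < u -> u <= v -> p * ln u <= p * ln v.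
    by move=> u0 uv; rewrite ler_pM2l// ler_ln// posrE// (lt_le_trans u0).
  exact: gen pos le.
apply: le_trans L _; apply: le_trans H _.
rewrite -[X in _ <= _ + X](EI_cst nu de) -EID; last 2 first.
- by apply: bm_ln_kavg => //; exact: expRN_lbound.
- exact: bmfun_cst.
have [c c0 hc] := expRN_lbound bh.
have SA x : A x -> expR (- h x) <= \sum_k expR (- a k) * \1_(C k) x <= expR de * expR (- h x).
  move=> Ax; rewrite sumC// -expRD !ler_expR; have /andP[l u] := ah _ Ax.
  by apply/andP; split; lra.
have kpos y : 0 < kavg rho f A (fun x => expR (- h x)) y by apply: kavg_pos => //; exists c.
have kb y : kavg rho f A (fun x => expR (- h x)) y <=
    kavg rho f A (fun x => \sum_k expR (- a k) * \1_(C k) x) y <=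
    expR de * kavg rho f A (fun x => expR (- h x)) y.
  rewrite -(kavgZ fi mA)//; apply/andP; split; apply: kavg_le => //.
  - by move=> x /SA/andP[].
  - by apply: bmfunM => //; exact: bmfun_cst.
  - by move=> x /SA/andP[].
have spos y : 0 < kavg rho f A (fun x => \sum_k expR (- a k) * \1_(C k) x) y.
  by have /andP[l _] := kb y; exact: lt_le_trans (kpos y) l.
have lnb y : ln (kavg rho f A (fun x => expR (- h x)) y) <=
   ln (kavg rho f A (fun x => \sum_k expR (- a k) * \1_(C k) x) y) <=
   ln (kavg rho f A (fun x => expR (- h x)) y) + de.
  have gen (u v : R) : 0 < u -> 0 < v -> u <= v <= expR de * u -> ln u <= ln v <= ln u + de.
    move=> u0 v0 /andP[l r]; rewrite ler_ln// l /= addrC -{1}(expRK de) -lnM ?posrE ?expR_gt0//.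
    by rewrite ler_ln ?posrE// mulr_gt0 ?expR_gt0.
  exact: gen (kpos y) (spos y) (kb y).
have bl : bounded_mfun (fun y => ln (kavg rho f A (fun x => expR (- h x)) y)).
  by apply: bm_ln_kavg => //; exists c.
apply: EI_le; last by move=> y; have /andP[] := lnb y.
  split.
    apply: measurableT_comp => //; apply: measurable_kavg => // x; apply: S0 => k; exact: expR_ge0.
  have [_ [B' bB']] := bl; exists (B' + de) => y.
  have := bB' y; rewrite !ler_norml => /andP[l1 u1]; have /andP[l2 u2] := lnb y.
  by apply/andP; split; lra.
by apply: bmfunD => //; exact: bmfun_cst.
Qed.

Lemma free_energy_ge_on :
  p * ln (\int[nu]_y kavg rho f A (fun x => expR (- (h x / p))) y) <=
  \int[nu]_y ln (kavg rho f A (fun x => expR (- h x)) y).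
Proof. by apply/ler_addgt0Pr => e e0; exact: free_energy_ge_approx. Qed.

End OnSet.

(** The bound on each [A n] passes to the limit by bounded convergence: the scale [r] on
    which ratios are controlled may shrink with [n], but the constant does not see it. *)
Theorem kernel_free_energy_ge (A : nat -> set X) : (forall n, measurable (A n)) ->
  (forall m n, (m <= n)%N -> A m `<=` A n) -> rho (\bigcup_n A n) = 1%E ->
  (forall n, ratio_controlled f S kappa (A n)) ->
  p * ln (\int[nu]_y kavg rho f setT (fun x => expR (- (h x / p))) y) <=
  \int[nu]_y ln (kavg rho f setT (fun x => expR (- h x)) y).
Proof.
move=> mA ndA A1 rA.
have [_ [B hB]] := bh.
have B0 : 0 <= B.
  have [x _] : exists x : X, True.
    apply: contrapT => nX; have : rho setT = 0%E.
      rewrite (_ : setT = set0) ?measure0// -subset0 => x _; apply: nX; by exists x.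
    by rewrite probability_setT => /eqP; rewrite onee_eq0.
  exact: le_trans (hB x).
have [n0 An0] : exists n0, rho (A n0) != 0%E.
  apply: contrapT => /forallNP H.
  have Z n : rho (A n) = 0%E by have /negP := H n; rewrite negbK => /eqP.
  have ndA' : nondecreasing_seq A by move=> m n mn; apply/subsetPset; exact: ndA.
  have mU : measurable (\bigcup_n A n) by exact: bigcupT_measurable.
  have := nondecreasing_cvg_mu (mu := rho) mA mU ndA'.
  rewrite (_ : _ \o _ = fun=> 0%E); last by apply/funext => n /=; exact: Z.
  move=> /(cvg_lim (@ereal_hausdorff R)); rewrite lim_cst//.
  move=> E; have : (1 : \bar R)%E = 0%E by rewrite -A1; exact/esym/E.
  by move/eqP; rewrite onee_eq0.
(* an average over [A n] is meaningful once [A n] has positive measure *)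
pose A' n := A (n0 + n)%N.
have mA' n : measurable (A' n) by exact: mA.
have A'0 n : rho (A' n) != 0%E.
  apply/eqP => Z; move/eqP: An0; apply; apply/eqP; rewrite -measure_le0 -Z.
  by apply: le_measure; rewrite ?inE//; apply: ndA; rewrite leq_addr.
have ndA' m n : (m <= n)%N -> A' m `<=` A' n by move=> mn; apply: ndA; rewrite leq_add2l.
have A'1 : rho (\bigcup_n A' n) = 1%E.
  rewrite -A1; congr (rho _); rewrite eqEsubset; split => x [n _ An].
    by exists (n0 + n)%N.
  by exists n => //; apply: ndA An; rewrite leq_addl.
have T0 : rho setT != 0%E by rewrite probability_setT onee_eq0.
have kcvg (G : X -> R) y : bounded_mfun G -> kavg rho f (A' n) G y @[n --> \oo] --> kavg rho f setT G y.
  move=> bG; have E (F : X -> R) : kint rho f (fun x => \1_setT x * F x) y = kint rho f F y.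
    by congr kint; apply/funext => x; rewrite indicT mul1r.
  rewrite /kavg E; apply: cvgM; first exact: kint_cvg.
  have E1 n : kint rho f (\1_(A' n)) y = kint rho f (fun x => \1_(A' n) x * 1) y.
    by congr kint; apply/funext => x; rewrite mulr1.
  under eq_fun do rewrite E1.
  have := E (fun=> 1); under eq_fun do rewrite mulr1; move=> ET.
  apply: cvgV; last by rewrite ET; apply: kint_cvg => //; exact: bmfun_cst.
  by rewrite gt_eqF//; exact: kint_gt0.
have bE := bmfun_expRN bh; have bEp := bmfun_expRN bhp.
have bound (g : X -> R) C : (forall x, `|g x| <= C) -> forall x, expR (- C) <= expR (- g x) <= expR C.
  move=> gC x; have := gC x; rewrite ler_norml !ler_expR => /andP[l u].
  by apply/andP; split; lra.
have [_ [Bp hBp]] := bhp.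
have posT : 0 < \int[nu]_y kavg rho f setT (fun x => expR (- (h x / p))) y.
  apply: EI_gt0 => [|y].
    split; first by apply: measurable_kavg => // x; exact: expR_ge0.
    exists (expR Bp) => y; have /andP[l u] := kavg_bounds f0 fi measurableT T0 y bEp (bound _ _ hBp).
    by rewrite ger0_norm// (le_trans _ l)// expR_ge0.
  have /andP[l _] := kavg_bounds f0 fi measurableT T0 y bEp (bound _ _ hBp).
  by apply: lt_le_trans l; exact: expR_gt0.
have c1 : \int[nu]_y kavg rho f (A' n) (fun x => expR (- (h x / p))) y @[n --> \oo] -->
    \int[nu]_y kavg rho f setT (fun x => expR (- (h x / p))) y.
  apply: (@EI_cvg _ _ _ nu _ _ (expR Bp)).
  - by move=> n; apply: measurable_kavg => // x; exact: expR_ge0.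
  - by apply: measurable_kavg => // x; exact: expR_ge0.
  - move=> n y; have /andP[l u] := kavg_bounds f0 fi (mA' n) (A'0 n) y bEp (bound _ _ hBp).
    by rewrite ger0_norm// (le_trans _ l)// expR_ge0.
  - by move=> y; exact: kcvg.
set I1 := fun n => \int[nu]_y kavg rho f (A' n) (fun x => expR (- (h x / p))) y in c1.
set J1 := \int[nu]_y kavg rho f setT _ y in c1 posT *.
have c3 : p * ln (I1 n) @[n --> \oo] --> p * ln J1.
  move: posT c1; clearbody I1 J1 => posT c1; apply: cvgM; first exact: cvg_cst.
  exact: (cvg_comp _ _ c1 (continuous_ln posT)).
have kb D (mD : measurable D) (D0 : rho D != 0%E) y := kavg_bounds f0 fi mD D0 y bE (bound _ _ hB).
have c4 : \int[nu]_y ln (kavg rho f (A' n) (fun x => expR (- h x)) y) @[n --> \oo] -->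
    \int[nu]_y ln (kavg rho f setT (fun x => expR (- h x)) y).
  apply: (@EI_cvg _ _ _ nu _ _ B).
  - by move=> n; apply: measurableT_comp => //; apply: measurable_kavg => // x; exact: expR_ge0.
  - by apply: measurableT_comp => //; apply: measurable_kavg => // x; exact: expR_ge0.
  - move=> n y; have /andP[l u] := kb _ (mA' n) (A'0 n) y.
    have k0 : 0 < kavg rho f (A' n) (fun x => expR (- h x)) y by apply: lt_le_trans l; exact: expR_gt0.
    by rewrite ler_norml -(ler_expR (- B)) -(ler_expR _ B) lnK ?posrE// l.
  move=> y; have /andP[l _] := kb _ measurableT T0 y.
  have k0 : 0 < kavg rho f setT (fun x => expR (- h x)) y by apply: lt_le_trans l; exact: expR_gt0.
  exact: (cvg_comp _ _ (kcvg _ y bE) (continuous_ln k0)).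
by apply: (ler_cvg_to c3 c4); apply: nearW => n; exact: (free_energy_ge_on (mA' n) (A'0 n) (rA (n0 + n)%N)).
Qed.

End KernelFreeEnergy.

(** * Functions with normalized exponential *)

Section ExpIntegrable.
Context d (T : measurableType d) (R : realType) (P : probability T R).
Implicit Types t : T -> R.

(** Such a function has nonnegative mean as soon as it is integrable, by
    [1 + x <= e^x]. *)
Definition exp_normalized t := measurable_fun setT t /\ (\int[P]_x (expR (- t x))%:E = 1)%E.

Lemma exp_normalized_integrable t : exp_normalized t ->
  P.-integrable setT (fun x => (expR (- t x))%:E).
Proof.
move=> [mt t1]; apply/integrableP; split.
  by apply/measurable_EFinP; apply: measurableT_comp => //; exact: measurableT_comp.
under eq_integral do rewrite gee0_abs ?lee_fin ?expR_ge0//.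
by rewrite t1 ltry.
Qed.

(** The negative part is dominated by the integrable function [e^(- t)], so only the
    positive part has to be controlled. *)
Lemma exp_normalized_int t : exp_normalized t -> (\int[P]_x (t x)%:E < +oo)%E ->
  P.-integrable setT (fun x => (t x)%:E).
Proof.
move=> nt; have [mt _] := nt; have ie := exp_normalized_integrable nt => tlt.
have mte : measurable_fun setT (fun x => (t x)%:E) by exact/measurable_EFinP.
have In : (\int[P]_x ((fun x => (t x)%:E)^\- x) < +oo)%E.
  apply: le_lt_trans (integrable_lty measurableT ie).
  apply: ge0_le_integral => //.
  - exact: measurable_funeneg.
  - exact: measurable_int ie.
  move=> x _; rewrite funenegE ge_max -EFinN !lee_fin expR_ge0 andbT.
  by have := expR_ge1Dx (- t x); lra.
have I0 : (0 <= \int[P]_x ((fun x => (t x)%:E)^\- x))%E by exact: integral_ge0.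
have Ip : (\int[P]_x ((fun x => (t x)%:E)^\+ x) < +oo)%E.
  rewrite ltey; apply/eqP => Ip; move: tlt; rewrite integralE Ip.
  by move: In I0; case: (integral _ _ _) => [x| |].
apply/integrableP; split => //.
rewrite (_ : (fun x => _) = ((fun x => (t x)%:E)^\+ \+ (fun x => (t x)%:E)^\-)%E); last first.
  by rewrite -fune_abse.
rewrite ge0_integralD//; [exact: lte_add_pinfty|exact: measurable_funepos|exact: measurable_funeneg].
Qed.

Lemma exp_normalized_ge0 t : exp_normalized t -> P.-integrable setT (fun x => (t x)%:E) ->
  0 <= \int[P]_x t x.
Proof.
move=> nt it; have ie := exp_normalized_integrable nt.
have i1 : P.-integrable setT (EFin \o (fun=> 1 : R)) := bmfun_int P (bmfun_cst _ 1).
have : \int[P]_x (1 - expR (- t x)) <= \int[P]_x t x.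
  apply: le_Rintegral => //; first exact: (integrableB measurableT i1 ie).
  by move=> x _; have := expR_ge1Dx (- t x); lra.
apply: le_trans; rewrite RintegralB// EI_cst /Rintegral nt.2 /= subrr//.
Qed.

(** The function [x + e^(- x) - 1] is nonnegative. Summed over the three parts it is
    integrable, so each part is. *)
Lemma exp_normalized_split t a b c : exp_normalized a -> exp_normalized b -> exp_normalized c ->
  (forall x, t x = a x + b x + c x) -> P.-integrable setT (fun x => (t x)%:E) ->
  P.-integrable setT (fun x => (a x)%:E).
Proof.
move=> na nb nc tE it.
have ia := exp_normalized_integrable na; have ib := exp_normalized_integrable nb.
have ic := exp_normalized_integrable nc.
have i1 : P.-integrable setT (EFin \o (fun=> 1 : R)) := bmfun_int P (bmfun_cst _ 1).
have i3 : P.-integrable setT (EFin \o (fun=> 3 : R)) := bmfun_int P (bmfun_cst _ 3).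
pose ent (s : T -> R) x := s x + expR (- s x) - 1.
have ent0 s x : 0 <= ent s x by rewrite /ent; have := expR_ge1Dx (- s x); lra.
have iT : P.-integrable setT (fun x => (t x + (expR (- a x) + expR (- b x) + expR (- c x)))%:E).
  exact: (integrableD measurableT it (integrableD measurableT (integrableD measurableT ia ib) ic)).
have iE : P.-integrable setT (fun x => (ent a x)%:E).
  apply: (le_integrable measurableT _ _ iT).
    apply/measurable_EFinP; rewrite /ent; apply: measurable_funB; last exact: measurable_cst.
    apply: measurable_funD; first exact: na.1.
    by apply/measurable_EFinP; exact: measurable_int ia.
  move=> x _; rewrite !gee0_abs ?lee_fin//.
    by have := ent0 b x; have := ent0 c x; rewrite tE /ent; lra.
  by have := ent0 a x; have := ent0 b x; have := ent0 c x; rewrite tE /ent; lra.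
have := integrableD measurableT (integrableB measurableT iE ia) i1.
by apply: eq_integrable => // x _; rewrite /= -EFinB -EFinD /ent; congr EFin; lra.
Qed.

End ExpIntegrable.

(** * Sinkhorn updates and Gibbs densities *)

Section Step.
Context (R : realType) (X : ptopologicalType) (d : nat).
Variables (c : X -> 'rV[R]_d -> R) (eps : R).
Variables (rho : probability (borel X) R) (nu : probability (borel 'rV[R]_d) R).
Hypothesis mc : measurable_fun (setT : set (borel X * borel 'rV[R]_d)%type)
          (fun z : borel X * borel 'rV[R]_d => c z.1 z.2).
Hypothesis eps0 : 0 < eps.
Notation Yd := (borel 'rV[R]_d).
Implicit Types (phi : borel X -> R) (psi : Yd -> R).

Let mfst (F : borel X -> R) : measurable_fun setT F -> measurable_fun setT (fun z : borel X * Yd => F z.1).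
Proof. by move=> mF; exact: (measurableT_comp mF measurable_fst). Qed.

Let msnd (F : Yd -> R) : measurable_fun setT F -> measurable_fun setT (fun z : borel X * Yd => F z.2).
Proof. by move=> mF; exact: (measurableT_comp mF measurable_snd). Qed.

Lemma measurable_half_gibbs_x phi : measurable_fun setT phi ->
  measurable_fun setT (fun z : borel X * Yd => half_gibbs_x c eps phi z.1 z.2).
Proof.
move=> mphi; apply: measurableT_comp => //; apply: measurableT_comp => //; apply: measurable_funM.
  by apply: measurable_funD => //; exact: mfst.
exact: measurable_cst.
Qed.

Lemma measurable_half_gibbs_y psi : measurable_fun setT psi ->
  measurable_fun setT (fun z : borel X * Yd => half_gibbs_y c eps psi z.1 z.2).
Proof.
move=> mpsi; apply: measurableT_comp => //; apply: measurableT_comp => //; apply: measurable_funM.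
  by apply: measurable_funD => //; exact: msnd.
exact: measurable_cst.
Qed.

Lemma measurable_gibbs phi psi : measurable_fun setT phi -> measurable_fun setT psi ->
  measurable_fun setT (fun z : borel X * Yd => gibbs c eps phi psi z.1 z.2).
Proof.
move=> mphi mpsi; apply: measurableT_comp => //; apply: measurableT_comp => //; apply: measurable_funM.
  apply: measurable_funD; last exact: msnd.
  by apply: measurable_funD => //; exact: mfst.
exact: measurable_cst.
Qed.

Lemma measurable_psi_update phi : measurable_fun setT phi ->
  measurable_fun (setT : set Yd) (psi_update c eps rho phi).
Proof.
move=> mphi; apply: measurable_funM; first exact: measurable_cst.
apply: measurableT_comp => //; apply: measurableT_comp => //.
have m := measurable_half_gibbs_x mphi.
apply: (@measurable_fun_fubini_tonelli_G _ _ (borel X) Yd R rho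
  (fun z => (half_gibbs_x c eps phi z.1 z.2)%:E)); first exact/measurable_EFinP.
by move=> z; rewrite lee_fin expR_ge0.
Qed.

Lemma measurable_phi_update psi : measurable_fun setT psi ->
  measurable_fun (setT : set (borel X)) (phi_update c eps nu psi).
Proof.
move=> mpsi; apply: measurable_funM; first exact: measurable_cst.
apply: measurableT_comp => //; apply: measurableT_comp => //.
have m := measurable_half_gibbs_y mpsi.
apply: (@measurable_fun_fubini_tonelli_F _ _ (borel X) Yd R nu
  (fun z => (half_gibbs_y c eps psi z.1 z.2)%:E)); first exact/measurable_EFinP.
by move=> z; rewrite lee_fin expR_ge0.
Qed.

End Step.

Section GibbsRatio.
Context (R : realType) (X : ptopologicalType) (d : nat).
Variables (c : X -> 'rV[R]_d -> R) (eps : R).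
Variables (rho : probability (borel X) R) (nu : probability (borel 'rV[R]_d) R).
Hypothesis mc : measurable_fun (setT : set (borel X * borel 'rV[R]_d)%type)
          (fun z : borel X * borel 'rV[R]_d => c z.1 z.2).
Hypothesis eps0 : 0 < eps.
Notation Yd := (borel 'rV[R]_d).
Variables (phi : borel X -> R) (psi : Yd -> R) (pi : probability (borel X * Yd)%type R).
Hypotheses (mphi : measurable_fun setT phi) (mpsi : measurable_fun setT psi).
Hypotheses (dpi : has_gibbs_density c eps rho nu phi psi pi).

(** The logarithm of the density of the optimal plan with respect to the Gibbs plan of
    potentials [ph] and [ps]. *)
Definition log_ratio (ph : borel X -> R) (ps : Yd -> R) (z : borel X * Yd) : R :=
  (ph z.1 - phi z.1 + (ps z.2 - psi z.2)) / eps.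

Variables (ph : borel X -> R) (ps : Yd -> R) (pn : probability (borel X * Yd)%type R).
Hypotheses (mph : measurable_fun setT ph) (mps : measurable_fun setT ps).
Hypothesis (dpn : has_gibbs_density c eps rho nu ph ps pn).

Let mg := measurable_gibbs eps mc mphi mpsi.
Let mgn := measurable_gibbs eps mc mph mps.

Lemma measurable_log_ratio : measurable_fun setT (log_ratio ph ps).
Proof.
apply: measurable_funM; last exact: measurable_cst.
apply: measurable_funD; apply: measurable_funB.
- exact: (measurableT_comp mph measurable_fst).
- exact: (measurableT_comp mphi measurable_fst).
- exact: (measurableT_comp mps measurable_snd).
- exact: (measurableT_comp mpsi measurable_snd).
Qed.

Lemma gibbs_log_ratio z :
  expR (log_ratio ph ps z) * gibbs c eps ph ps z.1 z.2 = gibbs c eps phi psi z.1 z.2.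
Proof.
rewrite /gibbs -expRD; congr expR; rewrite /log_ratio; field.
by rewrite gt_eqF.
Qed.

Let gibbs_dens (p : probability (borel X * Yd)%type R) a b : has_gibbs_density c eps rho nu a b p ->
  has_density p (prod_proba rho nu) (fun z => gibbs c eps a b z.1 z.2).
Proof. by []. Qed.

Lemma gibbs_has_density : has_density pi pn (fun z => expR (log_ratio ph ps z)).
Proof.
move=> B mB; rewrite [RHS]integral_mkcond.
have mE : measurable_fun setT (((fun z => (expR (log_ratio ph ps z))%:E) \_ B)).
  apply/(measurable_restrictT _ mB); apply: measurable_funTS; apply/measurable_EFinP.
  by apply: measurableT_comp => //; exact: measurable_log_ratio.
rewrite (ge0_integral_density mgn (gibbs_dens dpn) mE); last first.
  by move=> z; rewrite patchE; case: ifP => // _; rewrite lee_fin expR_ge0.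
rewrite dpi// [LHS]integral_mkcond; apply: eq_integral => z _; rewrite !patchE.
by case: ifP; rewrite ?mul0e// -EFinM gibbs_log_ratio.
Qed.

Lemma rel_entropy_gibbs : rel_entropy pi pn = (\int[pi]_z (log_ratio ph ps z)%:E)%E.
Proof.
have mE : measurable_fun setT (fun z => expR (log_ratio ph ps z)).
  by apply: measurableT_comp => //; exact: measurable_log_ratio.
rewrite (density_rel_entropy mE gibbs_has_density); last by move=> z; exact: expR_gt0.
by apply: eq_integral => z _; rewrite expRK.
Qed.

Lemma log_ratio_normalized : exp_normalized pi (log_ratio ph ps).
Proof.
split; first exact: measurable_log_ratio.
have mE : measurable_fun setT (fun z => (expR (- log_ratio ph ps z))%:E).
  apply/measurable_EFinP; apply: measurableT_comp => //; apply: measurableT_comp => //.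
  exact: measurable_log_ratio.
rewrite (ge0_integral_density mg (gibbs_dens dpi) mE); last by move=> z; rewrite lee_fin expR_ge0.
rewrite -(@probability_setT _ _ _ pn) dpn//; apply: eq_integral => z _.
by rewrite -EFinM -gibbs_log_ratio mulrA -expRD addNr expR0 mul1r.
Qed.

End GibbsRatio.

Section OneStep.
Context (R : realType) (X : ptopologicalType) (d : nat).
Variables (c : X -> 'rV[R]_d -> R) (eps : R).
Variables (rho : probability (borel X) R) (nu : probability (borel 'rV[R]_d) R).
Hypothesis mc : measurable_fun (setT : set (borel X * borel 'rV[R]_d)%type)
          (fun z : borel X * borel 'rV[R]_d => c z.1 z.2).
Hypothesis eps0 : 0 < eps.
Notation Yd := (borel 'rV[R]_d).
Variables (ph : borel X -> R).
Hypothesis mph : measurable_fun setT ph.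
Hypothesis fi : forall y, rho.-integrable setT (fun x => (half_gibbs_x c eps ph x y)%:E).
Let ps : Yd -> R := psi_update c eps rho ph.
Hypothesis hi : forall x, nu.-integrable setT (fun y => (half_gibbs_y c eps ps x y)%:E).
Let ph1 : borel X -> R := phi_update c eps nu ps.

Let mps : measurable_fun setT ps. Proof. exact: measurable_psi_update. Qed.
Let mph1 : measurable_fun setT ph1. Proof. exact: measurable_phi_update. Qed.

Lemma expR_psi_update y : expR (ps y / eps) = \int[rho]_x half_gibbs_x c eps ph x y.
Proof.
rewrite /ps /psi_update mulrAC mulfV ?gt_eqF// mul1r lnK// posrE.
by apply: Rintegral_gt0 => // x; exact: expR_gt0.
Qed.

Lemma expR_phi_update x : expR (ph1 x / eps) = \int[nu]_y half_gibbs_y c eps ps x y.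
Proof.
rewrite /ph1 /phi_update mulrAC mulfV ?gt_eqF// mul1r lnK// posrE.
by apply: Rintegral_gt0 => // y; exact: expR_gt0.
Qed.

Lemma gibbsE_y (a : borel X -> R) (b : Yd -> R) x y :
  gibbs c eps a b x y = expR (- (a x / eps)) * half_gibbs_y c eps b x y.
Proof. by rewrite /gibbs /half_gibbs_y -expRD; congr expR; field; rewrite gt_eqF. Qed.

Lemma gibbsE_x (a : borel X -> R) (b : Yd -> R) x y :
  gibbs c eps a b x y = expR (- (b y / eps)) * half_gibbs_x c eps a x y.
Proof. by rewrite /gibbs /half_gibbs_x -expRD; congr expR; field; rewrite gt_eqF. Qed.

Definition phi_drop (x : borel X) : R := (ph x - ph1 x) / eps.

Lemma int_gibbs_y (a : borel X -> R) x :
  (\int[nu]_y (gibbs c eps a ps x y)%:E = (expR ((ph1 x - a x) / eps))%:E)%E.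
Proof.
under eq_integral do rewrite gibbsE_y EFinM.
rewrite integralZl// -[X in (_ * X)%E]fineK; last exact: integrable_fin_num (hi x).
by rewrite -[fine _]/(\int[nu]_y half_gibbs_y c eps ps x y) -expR_phi_update -EFinM -expRD mulrBl addrC.
Qed.

Lemma int_gibbs_x (b : Yd -> R) y :
  (\int[rho]_x (gibbs c eps ph b x y)%:E = (expR ((ps y - b y) / eps))%:E)%E.
Proof.
under eq_integral do rewrite gibbsE_x EFinM.
rewrite integralZl// -[X in (_ * X)%E]fineK; last exact: integrable_fin_num (fi y).
by rewrite -[fine _]/(\int[rho]_x half_gibbs_x c eps ph x y) -expR_psi_update -EFinM -expRD mulrBl addrC.
Qed.

Let mgE (a : borel X -> R) (b : Yd -> R) : measurable_fun setT a -> measurable_fun setT b ->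
  measurable_fun setT (fun z : borel X * Yd => (gibbs c eps a b z.1 z.2)%:E).
Proof. by move=> ma mb; apply/measurable_EFinP; exact: measurable_gibbs. Qed.

Lemma tonelli_gibbs_xy (a : borel X -> R) (b : Yd -> R) : measurable_fun setT a -> measurable_fun setT b ->
  (\int[prod_proba rho nu]_z (gibbs c eps a b z.1 z.2)%:E =
   \int[rho]_x \int[nu]_y (gibbs c eps a b x y)%:E)%E.
Proof.
move=> ma mb; rewrite (@fubini_tonelli1 _ _ _ _ _ rho nu (fun z => (gibbs c eps a b z.1 z.2)%:E))//.
  exact: mgE.
by move=> z; rewrite lee_fin expR_ge0.
Qed.

Lemma tonelli_gibbs_yx (a : borel X -> R) (b : Yd -> R) : measurable_fun setT a -> measurable_fun setT b ->
  (\int[prod_proba rho nu]_z (gibbs c eps a b z.1 z.2)%:E =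
   \int[nu]_y \int[rho]_x (gibbs c eps a b x y)%:E)%E.
Proof.
move=> ma mb; rewrite (@fubini_tonelli2 _ _ _ _ _ rho nu (fun z => (gibbs c eps a b z.1 z.2)%:E))//.
  exact: mgE.
by move=> z; rewrite lee_fin expR_ge0.
Qed.

(** The function [e^(- phi_drop)] is the density of the first marginal of the Gibbs plan
    with potentials [ph] and [ps], whose second marginal is [nu]. *)
Lemma phi_drop_normalized : exp_normalized rho phi_drop.
Proof.
split; first by apply: measurable_funM; [exact: measurable_funB|exact: measurable_cst].
transitivity (\int[rho]_x \int[nu]_y (gibbs c eps ph ps x y)%:E)%E.
  apply: eq_integral => x _; rewrite int_gibbs_y; congr (expR _)%:E.
  by rewrite /phi_drop -mulNr opprB.
rewrite -tonelli_gibbs_xy// tonelli_gibbs_yx//.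
under eq_integral do rewrite int_gibbs_x subrr mul0r expR0.
by rewrite integral_cst//= probability_setT mule1.
Qed.

Hypothesis fi1 : forall y, rho.-integrable setT (fun x => (half_gibbs_x c eps ph1 x y)%:E).
Let ps1 : Yd -> R := psi_update c eps rho ph1.

Lemma int_gibbs_x1 (b : Yd -> R) y :
  (\int[rho]_x (gibbs c eps ph1 b x y)%:E = (expR ((ps1 y - b y) / eps))%:E)%E.
Proof.
under eq_integral do rewrite gibbsE_x EFinM.
rewrite integralZl// -[X in (_ * X)%E]fineK; last exact: integrable_fin_num (fi1 y).
rewrite -[fine _]/(\int[rho]_x half_gibbs_x c eps ph1 x y).
have -> : \int[rho]_x half_gibbs_x c eps ph1 x y = expR (ps1 y / eps).
  rewrite /ps1 /psi_update mulrAC mulfV ?gt_eqF// mul1r lnK// posrE.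
  by apply: Rintegral_gt0 => // x; exact: expR_gt0.
by rewrite -EFinM -expRD mulrBl addrC.
Qed.

Definition psi_drop (y : Yd) : R := (ps y - ps1 y) / eps.

(** The same with the roles of the marginals exchanged: after the update of the first
    potential the first marginal is [rho]. *)
Lemma psi_drop_normalized : exp_normalized nu psi_drop.
Proof.
have mps1 : measurable_fun setT ps1 by exact: measurable_psi_update.
split; first by apply: measurable_funM; [exact: (measurable_funB mps mps1)|exact: measurable_cst].
transitivity (\int[nu]_y \int[rho]_x (gibbs c eps ph1 ps x y)%:E)%E.
  apply: eq_integral => y _; rewrite int_gibbs_x1; congr (expR _)%:E.
  by rewrite /psi_drop -mulNr opprB.
rewrite -(tonelli_gibbs_yx mph1 mps) (tonelli_gibbs_xy mph1 mps).
under eq_integral do rewrite int_gibbs_y subrr mul0r expR0.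
by rewrite integral_cst//= probability_setT mule1.
Qed.

End OneStep.

(** * Two-sided truncation *)

Section Truncation.
Context (R : realType).
Implicit Types (k r w h : R).

Definition clamp k r : R := Num.max (- k) (Num.min r k).

(** The logarithm of an upper bound for the truncated Laplace transform: [e^w] comes from
    the untruncated part, [e^(- k)] from the points where [h] is cut at [k], and [k]
    bounds the whole. *)
Definition soft_clamp k w : R := Num.min k (ln (expR w + expR (- k))).

Lemma clampP k r : 0 <= k ->
  [\/ r <= - k /\ clamp k r = - k, - k <= r <= k /\ clamp k r = r | k <= r /\ clamp k r = k].
Proof.
move=> k0; rewrite /clamp /Num.min /Num.max; case: (ltP r k) => rk.
  case: (ltP (- k) r) => rk'; first by constructor 2; rewrite (ltW rk') (ltW rk).
  by constructor 1.
by constructor 3; split => //; case: (ltP (- k) k) => // kk; lra.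
Qed.

Lemma clamp_bound k r : 0 <= k -> `|clamp k r| <= k.
Proof.
move=> k0; case: (clampP r k0) => -[+ ->] => [H|/andP[? ?]|H];
  by rewrite ler_norml; apply/andP; split; lra.
Qed.

(** The clamp is odd and 1-Lipschitz, and [h + w] is the distance of [h] to [- w]. *)
Lemma clamp_dist k h w : 0 <= k -> `|clamp k h + clamp k w| <= `|h + w|.
Proof.
move=> k0; have := ler_norm (h + w); have := ler_norm (- (h + w)); rewrite normrN.
by move: (clampP h k0) (clampP w k0) => [] [? ->] [] [? ->] ? ?; rewrite ler_norml; apply/andP; split; lra.
Qed.

Lemma soft_clamp_bounds k w : 0 <= k -> clamp k w <= soft_clamp k w <= clamp k w + ln 2.
Proof.
move=> k0; rewrite /soft_clamp le_min ge_min.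
have l2 : 0 < ln 2 :> R by rewrite ln_gt0// ltr1n.
have ln2 r : ln (expR r + expR r) = r + ln 2.
  by rewrite (_ : expR r + expR r = expR r * 2); [rewrite lnM ?posrE ?expR_gt0// expRK|ring].
have P : 0 < expR w + expR (- k) by rewrite addr_gt0 ?expR_gt0.
have up r : w <= r -> - k <= r -> ln (expR w + expR (- k)) <= r + ln 2.
  by move=> wr kr; rewrite -ln2 ler_ln ?posrE// ?addr_gt0 ?expR_gt0// lerD// ler_expR.
have lo r : r <= w \/ r <= - k -> r <= ln (expR w + expR (- k)).
  move=> H; rewrite -[leLHS]expRK ler_ln ?posrE ?expR_gt0//.
  by case: H => H; [rewrite -[leLHS]addr0|rewrite -[leLHS]add0r]; rewrite lerD ?expR_ge0 ?ler_expR.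
case: (clampP w k0) => -[H ->].
- by apply/andP; split; [apply/andP; split; [lra|apply: lo; right]|apply/orP; right; apply: up].
- case/andP: H => H1 H2; apply/andP; split; [apply/andP; split => //; apply: lo; left => //|].
  by apply/orP; right; apply: up.
- by rewrite lexx lo ?lerDl ?(ltW l2)//; left.
Qed.

Lemma soft_clamp_le k w : soft_clamp k w <= w + expR (- w) * expR (- k).
Proof.
rewrite /soft_clamp ge_min; apply/orP; right.
have -> : expR w + expR (- k) = expR w * (1 + expR (- w) * expR (- k)).
  by rewrite mulrDr mulr1 mulrA -expRD subrr expR0 mul1r.
have H : 0 <= expR (- w) * expR (- k) by rewrite mulr_ge0 ?expR_ge0.
rewrite lnM ?posrE ?expR_gt0 ?ltr_wpDr// expRK lerD2l.
by apply: le_ln1Dx; rewrite (lt_le_trans _ H)// ltrN10.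
Qed.

Lemma truncation_cvg h w : clamp n%:R h + soft_clamp n%:R w @[n --> \oo] --> h + w.
Proof.
apply: (@squeeze_cvgr _ _ _ _ (fun=> h + w) (fun n => h + w + expR (- w) * (harmonic n))).
- near=> n; have n0 : (0 : R) <= n%:R by rewrite ler0n.
  have hn : `|h| <= n%:R by near: n; exact: nbhs_infty_ger.
  have wn : `|w| <= n%:R by near: n; exact: nbhs_infty_ger.
  have hE : clamp n%:R h = h.
    by move: hn; rewrite ler_norml => /andP[? ?]; case: (clampP h n0) => -[? ->]; lra.
  have wE : clamp n%:R w = w.
    by move: wn; rewrite ler_norml => /andP[? ?]; case: (clampP w n0) => -[? ->]; lra.
  have /andP[lo _] := soft_clamp_bounds w n0; have up := soft_clamp_le n%:R w.
  rewrite hE; rewrite wE in lo; rewrite lerD2l lo /= -addrA lerD2l (le_trans up)// lerD2l.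
  rewrite ler_wpM2l ?expR_ge0// expRN /harmonic /= lef_pV2 ?posrE ?expR_gt0//.
  by rewrite -natr1 addrC expR_ge1Dx.
- exact: cvg_cst.
- rewrite -[X in _ --> X]addr0; apply: cvgD; first exact: cvg_cst.
  rewrite -(mulr0 (expR (- w))); apply: cvgM; first exact: cvg_cst.
  exact: cvg_harmonic.
Unshelve. all: by end_near. Qed.

End Truncation.

(** * Entropy decrement in one iteration *)

Section CouplingIntegral.
Context d1 d2 (T1 : measurableType d1) (T2 : measurableType d2) (R : realType).
Variables (p : probability T1 R) (q : probability T2 R) (pi : probability (T1 * T2)%type R).
Hypothesis cpl : coupling p q pi.

Lemma coupling_fst (f : T1 -> \bar R) : measurable_fun setT f ->
  (\int[pi]_z f z.1 = \int[p]_x f x)%E.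
Proof.
move=> mf; rewrite integralE [RHS]integralE.
congr (_ - _)%E.
  rewrite -(ge0_integral_coupling1 cpl (measurable_funepos mf) (funepos_ge0 f)).
  by apply: eq_integral => z _; rewrite !funeposE.
rewrite -(ge0_integral_coupling1 cpl (measurable_funeneg mf) (funeneg_ge0 f)).
by apply: eq_integral => z _; rewrite !funenegE.
Qed.

Lemma coupling_snd (f : T2 -> \bar R) : measurable_fun setT f ->
  (\int[pi]_z f z.2 = \int[q]_x f x)%E.
Proof.
move=> mf; rewrite integralE [RHS]integralE.
congr (_ - _)%E.
  rewrite -(ge0_integral_coupling2 cpl (measurable_funepos mf) (funepos_ge0 f)).
  by apply: eq_integral => z _; rewrite !funeposE.
rewrite -(ge0_integral_coupling2 cpl (measurable_funeneg mf) (funeneg_ge0 f)).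
by apply: eq_integral => z _; rewrite !funenegE.
Qed.

Lemma integrable_fst (t : T1 -> R) : measurable_fun setT t ->
  pi.-integrable setT (fun z => (t z.1)%:E) <-> p.-integrable setT (fun x => (t x)%:E).
Proof.
move=> mt; have mte : measurable_fun setT (fun x => (t x)%:E) by exact/measurable_EFinP.
have E : (\int[pi]_z `|(t z.1)%:E| = \int[p]_x `|(t x)%:E|)%E.
  by apply: (coupling_fst (f := fun x => `|(t x)%:E|%E)); exact: measurableT_comp.
split=> /integrableP[m i]; apply/integrableP; split => //; first by rewrite -E.
  by apply: (measurableT_comp mte measurable_fst).
by rewrite E.
Qed.

Lemma integrable_snd (t : T2 -> R) : measurable_fun setT t ->
  pi.-integrable setT (fun z => (t z.2)%:E) <-> q.-integrable setT (fun x => (t x)%:E).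
Proof.
move=> mt; have mte : measurable_fun setT (fun x => (t x)%:E) by exact/measurable_EFinP.
have E : (\int[pi]_z `|(t z.2)%:E| = \int[q]_x `|(t x)%:E|)%E.
  by apply: (coupling_snd (f := fun x => `|(t x)%:E|%E)); exact: measurableT_comp.
split=> /integrableP[m i]; apply/integrableP; split => //; first by rewrite -E.
  by apply: (measurableT_comp mte measurable_snd).
by rewrite E.
Qed.

Lemma exp_normalized_fst t : exp_normalized p t -> exp_normalized pi (fun z => t z.1).
Proof.
move=> [mt t1]; split; first exact: (measurableT_comp mt measurable_fst).
rewrite -t1; apply: (coupling_fst (f := fun x => (expR (- t x))%:E)).
by apply/measurable_EFinP; apply: measurableT_comp => //; exact: measurableT_comp.
Qed.

Lemma exp_normalized_snd t : exp_normalized q t -> exp_normalized pi (fun z => t z.2).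
Proof.
move=> [mt t1]; split; first exact: (measurableT_comp mt measurable_snd).
rewrite -t1; apply: (coupling_snd (f := fun x => (expR (- t x))%:E)).
by apply/measurable_EFinP; apply: measurableT_comp => //; exact: measurableT_comp.
Qed.

End CouplingIntegral.

Section Decrement.
Context (R : realType) (X : ptopologicalType) (d : nat).
Variables (c : X -> 'rV[R]_d -> R) (eps : R).
Variables (rho : probability (borel X) R) (nu : probability (borel 'rV[R]_d) R).
Hypothesis mc : measurable_fun (setT : set (borel X * borel 'rV[R]_d)%type)
          (fun z : borel X * borel 'rV[R]_d => c z.1 z.2).
Hypothesis eps0 : 0 < eps.
Notation Yd := (borel 'rV[R]_d).
Variables (phi : borel X -> R) (psi : Yd -> R) (pi : probability (borel X * Yd)%type R).
Hypotheses (mphi : measurable_fun setT phi) (mpsi : measurable_fun setT psi).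
Hypotheses (dpi : has_gibbs_density c eps rho nu phi psi pi) (cpl : coupling rho nu pi).
Variables (ph : borel X -> R).
Hypothesis mph : measurable_fun setT ph.
Hypothesis fi : forall y, rho.-integrable setT (fun x => (half_gibbs_x c eps ph x y)%:E).
Let ps : Yd -> R := psi_update c eps rho ph.
Hypothesis hi : forall x, nu.-integrable setT (fun y => (half_gibbs_y c eps ps x y)%:E).
Let ph1 : borel X -> R := phi_update c eps nu ps.
Hypothesis fi1 : forall y, rho.-integrable setT (fun x => (half_gibbs_x c eps ph1 x y)%:E).
Let ps1 : Yd -> R := psi_update c eps rho ph1.
Variables pn1 : probability (borel X * Yd)%type R.
Hypotheses (dpn1 : has_gibbs_density c eps rho nu ph1 ps1 pn1).

Let mps : measurable_fun setT ps. Proof. exact: measurable_psi_update. Qed.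
Let mph1 : measurable_fun setT ph1. Proof. exact: measurable_phi_update. Qed.
Let mps1 : measurable_fun setT ps1. Proof. exact: measurable_psi_update. Qed.

Let E := log_ratio eps phi psi ph ps.
Let E1 := log_ratio eps phi psi ph1 ps1.
Let u := phi_drop c eps rho nu ph.
Let v := psi_drop c eps rho nu ph.

Hypothesis iE : pi.-integrable setT (fun z => (E z)%:E).

Let stepE z : E z = E1 z + u z.1 + v z.2.
Proof. by rewrite /E /E1 /u /v /log_ratio /phi_drop /psi_drop -/ps -/ph1 -/ps1; field; rewrite gt_eqF. Qed.

Let nu' : exp_normalized rho u. Proof. exact: phi_drop_normalized. Qed.
Let nv' : exp_normalized nu v. Proof. exact: psi_drop_normalized. Qed.
Let nE1 : exp_normalized pi E1.
Proof. exact: (log_ratio_normalized mc eps0 mphi mpsi dpi mph1 mps1 dpn1). Qed.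

Lemma phi_drop_integrable : rho.-integrable setT (fun x => (u x)%:E).
Proof.
apply/(integrable_fst cpl nu'.1).
apply: (exp_normalized_split (exp_normalized_fst cpl nu') nE1 (exp_normalized_snd cpl nv') _ iE).
by move=> z; rewrite stepE (addrC (E1 z)).
Qed.

Lemma psi_drop_integrable : nu.-integrable setT (fun x => (v x)%:E).
Proof.
apply/(integrable_snd cpl nv'.1).
apply: (exp_normalized_split (exp_normalized_snd cpl nv') nE1 (exp_normalized_fst cpl nu') _ iE).
by move=> z; rewrite stepE addrC addrA.
Qed.

(** Finite entropy is inherited by the three summands of the log-ratio, each of which
    has normalized exponential. *)
Lemma log_ratio_integrable_step : pi.-integrable setT (fun z => (E1 z)%:E).
Proof.
apply: (exp_normalized_split nE1 (exp_normalized_fst cpl nu') (exp_normalized_snd cpl nv') _ iE).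
exact: stepE.
Qed.

(** The log-ratio loses the two drops, and the drop of the second potential has
    nonnegative mean. *)
Lemma entropy_decrement : \int[pi]_z E1 z <= \int[pi]_z E z - \int[rho]_x u x.
Proof.
have iu := phi_drop_integrable; have iv := psi_drop_integrable.
have iE1 := log_ratio_integrable_step.
have /(integrable_fst cpl nu'.1) iu' := iu; have /(integrable_snd cpl nv'.1) iv' := iv.
have v0 := exp_normalized_ge0 nv' iv.
have -> : \int[pi]_z E z = \int[pi]_z E1 z + \int[rho]_x u x + \int[nu]_y v y.
  have -> : \int[rho]_x u x = \int[pi]_z u z.1.
    congr fine; rewrite -(coupling_fst cpl (f := fun x => (u x)%:E))//.
    by apply/measurable_EFinP; exact: nu'.1.
  have -> : \int[nu]_x v x = \int[pi]_z v z.2.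
    congr fine; rewrite -(coupling_snd cpl (f := fun x => (v x)%:E))//.
    by apply/measurable_EFinP; exact: nv'.1.
  rewrite -RintegralD// -RintegralD//; last exact: (integrableD measurableT iE1 iu').
  by apply: eq_Rintegral => z _; exact: stepE.
have gen (a b c' : R) : 0 <= c' -> a <= a + b + c' - b by lra.
exact: gen v0.
Qed.

End Decrement.

(** * The entropy is controlled by the drop of the first potential *)

Section EntropyBound.
Context (R : realType) (X : ptopologicalType) (d : nat).
Variables (c : X -> 'rV[R]_d -> R) (eps : R).
Variables (rho : probability (borel X) R) (nu : probability (borel 'rV[R]_d) R).
Hypothesis mc : measurable_fun (setT : set (borel X * borel 'rV[R]_d)%type)
          (fun z : borel X * borel 'rV[R]_d => c z.1 z.2).
Hypothesis eps0 : 0 < eps.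
Notation Yd := (borel 'rV[R]_d).
Variables (phi : borel X -> R) (psi : Yd -> R) (pi : probability (borel X * Yd)%type R).
Hypotheses (mphi : measurable_fun setT phi) (mpsi : measurable_fun setT psi).
Hypotheses (dpi : has_gibbs_density c eps rho nu phi psi pi) (cpl : coupling rho nu pi).

(** The second marginal of the optimal plan is [nu], so the conditional mass of its
    density is 1 for almost every [y]. *)
Lemma gibbs_marginal_snd :
  ae_eq nu setT (fun y => \int[rho]_x (gibbs c eps phi psi x y)%:E)%E (fun=> 1%E).
Proof.
pose F (y : Yd) : \bar R := (\int[rho]_x (gibbs c eps phi psi x y)%:E)%E.
have mg : measurable_fun setT (fun z : borel X * Yd => (gibbs c eps phi psi z.1 z.2)%:E).
  by apply/measurable_EFinP; exact: measurable_gibbs.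
have mF : measurable_fun setT F.
  apply: (@measurable_fun_fubini_tonelli_G _ _ (borel X) Yd R rho
    (fun z => (gibbs c eps phi psi z.1 z.2)%:E)) => //.
  by move=> z; rewrite lee_fin expR_ge0.
have F0 y : (0 <= F y)%E by apply: integral_ge0 => x _; rewrite lee_fin expR_ge0.
have FB (B : set Yd) : measurable B -> (\int[nu]_(y in B) F y = nu B)%E.
  move=> mB; rewrite -(cpl.2 _ mB) dpi; last by rewrite -[X in measurable X]setTI; exact: measurable_snd.
  rewrite [RHS]integral_mkcond [LHS]integral_mkcond.
  have E : (fun z : borel X * Yd => (gibbs c eps phi psi z.1 z.2)%:E) \_ (snd @^-1` B) =
      (fun z => (\1_B z.2)%:E * (gibbs c eps phi psi z.1 z.2)%:E)%E.
    apply/funext => z; rewrite patchE indicE.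
    have -> : (z \in snd @^-1` B) = (z.2 \in B) by apply/idP/idP; rewrite !inE.
    by case: (_ \in _); rewrite ?mul1e ?mul0e.
  rewrite E (@fubini_tonelli2 _ _ _ _ _ rho nu (fun z => (\1_B z.2)%:E * (gibbs c eps phi psi z.1 z.2)%:E)%E).
  - apply: eq_integral => y _; rewrite patchE /fubini_G /= indicE.
    case: (_ \in _); first by under [RHS]eq_integral do rewrite mul1e.
    by under [RHS]eq_integral do rewrite mul0e; rewrite integral0.
  - apply: emeasurable_funM => //; apply/measurable_EFinP.
    exact: (measurableT_comp (measurable_indic mB) measurable_snd).
  - by move=> z; rewrite mule_ge0// lee_fin ?expR_ge0// indicE ler0n.
apply: integral_ae_eq => //.
- apply/integrableP; split => //; under eq_integral => y _ do rewrite (gee0_abs (F0 y)).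
  by rewrite FB// probability_setT ltry.
- by move=> B _ mB; rewrite FB// integral_cst// mul1e.
Qed.

Variables (ph : borel X -> R).
Hypothesis mph : measurable_fun setT ph.
Let f : borel X -> Yd -> R := half_gibbs_x c eps ph.
Hypothesis fi : forall y, rho.-integrable setT (fun x => (f x y)%:E).
Let ps : Yd -> R := psi_update c eps rho ph.
Hypothesis hi : forall x, nu.-integrable setT (fun y => (half_gibbs_y c eps ps x y)%:E).
Let ph1 : borel X -> R := phi_update c eps nu ps.
Let E := log_ratio eps phi psi ph ps.
Let u := phi_drop c eps rho nu ph.

Let mps : measurable_fun setT ps. Proof. exact: measurable_psi_update. Qed.

Lemma kavg_gibbs (G : borel X -> R) y : bounded_mfun G ->
  ((kavg rho f setT G y)%:E = \int[rho]_x (G x * gibbs c eps ph ps x y)%:E)%E.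
Proof.
move=> bG; rewrite /kavg.
have -> : kint rho f (\1_setT) y = expR (ps y / eps).
  by rewrite expR_psi_update//; apply: eq_Rintegral => x _; rewrite indicT mul1r.
have -> : kint rho f (fun x => \1_setT x * G x) y = kint rho f G y.
  by apply: eq_Rintegral => x _; rewrite indicT mul1r.
under [RHS]eq_integral do rewrite (gibbsE_x c eps0) mulrCA EFinM.
rewrite integralZl//; last exact: kint_integrable.
by rewrite kintE// -EFinM expRN mulrC.
Qed.

Variable p : R.
Hypothesis p0 : 0 < p.
Hypothesis free_energy_ineq : forall h : borel X -> R, bounded_mfun h ->
  p * ln (\int[nu]_y kavg rho f setT (fun x => expR (- (h x / p))) y) <=
  \int[nu]_y ln (kavg rho f setT (fun x => expR (- h x)) y).
Hypothesis iE : pi.-integrable setT (fun z => (E z)%:E).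
Hypothesis iu : rho.-integrable setT (fun x => (u x)%:E).

Lemma int_kavg_gibbs (G : borel X -> R) : bounded_mfun G -> (forall x, 0 <= G x) ->
  (\int[nu]_y (kavg rho f setT G y)%:E = \int[rho]_x (G x * expR (- u x))%:E)%E.
Proof.
move=> bG G0; under eq_integral do rewrite kavg_gibbs//.
have mGg : measurable_fun setT (fun z : borel X * Yd => (G z.1 * gibbs c eps ph ps z.1 z.2)%:E).
  apply/measurable_EFinP; apply: measurable_funM; last exact: measurable_gibbs.
  exact: (measurableT_comp bG.1 measurable_fst).
have Gg0 (z : borel X * Yd) : (0 <= (G z.1 * gibbs c eps ph ps z.1 z.2)%:E)%E.
  by rewrite lee_fin mulr_ge0 ?expR_ge0.
rewrite -[LHS](@fubini_tonelli2 _ _ _ _ _ rho nu _ mGg Gg0) (@fubini_tonelli1 _ _ _ _ _ rho nu _ mGg Gg0).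
apply: eq_integral => x _; rewrite /fubini_F /=.
have H := int_gibbs_y eps0 hi ph x.
under eq_integral do rewrite EFinM.
rewrite ge0_integralZl ?lee_fin//.
- by rewrite H -EFinM /u /phi_drop -mulNr opprB.
- apply/measurable_EFinP.
  exact: (measurable_fun_pair2 x (measurable_gibbs eps mc mph mps)).
- by move=> y _; rewrite lee_fin expR_ge0.
Qed.

(** The free energy bound for the truncation [hk] of [(phi - ph) / eps]. On the side of
    the logarithm, Tonelli turns the kernel averages of [e^(- hk / p)] into the integral
    of [e^(- hk / p - u)], and Jensen bounds its logarithm below by the mean of
    [- hk / p - u]. On the other side the averages of [e^(- hk)] are at most the
    exponential of the soft clamp of [(psi - ps) / eps]. *)
Lemma entropy_le_truncated (k : R) : 0 <= k ->
  - (\int[pi]_z (clamp k ((phi z.1 - ph z.1) / eps) + soft_clamp k ((psi z.2 - ps z.2) / eps))) <= p * \int[rho]_x u x.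
Proof.
move=> k0.
pose hk (x : borel X) := clamp k ((phi x - ph x) / eps).
pose wk (y : Yd) := soft_clamp k ((psi y - ps y) / eps).
have mh : measurable_fun setT (fun x : borel X => (phi x - ph x) / eps).
  by apply: measurable_funM; [exact: measurable_funB|exact: measurable_cst].
have mw : measurable_fun setT (fun y : Yd => (psi y - ps y) / eps).
  by apply: measurable_funM; [exact: measurable_funB|exact: measurable_cst].
have bh : bounded_mfun hk.
  split; last by exists k => x; exact: clamp_bound.
  apply: measurable_maxr; first exact: measurable_cst.
  by apply: measurable_minr => //; exact: measurable_cst.
have bhp : bounded_mfun (fun x => hk x / p) by apply: bmfunM => //; exact: bmfun_cst.
have bw : bounded_mfun wk.
  split.
    apply: measurable_minr; first exact: measurable_cst.
    apply: measurableT_comp => //; apply: measurable_funD; last exact: measurable_cst.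
    exact: measurableT_comp.
  exists (k + ln 2) => y; have /andP[l r] := soft_clamp_bounds ((psi y - ps y) / eps) k0.
  have := clamp_bound ((psi y - ps y) / eps) k0; rewrite ler_norml => /andP[l' r'].
  have l2 : 0 < ln 2 :> R by rewrite ln_gt0// ltr1n.
  by rewrite /wk ler_norml; apply/andP; split; lra.
have bE := bmfun_expRN bh; have bEp := bmfun_expRN bhp.
pose I := \int[nu]_y kavg rho f setT (fun x => expR (- (hk x / p))) y.
have T0 : rho setT != 0%E by rewrite probability_setT onee_eq0.
have fpos (x : borel X) (y : Yd) : 0 < f x y by exact: expR_gt0.
have mf : measurable_fun setT (fun z : borel X * Yd => f z.1 z.2) by exact: measurable_half_gibbs_x.
have kb (h : borel X -> R) : bounded_mfun h -> exists2 B, 0 <= B & forall y,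
    expR (- B) <= kavg rho f setT (fun x => expR (- h x)) y <= expR B.
  move=> bh'; have [_ [B hB]] := bh'; exists (Num.max B 0); first by rewrite le_max lexx orbT.
  move=> y; apply: (kavg_bounds fpos fi measurableT T0) => //; first exact: bmfun_expRN.
  move=> x; have := hB x; rewrite !ler_expR ler_norml => /andP[l r].
  by apply/andP; split; rewrite ?lerN2 ?[- Num.max _ _ <= _]lerNl le_max; apply/orP; left; lra.
have bk (h : borel X -> R) : bounded_mfun h -> bounded_mfun (kavg rho f setT (fun x => expR (- h x))).
  move=> bh'; have [B _ kB] := kb _ bh'; apply: (@bmfun_le _ _ _ _ (expR B)).
    apply: (measurable_kavg mf fpos fi measurableT T0); first exact: bmfun_expRN.
    by move=> x; exact: expR_ge0.
  by move=> y; have /andP[l ->] := kB y; rewrite (le_trans _ l)// expR_ge0.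
have kpos (h : borel X -> R) : bounded_mfun h -> forall y, 0 < kavg rho f setT (fun x => expR (- h x)) y.
  by move=> bh' y; have [B _ /(_ y)/andP[l _]] := kb _ bh'; rewrite (lt_le_trans _ l)// expR_gt0.
have I0 : 0 < I by apply: EI_gt0; [exact: bk|exact: kpos].
have IE : (\int[rho]_x (expR (- (hk x / p)) * expR (- u x))%:E = I%:E)%E.
  rewrite -(int_kavg_gibbs bEp (fun x => expR_ge0 _)).
  by rewrite [RHS]fineK//; apply: integrable_fin_num => //; exact: (bmfun_int nu (bk _ bhp)).
have nt : exp_normalized rho (fun x => hk x / p + u x + ln I).
  have mu : measurable_fun setT u by apply/measurable_EFinP; exact: measurable_int iu.
  split; first by apply: measurable_funD; [apply: measurable_funD => //; exact: bhp.1|exact: measurable_cst].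
  have -> : (\int[rho]_x (expR (- (hk x / p + u x + ln I)))%:E =
      \int[rho]_x ((I^-1)%:E * (expR (- (hk x / p)) * expR (- u x))%:E))%E.
    apply: eq_integral => x _; rewrite -EFinM -expRD -[in RHS](lnK (x := I))//.
    by rewrite -expRN -expRD; congr (expR _)%:E; ring.
  rewrite ge0_integralZl//.
  - by rewrite IE -EFinM mulVf// gt_eqF.
  - apply/measurable_EFinP; apply: measurable_funM; first exact: bEp.1.
    by apply: measurableT_comp => //; exact: measurableT_comp.
  - by rewrite lee_fin invr_ge0 ltW.
have ih := bmfun_int rho bh.
have ihp := bmfun_int rho bhp.
have i1 : rho.-integrable setT (EFin \o (fun=> ln I)) := bmfun_int rho (bmfun_cst _ (ln I)).
have t0 : 0 <= (\int[rho]_x hk x) / p + \int[rho]_x u x + ln I.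
  have := exp_normalized_ge0 nt (integrableD measurableT (integrableD measurableT ihp iu) i1).
  rewrite RintegralD//; last exact: (integrableD measurableT ihp iu).
  by rewrite RintegralD// EI_cst EIZr.
have sI := free_energy_ineq bh.
rewrite -/I in sI.
have wle : \int[nu]_y ln (kavg rho f setT (fun x => expR (- hk x)) y) <= \int[nu]_y wk y.
  pose wm y := Num.min (ln (kavg rho f setT (fun x => expR (- hk x)) y)) (wk y).
  have bl : bounded_mfun (fun y => ln (kavg rho f setT (fun x => expR (- hk x)) y)).
    split; first by apply: measurableT_comp => //; exact: (bk _ bh).1.
    have [B _ kB] := kb _ bh; exists B => y; have /andP[l r] := kB y.
    by rewrite ler_norml -(ler_expR (- B)) -(ler_expR _ B) lnK ?posrE ?l//; exact: kpos.
  have bm : bounded_mfun wm.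
    split; first by apply: measurable_minr; [exact: bl.1|exact: bw.1].
    have [_ [B1 H1]] := bl; have [_ [B2 H2]] := bw; exists (B1 + B2) => y.
    have := H1 y; have := H2 y; rewrite /wm !ler_norml => /andP[l1 r1] /andP[l2 r2].
    by rewrite /Num.min; case: ifP => _; apply/andP; split; lra.
  have -> : \int[nu]_y ln (kavg rho f setT (fun x => expR (- hk x)) y) = \int[nu]_y wm y.
    congr fine; apply: ae_eq_integral => //.
    - by apply/measurable_EFinP; exact: bl.1.
    - by apply/measurable_EFinP; exact: bm.1.
    (* where the conditional mass is 1 the minimum is attained by the first term *)
    apply: filterS gibbs_marginal_snd => y H _; congr EFin; have {}H := H Logic.I.
    apply/esym/min_idPl; rewrite /wk /soft_clamp le_min; apply/andP; split.
      rewrite -ler_expR lnK ?posrE ?kpos//.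
      have hk' x : expR (- k) <= expR (- hk x) <= expR k.
        have := clamp_bound ((phi x - ph x) / eps) k0; rewrite !ler_expR ler_norml => /andP[l r].
        by rewrite /hk; apply/andP; split; lra.
      by have /andP[] := kavg_bounds fpos fi measurableT T0 y bE hk'.
    rewrite ler_ln ?posrE ?kpos ?addr_gt0 ?expR_gt0// -lee_fin kavg_gibbs//.
    have mgy (a : borel X -> R) (b : Yd -> R) : measurable_fun setT a -> measurable_fun setT b ->
        measurable_fun setT (fun x : borel X => (gibbs c eps a b x y)%:E).
      move=> ma mb; apply/measurable_EFinP.
      exact: (measurable_fun_pair1 y (measurable_gibbs eps mc ma mb)).
    have -> : (expR ((psi y - ps y) / eps) + expR (- k))%:E =
        (\int[rho]_x ((expR ((psi y - ps y) / eps))%:E * (gibbs c eps phi psi x y)%:E +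
                      (expR (- k))%:E * (gibbs c eps ph ps x y)%:E))%E.
      rewrite ge0_integralD//.
      - rewrite !ge0_integralZl ?lee_fin ?expR_ge0//; first last.
        + by move=> x _; rewrite lee_fin expR_ge0.
        + exact: mgy.
        + by move=> x _; rewrite lee_fin expR_ge0.
        + exact: mgy.
        by rewrite H int_gibbs_x// subrr mul0r expR0 !mule1.
      - by move=> x _; rewrite -EFinM lee_fin mulr_ge0 ?expR_ge0.
      - by apply: measurable_funeM; exact: mgy.
      - by move=> x _; rewrite -EFinM lee_fin mulr_ge0 ?expR_ge0.
      - by apply: measurable_funeM; exact: mgy.
    apply: ge0_le_integral => //.
    - by move=> x _; rewrite lee_fin mulr_ge0 ?expR_ge0.
    - apply/measurable_EFinP; apply: measurable_funM; first exact: bE.1.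
      by apply/measurable_EFinP; exact: mgy.
    - by apply: emeasurable_funD; apply: measurable_funeM; exact: mgy.
    move=> x _; rewrite -!EFinM -EFinD lee_fin.
    have -> : expR ((psi y - ps y) / eps) * gibbs c eps phi psi x y =
        expR (- ((phi x - ph x) / eps)) * gibbs c eps ph ps x y.
      by rewrite /gibbs -!expRD; congr expR; field; rewrite gt_eqF.
    rewrite -mulrDl ler_wpM2r ?expR_ge0// /hk.
    case: (clampP ((phi x - ph x) / eps) k0) => -[hk0 ->] //.
    - by rewrite -[leLHS]addr0 lerD ?expR_ge0// ler_expR lerN2.
    - by rewrite lerDl expR_ge0.
    - by rewrite lerDr expR_ge0.
  apply: EI_le => // y; rewrite /wm ge_min lexx orbT //.
have -> : \int[pi]_z (clamp k ((phi z.1 - ph z.1) / eps) + soft_clamp k ((psi z.2 - ps z.2) / eps)) =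
    \int[rho]_x hk x + \int[nu]_y wk y.
  rewrite RintegralD//.
  - congr (_ + _).
      by congr fine; rewrite -(coupling_fst cpl (f := fun x => (hk x)%:E))//; apply/measurable_EFinP; exact: bh.1.
    by congr fine; rewrite -(coupling_snd cpl (f := fun x => (wk x)%:E))//; apply/measurable_EFinP; exact: bw.1.
  - exact/(integrable_fst cpl bh.1).
  - by apply/(integrable_snd cpl bw.1); exact: bmfun_int.
have gen (a b U l q : R) : 0 <= a / p + U + l -> p * l <= q -> q <= b -> - (a + b) <= p * U.
  move=> H1 H2 H3; have : 0 <= p * (a / p + U + l) by rewrite mulr_ge0// ltW.
  rewrite (_ : p * (a / p + U + l) = a + p * U + p * l); last by field; rewrite gt_eqF.
  by lra.
move: t0 sI wle.
exact: gen.
Qed.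

(** Passage to the limit in the truncation, dominated by [|E| + ln 2]. *)
Lemma entropy_le_phi_drop : \int[pi]_z E z <= p * \int[rho]_x u x.
Proof.
pose F (n : nat) (z : borel X * Yd) :=
  clamp n%:R ((phi z.1 - ph z.1) / eps) + soft_clamp n%:R ((psi z.2 - ps z.2) / eps).
have EE z : E z = - ((phi z.1 - ph z.1) / eps + (psi z.2 - ps z.2) / eps).
  by rewrite /E /log_ratio; field; rewrite gt_eqF.
have l2 : 0 < ln 2 :> R by rewrite ln_gt0// ltr1n.
have i2 : pi.-integrable setT (EFin \o (fun=> ln 2 : R)) := bmfun_int pi (bmfun_cst _ (ln 2)).
have mh : measurable_fun setT (fun z : borel X * Yd => (phi z.1 - ph z.1) / eps).
  apply: measurable_funM; last exact: measurable_cst.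
  by apply: measurable_funB; apply: (measurableT_comp _ measurable_fst).
have mw : measurable_fun setT (fun z : borel X * Yd => (psi z.2 - ps z.2) / eps).
  apply: measurable_funM; last exact: measurable_cst.
  by apply: measurable_funB; apply: (measurableT_comp _ measurable_snd).
have /fine_cvgP[_ H] : (\int[pi]_z (F n z)%:E)%E @[n --> \oo] --> (\int[pi]_z (- E z))%:E.
  rewrite /Rintegral fineK; last first.
    by apply: integrable_fin_num => //; under eq_fun do rewrite EFinN; exact: integrableN.
  apply: (@dominated_cvg _ _ _ pi _ measurableT (fun n z => (F n z)%:E) _
    (fun z => (`|E z|)%:E + (ln 2)%:E)%E) => //.
  - move=> n; apply/measurable_EFinP; apply: measurable_funD.
      apply: measurable_maxr; first exact: measurable_cst.
      by apply: measurable_minr => //; exact: measurable_cst.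
    apply: measurable_minr; first exact: measurable_cst.
    apply: measurableT_comp => //; apply: measurable_funD; last exact: measurable_cst.
    exact: measurableT_comp.
  - move=> z _; rewrite EE opprK; apply/fine_cvgP; split; first exact: nearW.
    exact: truncation_cvg.
  - by apply: integrableD => //; exact: (integrable_abse iE).
  - move=> n z _; rewrite -EFinD lee_fin /F EE normrN.
    have n0 : (0 : R) <= n%:R by rewrite ler0n.
    have /andP[a b] := soft_clamp_bounds ((psi z.2 - ps z.2) / eps) n0.
    have := clamp_dist ((phi z.1 - ph z.1) / eps) ((psi z.2 - ps z.2) / eps) n0.
    rewrite !ler_norml => /andP[a' b']; apply/andP; split; lra.
have L : forall n : nat, - (\int[pi]_z F n z) <= p * \int[rho]_x u x.
  by move=> n; apply: entropy_le_truncated; rewrite ler0n.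
have -> : \int[pi]_z E z = - (\int[pi]_z (- E z)).
  rewrite (_ : (fun z => - E z) = fun z => -1 * E z); last by apply/funext => z; rewrite mulN1r.
  by rewrite RintegralZl// mulN1r opprK.
by apply: (ler_cvg_to (cvgN H) (cvg_cst _)); exact: nearW.
Qed.

End EntropyBound.

(** * Geometric decay of the entropy *)

Section Convergence.
Context (R : realType) (X : ptopologicalType) (d : nat).
Variables (c : X -> 'rV[R]_d -> R) (eps : R).
Variables (rho : probability (borel X) R) (nu : probability (borel 'rV[R]_d) R).
Hypothesis mc : measurable_fun (setT : set (borel X * borel 'rV[R]_d)%type)
          (fun z : borel X * borel 'rV[R]_d => c z.1 z.2).
Hypothesis eps0 : 0 < eps.
Notation Yd := (borel 'rV[R]_d).
Variables (phi : borel X -> R) (psi : Yd -> R) (pi : probability (borel X * Yd)%type R).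
Hypotheses (mphi : measurable_fun setT phi) (mpsi : measurable_fun setT psi).
Hypotheses (dpi : has_gibbs_density c eps rho nu phi psi pi) (cpl : coupling rho nu pi).
Variables (phi0 : borel X -> R) (pin : nat -> probability (borel X * Yd)%type R).
Hypotheses (hphi0 : admissible_init c eps rho nu phi0) (hpin : sinkhorn_plans c eps rho nu phi0 pin).

Variable p0 : R.
Hypothesis p01 : 1 < p0.
Hypothesis free_energy_ineq : forall (p : R) (ph : borel X -> R), p0 < p -> measurable_fun setT ph ->
  (forall y, rho.-integrable setT (fun x => (half_gibbs_x c eps ph x y)%:E)) ->
  forall h : borel X -> R, bounded_mfun h ->
  p * ln (\int[nu]_y kavg rho (half_gibbs_x c eps ph : borel X -> Yd -> R) setT
                       (fun x => expR (- (h x / p))) y) <=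
  \int[nu]_y ln (kavg rho (half_gibbs_x c eps ph : borel X -> Yd -> R) setT
                   (fun x => expR (- h x)) y).

Let ph n : borel X -> R := sinkhorn_phi c eps rho nu phi0 n.
Let ps n : Yd -> R := sinkhorn_psi c eps rho nu phi0 n.

Let fi n y : rho.-integrable setT (fun x => (half_gibbs_x c eps (ph n) x y)%:E).
Proof. by have [[_ /(_ y)[]]] := hphi0.2 n. Qed.

Let hi n x : nu.-integrable setT (fun y => (half_gibbs_y c eps (ps n) x y)%:E).
Proof. by have [_] := hphi0.2 n. Qed.

Let mph n : measurable_fun setT (ph n).
Proof.
elim: n => [|n IH]; first exact: hphi0.1.
exact: (measurable_phi_update eps nu mc (measurable_psi_update eps rho mc IH)).
Qed.

Let mps n : measurable_fun setT (ps n).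
Proof. exact: (measurable_psi_update eps rho mc (mph n)). Qed.

Let E n := log_ratio eps phi psi (ph n) (ps n).

Let entE n : rel_entropy pi (pin n) = (\int[pi]_z (E n z)%:E)%E.
Proof. exact: (rel_entropy_gibbs mc eps0 mphi mpsi dpi (mph n) (mps n) (hpin n)). Qed.

Let nE n : exp_normalized pi (E n).
Proof. exact: (log_ratio_normalized mc eps0 mphi mpsi dpi (mph n) (mps n) (hpin n)). Qed.

Let entP n : rel_entropy pi (pin n) = +oo%E \/
  [/\ pi.-integrable setT (fun z => (E n z)%:E), 0 <= \int[pi]_z E n z &
      rel_entropy pi (pin n) = (\int[pi]_z E n z)%:E].
Proof.
have [->|fin] := eqVneq (rel_entropy pi (pin n)) +oo%E; first by left.
have iE : pi.-integrable setT (fun z => (E n z)%:E).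
  by apply: exp_normalized_int => //; rewrite -entE ltey.
right; split => //; first exact: exp_normalized_ge0.
by rewrite entE [RHS]fineK//; exact: integrable_fin_num.
Qed.

Lemma sinkhorn_rate01 : 0 < 1 - p0^-1 < 1.
Proof.
have p00 : 0 < p0 by rewrite (lt_trans ltr01).
by rewrite subr_gt0 invf_lt1// p01 ltrBlDr ltrDl invr_gt0.
Qed.

(** If the entropy is infinite there is nothing to prove, as the factor is positive;
    otherwise the decrement is at least a fraction [1 / p] of the entropy for every
    [p > p0], and [p] tends to [p0]. *)
Lemma rel_entropy_contraction n :
  (rel_entropy pi (pin n.+1) <= (1 - p0^-1)%:E * rel_entropy pi (pin n))%E.
Proof.
have /andP[r0 _] := sinkhorn_rate01.
case: (entP n) => [->|[iE A0 AE]]; first by rewrite gt0_muley ?lte_fin// leey.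
have iu := phi_drop_integrable mc eps0 mphi mpsi dpi cpl (mph n) (fi n) (hi n) (fi n.+1) (hpin n.+1) iE.
have iE1 := log_ratio_integrable_step mc eps0 mphi mpsi dpi cpl (mph n) (fi n) (hi n) (fi n.+1) (hpin n.+1) iE.
have dec := entropy_decrement mc eps0 mphi mpsi dpi cpl (mph n) (fi n) (hi n) (fi n.+1) (hpin n.+1) iE.
have E1E : rel_entropy pi (pin n.+1) = (\int[pi]_z E n.+1 z)%:E.
  by rewrite entE [RHS]fineK//; exact: integrable_fin_num iE1.
have bd p : p0 < p -> \int[pi]_z E n z <= p * \int[rho]_x phi_drop c eps rho nu (ph n) x.
  move=> pp; have p00 : 0 < p by rewrite (lt_trans _ pp)// (lt_trans ltr01).
  by apply: (entropy_le_phi_drop mc eps0 mphi mpsi dpi cpl (mph n) (fi n) (hi n) p00 _ iE iu) => h; apply: free_energy_ineq.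
rewrite E1E AE -EFinM lee_fin.
have gen (a a1 U : R) : a1 <= a - U -> (forall p, p0 < p -> a <= p * U) -> a1 <= (1 - p0^-1) * a.
  move=> a1U aU; have : a <= p0 * U.
    apply: (@le_of_le_addM _ _ _ U 1) => // e /andP[e0 _]; rewrite -mulrDl; apply: aU.
    by rewrite ltrDl.
  have p00 : 0 < p0 by rewrite (lt_trans ltr01).
  rewrite mulrC -ler_pdivrMr// => aU'; apply: le_trans a1U _.
  by rewrite mulrBl mul1r mulrC lerD2l lerN2.
exact: gen dec bd.
Qed.

Theorem sinkhorn_converges_with_rate : converges_with_rate pi pin (1 - p0^-1).
Proof.
have /andP[r0 r1] := sinkhorn_rate01.
move=> n _; elim: n => [|n IH].
  rewrite expr0 mul1e; apply: le_trans (rel_entropy_contraction 0) _.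
  case: (entP 0) => [->|[_ A0 ->]]; first by rewrite leey.
  by rewrite -EFinM lee_fin ler_piMl// ltW.
apply: le_trans (rel_entropy_contraction n.+1) _.
by rewrite exprS EFinM -muleA lee_pmul2l// lte_fin.
Qed.

End Convergence.

(** * Euclidean calculus *)

Section Euclidean.
Context (R : realType) (d : nat).
Implicit Types (u v y z : 'rV[R]_d) (f : 'rV[R]_d -> R).

Definition dot u v := \sum_(i < d) u 0 i * v 0 i.

Lemma enorm_ge0 v : 0 <= enorm v.
Proof. exact: sqrtr_ge0. Qed.

Lemma enorm_sqr v : enorm v ^+ 2 = dot v v.
Proof.
rewrite /enorm sqr_sqrtr; last by apply: sumr_ge0 => i _; exact: sqr_ge0.
by apply: eq_bigr => i _; rewrite expr2.
Qed.

(** The Cauchy-Schwarz inequality. *)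
Lemma dot_le u v : `|dot u v| <= enorm u * enorm v.
Proof.
rewrite -(@ler_pXn2r _ 2)// ?nnegrE ?mulr_ge0 ?enorm_ge0 ?normr_ge0//.
rewrite exprMn !enorm_sqr real_normK ?num_real//.
have [v0|vn0] := eqVneq (dot v v) 0.
  have : forall i, v 0 i = 0.
    move=> i; apply/eqP; have := v0; rewrite /dot => /eqP.
    rewrite psumr_eq0; last by move=> j _; rewrite -expr2 sqr_ge0.
    by move=> /allP/(_ i); rewrite mem_index_enum /= mulf_eq0 orbb; exact.
  by move=> H; rewrite v0 mulr0 /dot big1 ?expr0n// => i _; rewrite H mulr0.
have vp : 0 < dot v v by rewrite lt_neqAle eq_sym vn0 -enorm_sqr sqr_ge0.
pose t := dot u v / dot v v.
have : 0 <= \sum_(i < d) (u 0 i - t * v 0 i) ^+ 2 by apply: sumr_ge0 => i _; exact: sqr_ge0.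
have -> : \sum_(i < d) (u 0 i - t * v 0 i) ^+ 2 = dot u u - 2 * t * dot u v + t ^+ 2 * dot v v.
  rewrite /dot !mulr_sumr -sumrB -big_split /=; apply: eq_bigr => i _; ring.
have gen (a b c : R) : 0 < c -> 0 <= a - 2 * (b / c) * b + (b / c) ^+ 2 * c -> b ^+ 2 <= a * c.
  move=> c0; have -> : a - 2 * (b / c) * b + (b / c) ^+ 2 * c = (a * c - b ^+ 2) / c.
    by field; rewrite gt_eqF.
  by rewrite pmulr_lge0 ?invr_gt0// subr_ge0.
exact: gen.
Qed.

Lemma coord_le_enorm v i : `|v 0 i| <= enorm v.
Proof.
rewrite -(@ler_pXn2r _ 2)// ?nnegrE ?enorm_ge0 ?normr_ge0//.
rewrite enorm_sqr real_normK ?num_real// /dot (bigD1 i)//= -expr2 lerDl.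
by apply: sumr_ge0 => j _; rewrite -expr2 sqr_ge0.
Qed.

Lemma enorm_continuous : continuous (@enorm R d).
Proof.
have H (s : seq 'I_d) : continuous (fun w : 'rV[R]_d => \sum_(i <- s) w 0 i ^+ 2).
  elim: s => [|i s IH] w.
    rewrite (_ : (fun w : 'rV[R]_d => _) = fun=> 0); first exact: cst_continuous.
    by apply/funext => w'; rewrite big_nil.
  rewrite (_ : (fun w : 'rV[R]_d => _) = fun w : 'rV[R]_d => w 0 i * w 0 i + \sum_(j <- s) w 0 j ^+ 2).
    exact: (cvgD (cvgM (@coord_continuous _ _ _ _ _ w) (@coord_continuous _ _ _ _ _ w)) (IH w)).
  by apply/funext => w'; rewrite big_cons expr2.
by move=> v; exact: (cvg_comp _ _ (H _ v) (@sqrt_continuous R _)).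
Qed.

Lemma derive_grad f y z : differentiable f y -> 'D_z f y = dot (grad f y) z.
Proof.
move=> df; rewrite deriveE// {1}(row_sum_delta z) linear_sum; apply: eq_bigr => i _.
by rewrite linearZ /= /GRing.scale /= mulrC mxE deriveE.
Qed.

Lemma is_derive_segment f y z (s : R) : differentiable f (y + s *: z) ->
  is_derive s 1 (fun s => f (y + s *: z)) ('D_z f (y + s *: z)).
Proof.
move=> df; pose a := y + s *: z; pose g (s : R) := f (y + s *: z).
have E : (fun h : R => h^-1 *: ((g \o shift s) (h *: (1 : R)) - g s)) =
    (fun h : R => h^-1 *: ((f \o shift a) (h *: z) - f a)).
  apply/funext => h; congr (_ *: (f _ - _)).
  by rewrite scalerDl -scalerA scale1r addrCA.
constructor; last by rewrite /derive -/g E.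
rewrite /derivable -/g E; exact: (@diff_derivable R _ _ f a z df).
Qed.

Lemma segment_mvt f y z : (forall y, differentiable f y) ->
  exists2 s : R, 0 <= s <= 1 & f (y + z) - f y = dot (grad f (y + s *: z)) z.
Proof.
move=> df; pose g (s : R) := f (y + s *: z).
have dg (s : R) : is_derive s 1 g ('D_z f (y + s *: z)) by exact: is_derive_segment.
have [|s s01] := @MVT_segment R g (fun s => 'D_z f (y + s *: z)) 0 1 ler01.
  apply: continuous_subspaceT => s; apply: differentiable_continuous; apply/derivable1_diffP.
  by have [] := dg s.
rewrite /g scale1r scale0r addr0 subr0 mulr1 => ->; exists s; first by move: s01; rewrite in_itv.
by rewrite derive_grad.
Qed.

Lemma grad_sub f1 f2 y : differentiable f1 y -> differentiable f2 y ->
  grad (fun y => f1 y - f2 y) y = grad f1 y - grad f2 y.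
Proof.
move=> d1 d2; apply/rowP => i; rewrite !mxE.
exact: (deriveB (@diff_derivable R _ _ f1 y _ d1) (@diff_derivable R _ _ f2 y _ d2)).
Qed.

End Euclidean.

(** * Second countability and supports *)

Section SecondCountable.

Lemma countable_basis_seq (T : topologicalType) : T -> @second_countable T ->
  exists f : nat -> set T, (forall n, open (f n)) /\
    forall x U, nbhs x U -> exists2 n, f n x & f n `<=` U.
Proof.
move=> x0 [B cB [oB nB]]; have /pfcard_geP[B0|[f]] := cB.
  have [V [BV _]] := nB x0 setT filterT.
  by move: BV; rewrite B0.
exists f; split=> [n|x U /nB[V [BV Vx] VU]]; first by apply: oB; apply: funS.
by have [n _ fn] := @surj _ _ _ _ f V BV; exists n; rewrite fn.
Qed.

Lemma dense_seq (T : topologicalType) (S : set T) : @second_countable T -> S !=set0 ->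
  exists q : nat -> T, (forall n, S (q n)) /\
    forall y U, S y -> nbhs y U -> exists n, U (q n).
Proof.
move=> sT [y0 Sy0]; have [f [_ fB]] := countable_basis_seq y0 sT.
have /choice[q qP] : forall n, exists y, S y /\ ((S `&` f n) !=set0 -> f n y).
  move=> n; have [[y [Sy fy]]|H] := pselect (S `&` f n !=set0); first by exists y.
  by exists y0.
exists q; split=> [n|y U Sy /fB[n fy fU]]; first by case: (qP n).
by exists n; apply: fU; apply: (qP n).2; exists y.
Qed.

(** The complement of the support is the union of the null members of a countable
    basis. *)
Lemma supp_setC_negligible (T : ptopologicalType) (R : realType) (mu : probability (borel T) R) :
  @second_countable T -> open (~` supp mu) /\ mu (~` supp mu) = 0%E.
Proof.
move=> sT; have [f [of_ fB]] := countable_basis_seq point sT.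
pose g n := if mu (f n) == 0%E then f n else set0.
have og n : open (g n) by rewrite /g; case: ifP => // _; exact: open0.
have g0 n : mu (g n) = 0%E by rewrite /g; case: ifPn => [/eqP//|_]; rewrite measure0.
have E : ~` supp mu = \bigcup_n g n.
  apply/seteqP; split=> [x /existsNP[U /not_implyP[oU /not_implyP[Ux /negP]]]|x [n _]].
    rewrite -leNgt measure_le0 => /eqP U0.
    have [n fx fU] := fB x U (open_nbhs_nbhs (conj oU Ux)).
    exists n => //; rewrite /g; case: ifPn => // /negP[]; apply/eqP.
    apply/eqP; rewrite -measure_le0 -U0; apply: le_measure => //; rewrite inE; exact: sub_sigma_algebra.
  rewrite /g; case: ifPn => // /eqP f0 fx /(_ _ (of_ n) fx); by rewrite f0 ltxx.
split; first by rewrite E; exact: bigcup_open.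
have mg n : measurable (g n : set (borel T)) by exact: sub_sigma_algebra.
have mU : measurable (\bigcup_n g n : set (borel T)) by apply: bigcupT_measurable.
rewrite E; apply: (iffLR (negligibleP mu mU)); apply: negligible_bigcup => n.
by exists (g n); split; [exact: mg|exact: g0|].
Qed.

(** Balls with rational centers and radii [1 / (k + 1)]. *)
Lemma rV_second_countable (R : realType) (d : nat) : @second_countable 'rV[R]_d.
Proof.
pose b (qk : 'rV[rat]_d * nat) : set 'rV[R]_d := ball (\row_i ratr (qk.1 0 i) : 'rV[R]_d) qk.2.+1%:R^-1.
exists (range b); first by apply: sub_countable (card_image_le _ _) _; exact: countableP.
split=> [_ [qk _ <-]|x U /nbhs_ballP[e e0 eU]].
  by apply: ball_open; rewrite invr_gt0.
have [k ke] : exists k : nat, k.+1%:R^-1 < e / 2.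
  by have := near_infty_natSinv_lt (PosNum (divr_gt0 e0 (ltr0Sn R 1))) => -[k _ /(_ k (leqnn k))]; exists k.
have /choice[q qP] : forall i, exists q : rat, `|ratr q - x 0 i| < k.+1%:R^-1.
  move=> i; have /rat_in_itvoo[q] : x 0 i - k.+1%:R^-1 < x 0 i + k.+1%:R^-1.
    by rewrite ltrD2l gtrN// invr_gt0.
  by rewrite in_itv /= => H; exists q; rewrite ltr_distl.
exists (b (\row_i q i, k)).
  split; first by exists (\row_i q i, k).
  by split; [rewrite invr_gt0|move=> i j; rewrite !mxE ord1; exact: qP].
move=> y [_ yb]; apply: eU; split => // i j; rewrite ord1.
have := yb 0 j; have := qP j; rewrite /ball /= !mxE => H1 H2.
have -> : x 0 j - y 0 j = (x 0 j - ratr (q j)) + (ratr (q j) - y 0 j) by ring.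
apply: le_lt_trans (ler_normD _ _) _; rewrite (distrC (x 0 j)).
by rewrite [e in _ < e]splitr ltrD// ?(lt_trans H1)// (lt_trans H2).
Qed.

End SecondCountable.

(** * Increments of the cost *)

Section Increments.
Context (R : realType) (X : ptopologicalType) (d : nat).
Variables (c : X -> 'rV[R]_d -> R).
Variables (rho : probability (borel X) R) (nu : probability (borel 'rV[R]_d) R).
Notation Yd := (borel 'rV[R]_d).

(** Up to a term [b] that does not depend on [x], the increments of [c x] over short
    distances in [S] have slope at most [M'], for any [M'] above [M], on an exhausting
    sequence of sets of [x]. The scale of the distances may depend on the set. *)
Definition increments_bounded (S : set Yd) (M : R) := forall M', M < M' ->
  exists A : nat -> set (borel X), [/\ forall n, measurable (A n),
    forall m n, (m <= n)%N -> A m `<=` A n, rho (\bigcup_n A n) = 1%E &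
    forall n, exists2 r : R, 0 < r & forall y y', S y -> S y' -> enorm (y' - y : 'rV[R]_d) < r ->
      exists b, forall x, A n x -> `|c x y' - c x y - b| <= M' * enorm (y' - y : 'rV[R]_d)].

(** The slope [M'] is chosen between [M] and the largest value that [p] allows, so that
    the ratios of the kernel are controlled with [kappa = M' / eps]. *)
Lemma free_energy_ge_increments (S : set Yd) (M tau eps p : R) (ph : borel X -> R) (h : borel X -> R) :
  measurable_fun (setT : set (borel X * Yd)%type) (fun z : borel X * Yd => c z.1 z.2) ->
  0 < eps -> 0 < tau -> TI tau nu -> measurable S -> nu S = 1%E -> 0 <= M ->
  increments_bounded S M -> 1 + tau * M ^+ 2 / eps ^+ 2 < p -> measurable_fun setT ph ->
  (forall y, rho.-integrable setT (fun x => (half_gibbs_x c eps ph x y)%:E)) -> bounded_mfun h ->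
  p * ln (\int[nu]_y kavg rho (half_gibbs_x c eps ph : borel X -> Yd -> R) setT
                       (fun x => expR (- (h x / p))) y) <=
  \int[nu]_y ln (kavg rho (half_gibbs_x c eps ph : borel X -> Yd -> R) setT
                   (fun x => expR (- h x)) y).
Proof.
move=> mc eps0 tau0 hnu mS nuS M0 incr pM mph fi bh.
(* the hypothesis on [p] says [M^2 < (p - 1) eps^2 / tau] *)
have q0 : 0 <= (p - 1) * eps ^+ 2 / tau.
  rewrite divr_ge0 ?(ltW tau0)// mulr_ge0 ?sqr_ge0// subr_ge0.
  by apply: le_trans (ltW pM); rewrite lerDl divr_ge0 ?sqr_ge0// mulr_ge0 ?sqr_ge0// ltW.
pose q := Num.sqrt ((p - 1) * eps ^+ 2 / tau).
have qq : q ^+ 2 = (p - 1) * eps ^+ 2 / tau by rewrite /q sqr_sqrtr.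
have Mq : M < q.
  rewrite -(@ltr_pXn2r _ 2)// ?nnegrE ?sqrtr_ge0// qq ltr_pdivlMr//.
  by rewrite (mulrC (M ^+ 2)) -ltr_pdivrMr ?exprn_gt0// ltrBrDl.
pose M' := (M + q) / 2.
have MM' : M < M' by rewrite /M' ltr_pdivlMr//; lra.
have M'q : M' < q by rewrite /M' ltr_pdivrMr//; lra.
have M'0 : 0 < M' by exact: le_lt_trans MM'.
pose kappa := M' / eps.
have Kp : 1 + kappa ^+ 2 * tau < p.
  rewrite -ltrBrDl /kappa expr_div_n mulrAC ltr_pdivrMr ?exprn_gt0// -ltr_pdivlMr// -qq.
  by rewrite ltr_pXn2r ?nnegrE// ltW// (lt_trans M'0).
have [A [mA ndA A1 incA]] := incr _ MM'.
have mf := measurable_half_gibbs_x eps mc mph.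
apply: (kernel_free_energy_ge tau0 hnu mf _ fi mS nuS _ Kp bh mA ndA A1).
- by move=> x y; exact: expR_gt0.
- by rewrite divr_gt0.
move=> n; have [r r0 rP] := incA n; exists r => // y y' Sy Sy' yr.
have [b bP] := rP _ _ Sy Sy' yr.
exists (expR (- (b / eps))); first exact: expR_gt0.
move=> x Ax; have := bP _ Ax.
have -> : c x y' - c x y - b = (c x y' - b) - c x y by ring.
rewrite ler_norml /half_gibbs_x -!expRD !ler_expR => /andP[l u].
set e := enorm _ in l u *.
have E s : s * (M' / eps * e) + (- (b / eps)) + (- ((c x y + ph x) / eps)) + (c x y' + ph x) / eps =
    (s * (M' * e) + (c x y' - b - c x y)) / eps by field; rewrite gt_eqF.
have e1 := E 1; have e2 := E (-1); rewrite mul1r in e1; rewrite mulN1r in e2.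
have s1 : 0 <= M' / eps * e + (- (b / eps)) + (- ((c x y + ph x) / eps)) + (c x y' + ph x) / eps.
  by rewrite e1 mul1r divr_ge0 ?(ltW eps0)//; lra.
have s2 : - (M' / eps * e) + (- (b / eps)) + (- ((c x y + ph x) / eps)) + (c x y' + ph x) / eps <= 0.
  by rewrite e2 pmulr_lle0 ?invr_gt0//; lra.
by rewrite /kappa; apply/andP; split; lra.
Qed.

End Increments.

Lemma Linfty_norm_ge0 dT (T : measurableType dT) (R : realType) (P : probability T R) d (F : T -> 'rV[R]_d) :
  (0 <= Linfty_norm P F)%E.
Proof.
apply: ess_sup_ger => [|x]; last by rewrite lee_fin enorm_ge0.
have P1 : P setT = 1%E := probability_setT P.
by apply: (lt_le_trans (y := 1%E)); [exact: lte01|rewrite -P1].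
Qed.

Lemma Linfty_norm_ae dT (T : measurableType dT) (R : realType) (P : probability T R) d (F : T -> 'rV[R]_d) :
  (Linfty_norm P F < +oo)%E ->
  exists N, [/\ measurable N, P N = 0%E & forall x, ~ N x -> enorm (F x) <= fine (Linfty_norm P F)].
Proof.
move=> fin; have := ess_sup_ge P (fun x => (enorm (F x))%:E).
move=> [N [mN N0 sN]]; exists N; split => // x Nx.
have : ((enorm (F x))%:E <= Linfty_norm P F)%E by apply: contrapT => H; apply: Nx; exact: sN.
by rewrite -{1}[Linfty_norm P F]fineK ?lee_fin// ge0_fin_numE// Linfty_norm_ge0.
Qed.

Section ConstantHessian.
Context (R : realType) (X : ptopologicalType) (d : nat).
Variables (c : X -> 'rV[R]_d -> R) (rho : probability (borel X) R).

(** The gradient of [c x - c x0] is the constant [g x - g x0], so by the mean value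
    theorem the increments of [c x] and [c x0] differ by [(g x - g x0) . (y' - y)]. *)
Lemma increments_constant_hess (Sigma : 'M[R]_d) (g : X -> 'rV[R]_d) :
  (forall x y, differentiable (c x) y) ->
  (forall x y, g x = grad (c x) y - y *m Sigma^T) -> (Linfty_norm rho g < +oo)%E ->
  increments_bounded c rho setT (fine (Linfty_norm rho g)).
Proof.
move=> dc gE gfin M' MM'; have [N [mN N0 gN]] := Linfty_norm_ae gfin.
have NC : rho (~` N) = 1%E by have := probability_setC rho mN; rewrite N0 sube0.
exists (fun=> ~` N); split; [by move=> _; exact: measurableC|by move=> m n _ x| |].
  by rewrite -NC; congr (rho _); apply/seteqP; split=> [x [_ _]|x Nx] //; exists 0%N.
move=> _; exists 1 => // y y' _ _ _; pose x0 : X := point; pose z : 'rV[R]_d := y' - y.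
exists (c x0 y' - c x0 y - dot (g x0) z) => x Nx.
pose F (v : 'rV[R]_d) := c x v - c x0 v.
have [|s _] := @segment_mvt _ _ F y z.
  by move=> v; exact: differentiableB.
rewrite grad_sub// /z subrKC /F -/z.
have -> : grad (c x) (y + s *: z) - grad (c x0) (y + s *: z) = g x - g x0.
  by rewrite (gE x (y + s *: z)) (gE x0 (y + s *: z)) opprB addrA subrK.
have -> : dot (g x - g x0) z = dot (g x) z - dot (g x0) z.
  by rewrite /dot -sumrB; apply: eq_bigr => i _; rewrite !mxE mulrBl.
move=> H; have -> : c x y' - c x y - (c x0 y' - c x0 y - dot (g x0) z) = dot (g x) z by lra.
by apply: le_trans (dot_le _ _) _; rewrite ler_wpM2r ?enorm_ge0// (le_trans (gN _ Nx))// ltW.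
Qed.

End ConstantHessian.

Section LocallyLipschitz.
Context (R : realType) (d : nat).

(** Near each point of [S] the gradient stays below [M']; compactness gives a uniform
    scale, and the mean value theorem the Lipschitz bound. *)
Lemma compact_locally_lipschitz (f : 'rV[R]_d -> R) (S : set 'rV[R]_d) (M M' : R) :
  compact S -> (forall y, differentiable f y) -> continuous (grad f) ->
  (forall y, S y -> enorm (grad f y) <= M) -> M < M' ->
  exists2 r : R, 0 < r & forall y y', S y -> enorm (y' - y) < r ->
    `|f y' - f y| <= M' * enorm (y' - y).
Proof.
move=> /compact_near_coveringP cS df cg gM MM'.
pose P (r : R) (y : 'rV[R]_d) := forall y', enorm (y' - y) < r -> `|f y' - f y| <= M' * enorm (y' - y).
have H : \forall r \near 0^'+, S `<=` P r.
  apply: cS => y0 Sy0.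
  have : \forall y \near y0, enorm (grad f y) < M'.
    have c0 : (fun y => enorm (grad f y)) @ y0 --> enorm (grad f y0).
      exact: (cvg_comp _ _ (cg y0) (@enorm_continuous _ _ _)).
    by apply: (cvgr_lt _ c0); exact: le_lt_trans (gM _ Sy0) MM'.
  move=> /nbhs_ballP[e /= e0 eM].
  exists (ball y0 (e / 2), [set r : R | r < e / 2]) => /=.
    split; first by apply: nbhsx_ballx; rewrite divr_gt0.
    by apply: nbhs_right_lt; rewrite divr_gt0.
  move=> [y r] /= [[_ yb] re] y' yr.
  have [s s01 sE] := segment_mvt y (y' - y) df.
  rewrite subrKC in sE; rewrite sE; apply: le_trans (dot_le _ _) _.
  rewrite ler_wpM2r ?enorm_ge0// ltW//; apply: eM; split => // i j.
  have := yb i j; rewrite /ball /= !mxE => H1.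
  have := coord_le_enorm (y' - y) j; rewrite !mxE (ord1 i) in H1 *.
  set a := y' 0 j - y 0 j => H2.
  have -> : y0 0 j - (y 0 j + s * a) = (y0 0 j - y 0 j) - s * a by ring.
  apply: le_lt_trans (ler_normB _ _) _; rewrite normrM.
  case/andP: s01 => s0 s1; rewrite (ger0_norm s0).
  have : s * `|a| <= enorm (y' - y) by apply: le_trans H2; rewrite ler_piMl.
  by lra.
have [r [r0 rP]] : exists r : R, 0 < r /\ S `<=` P r.
  by apply: (@filter_ex _ (0 : R)^'+); apply: filterI H; exact: nbhs_right_gt.
by exists r => // y y' /rP; exact.
Qed.

End LocallyLipschitz.

Section CompactTarget.
Context (R : realType) (X : ptopologicalType) (d : nat).
Variables (c : X -> 'rV[R]_d -> R).
Variables (rho : probability (borel X) R) (nu : probability (borel 'rV[R]_d) R).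
Notation Yd := (borel 'rV[R]_d).
Hypothesis mc : measurable_fun (setT : set (borel X * Yd)%type) (fun z : borel X * Yd => c z.1 z.2).
Hypothesis dc : forall x, twice_differentiable (c x).

Let grad_c (z : borel X * Yd) := grad (c z.1) z.2.

Lemma product_null_sections (N : set (borel X * Yd)) : measurable N ->
  prod_proba rho nu N = 0%E ->
  exists N1 : set (borel X), [/\ measurable N1, rho N1 = 0%E & forall x, ~ N1 x -> nu (xsection N x) = 0%E].
Proof.
move=> mN N0.
have mx : measurable_fun setT (nu \o xsection N) by exact: measurable_fun_xsection.
have : (\int[rho]_x `|nu (xsection N x)| = 0)%E.
  by rewrite -N0; apply: eq_integral => x _; rewrite gee0_abs.
move/(ae_eq_integral_abs rho measurableT mx) => [N1 [mN1 N10 sN]].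
exists N1; split => // x N1x; apply: contrapT => H; apply: N1x; apply: sN => /=.
by move=> /(_ Logic.I).
Qed.

(** For almost every [x] the bound holds for [nu]-almost every [y]; the set where it
    fails is open by continuity of the gradient, hence misses the support. *)
Lemma grad_bounded_on_supp : (Linfty_norm (prod_proba rho nu) grad_c < +oo)%E ->
  exists N1 : set (borel X), [/\ measurable N1, rho N1 = 0%E &
    forall x y, ~ N1 x -> supp nu y -> enorm (grad (c x) y) <= fine (Linfty_norm (prod_proba rho nu) grad_c)].
Proof.
move=> fin; have [N [mN N0 gN]] := Linfty_norm_ae fin; set M := fine _ in gN *.
have [N1 [mN1 N10 sN1]] := product_null_sections mN N0.
exists N1; split => // x y N1x Sy; rewrite leNgt; apply/negP => My.
have cg : continuous (fun y => enorm (grad (c x) y)).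
  move=> v; have cgv := differentiable_continuous (dc x v).2.
  exact: (cvg_comp _ _ cgv (@enorm_continuous R d _)).
(* the open set where the bound fails *)
pose U := (fun y => enorm (grad (c x) y)) @^-1` `]M, +oo[%classic.
have oU : open U by apply: open_comp => [v _|]; [exact: cg|exact: interval_open].
have Uy : U y by rewrite /U /= in_itv /= My.
have := Sy U oU Uy; rewrite lt_neqAle eq_sym => /andP[/eqP + _]; apply.
apply/eqP; rewrite -measure_le0 -(sN1 x N1x); apply: le_measure; rewrite ?inE.
- exact: sub_sigma_algebra.
- exact: measurable_xsection.
move=> v; rewrite /U /= in_itv /= andbT => Mv; apply/mem_set; apply: contrapT => Nv.
by have := gN (x, v) Nv; rewrite leNgt Mv.
Qed.

(** The sets [A n] ask for the slope bound at scale [1 / (n + 1)] only between points of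
    a countable dense subset of the support, which keeps them measurable; continuity
    extends it to the whole support. *)
Lemma increments_compact_supp : compact (supp nu) ->
  (Linfty_norm (prod_proba rho nu) grad_c < +oo)%E ->
  [/\ measurable (supp nu : set Yd), nu (supp nu) = 1%E &
  increments_bounded c rho (supp nu) (fine (Linfty_norm (prod_proba rho nu) grad_c))].
Proof.
move=> cS fin; have [oS S0] := supp_setC_negligible nu (@rV_second_countable R d).
have mSC : measurable (~` supp nu : set Yd) by exact: sub_sigma_algebra.
have mS : measurable (supp nu : set Yd) by rewrite -(setCK (supp nu)); exact: measurableC.
have nuS : nu (supp nu) = 1%E.
  by rewrite -(setCK (supp nu)); have := probability_setC nu mSC; rewrite S0 sube0.
split => // M' MM'.
have Sne : (supp nu) !=set0.
  by apply/set0P/eqP => E; move: nuS; rewrite E measure0 => /eqP; rewrite eq_sym onee_eq0.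
have [q [qS qd]] := dense_seq (@rV_second_countable R d) Sne.
have [N1 [mN1 N10 gN1]] := grad_bounded_on_supp fin.
pose B n i j : set (borel X) := [set x | enorm (q j - q i) < n.+1%:R^-1 ->
   `|c x (q j) - c x (q i)| <= M' * enorm (q j - q i)].
pose A n : set (borel X) := ~` N1 `&` \bigcap_i \bigcap_j B n i j.
have mcy (y : Yd) : measurable_fun setT (fun x : borel X => c x y).
  exact: (measurable_fun_pair1 y mc).
have mB n i j : measurable (B n i j).
  rewrite /B; case: (ltP (enorm (q j - q i)) n.+1%:R^-1) => H; last first.
    by rewrite (_ : [set x | _] = setT)//; apply/seteqP; split.
  rewrite (_ : [set x | _] = (fun x : borel X => `|c x (q j) - c x (q i)|) @^-1` `]-oo, M' * enorm (q j - q i)]).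
    rewrite -[X in measurable X]setTI; apply: (measurableT_comp _ (measurable_funB (mcy _) (mcy _))) => //.
  by apply/seteqP; split=> x /=; rewrite in_itv /=; [apply|move=> Hx _].
have mA n : measurable (A n).
  apply: measurableI; first exact: measurableC.
  by apply: bigcapT_measurable => i; apply: bigcapT_measurable.
have ndA m n : (m <= n)%N -> A m `<=` A n.
  move=> mn x [N1x Bx]; split => // i _ j _ H; apply: (Bx i Logic.I j Logic.I).
  by apply: lt_le_trans H _; rewrite lef_pV2 ?posrE ?ler_nat.
have UA x : ~ N1 x -> (\bigcup_n A n) x.
  move=> N1x.
  have [r r0 rP] := compact_locally_lipschitz cS (fun y => (dc x y).1)
    (fun y => differentiable_continuous (dc x y).2) (fun y Sy => gN1 x y N1x Sy) MM'.
  have [n nr] : exists n : nat, n.+1%:R^-1 < r.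
    by have := near_infty_natSinv_lt (PosNum r0) => -[k _ /(_ k (leqnn k))]; exists k.
  by exists n => //; split => // i _ j _ H; apply: rP => //; exact: lt_trans nr.
exists A; split => //.
  have mUA : measurable (\bigcup_n A n) by exact: bigcupT_measurable.
  apply/eqP; rewrite eq_le; apply/andP; split; first exact: probability_le1.
  have <- : rho (~` N1) = 1%E by have := probability_setC rho mN1; rewrite N10 sube0.
  by apply: le_measure => [||x /UA//]; rewrite inE//; exact: measurableC.
move=> n; exists n.+1%:R^-1; first by rewrite invr_gt0.
move=> y y' Sy Sy' yr; exists 0 => x [N1x Bx]; rewrite subr0 leNgt; apply/negP => H.
have cc (v : 'rV[R]_d) : (c x) @ v --> c x v by exact: (differentiable_continuous (dc x v).1).
have ce : (fun z : 'rV[R]_d * 'rV[R]_d => enorm (z.2 - z.1)) @ (y, y') --> enorm (y' - y).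
  apply: (@cvg_comp _ _ _ (fun z : 'rV[R]_d * 'rV[R]_d => z.2 - z.1) _ _ (nbhs (y' - y))).
    by apply: cvgB; [exact: cvg_snd|exact: cvg_fst].
  exact: enorm_continuous.
have cF : (fun z : 'rV[R]_d * 'rV[R]_d => `|c x z.2 - c x z.1| - M' * enorm (z.2 - z.1)) @ (y, y') -->
    `|c x y' - c x y| - M' * enorm (y' - y).
  apply: cvgB; last by apply: cvgM => //; exact: cvg_cst.
  apply: cvg_norm; apply: cvgB.
    exact: (cvg_comp _ _ cvg_snd (cc y')).
  exact: (cvg_comp _ _ cvg_fst (cc y)).
have : \forall z \near (y, y'), enorm (z.2 - z.1) < n.+1%:R^-1 /\
    0 < `|c x z.2 - c x z.1| - M' * enorm (z.2 - z.1).
  apply: filterI; first exact: (cvgr_lt _ ce).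
  by apply: (cvgr_gt _ cF); rewrite subr_gt0.
move=> [[U U'] /= [nU nU'] sub].
have [i Ui] := qd _ _ Sy nU; have [j Uj] := qd _ _ Sy' nU'.
have [/= h1 h2] := sub (q i, q j) (conj Ui Uj).
have := Bx i Logic.I j Logic.I h1; rewrite leNgt => /negP; apply.
by rewrite -subr_gt0.
Qed.

End CompactTarget.

(** * Convergence rates *)

Section Conclusion.
Context (R : realType) (X : ptopologicalType) (d : nat).
Variables (c : X -> 'rV[R]_d -> R) (eps tau : R).
Variables (rho : probability (borel X) R) (nu : probability (borel 'rV[R]_d) R).
Hypothesis mc : measurable_fun (setT : set (borel X * borel 'rV[R]_d)%type)
          (fun z : borel X * borel 'rV[R]_d => c z.1 z.2).
Hypotheses (eps0 : 0 < eps) (tau0 : 0 < tau) (hnu : TI tau nu).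
Notation Yd := (borel 'rV[R]_d).
Variables (phi : borel X -> R) (psi : Yd -> R) (pi : probability (borel X * Yd)%type R).
Hypotheses (mphi : measurable_fun setT phi) (mpsi : measurable_fun setT psi).
Hypotheses (dpi : has_gibbs_density c eps rho nu phi psi pi) (cpl : coupling rho nu pi).
Variables (phi0 : borel X -> R) (pin : nat -> probability (borel X * Yd)%type R).
Hypotheses (hphi0 : admissible_init c eps rho nu phi0) (hpin : sinkhorn_plans c eps rho nu phi0 pin).
Variables (S : set Yd) (M : R).
Hypotheses (mS : measurable S) (nuS : nu S = 1%E) (M0 : 0 <= M) (incr : increments_bounded c rho S M).

(** The free energy bound holds for all [p > 1 + tau M^2 / eps^2], hence for all
    [p > p0]. *)
Lemma rate_of_increments p0 : 1 < p0 -> 1 + tau * M ^+ 2 / eps ^+ 2 <= p0 ->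
  converges_with_rate pi pin (1 - p0^-1).
Proof.
move=> p01 pM.
apply: (sinkhorn_converges_with_rate mc eps0 mphi mpsi dpi cpl hphi0 hpin p01) => p ph pp mph fi h bh.
exact: (free_energy_ge_increments mc eps0 tau0 hnu mS nuS M0 incr (le_lt_trans pM pp) mph fi bh).
Qed.

Lemma exponential_of_increments : converges_exponentially pi pin.
Proof.
have K0 : 0 <= tau * M ^+ 2 / eps ^+ 2 by rewrite divr_ge0 ?sqr_ge0// mulr_ge0 ?sqr_ge0// ltW.
(* 2 rather than 1, so that [p0 > 1] also when [M = 0] *)
pose p0 := 2 + tau * M ^+ 2 / eps ^+ 2.
have p01 : 1 < p0 by rewrite /p0; lra.
exists p0^-1; first by rewrite invr_gt0 invf_lt1 ?p01 ?andbT// (lt_trans ltr01).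
by apply: rate_of_increments => //; rewrite /p0; lra.
Qed.

End Conclusion.

Lemma semidef_le_diag (R : realType) d (A B : 'M[R]_d) i : semidef_le A B -> A i i <= B i i.
Proof.
move=> /(_ (delta_mx 0 i)); rewrite trmx_delta -rowE -colE !mxE.
by rewrite subr_ge0.
Qed.

Lemma supp_nonempty (T : ptopologicalType) (R : realType) (mu : probability (borel T) R) :
  @second_countable T -> supp mu !=set0.
Proof.
move=> sT; apply/set0P/eqP => S0; have [_] := supp_setC_negligible mu sT.
by rewrite S0 setC0 probability_setT => /eqP; rewrite onee_eq0.
Qed.

Theorem mainTheorem8 (R : realType) (X : completePseudoMetricType R) (d : nat)
  (hX : hausdorff_space X) (sX : @second_countable X)
  (rho : probability (borel X) R) (nu : probability (borel 'rV[R]_d) R)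
  (c : X -> 'rV[R]_d -> R)
  (mc : measurable_fun (setT : set (borel X * borel 'rV[R]_d)%type)
          (fun z : borel X * borel 'rV[R]_d => c z.1 z.2))
  (dc : forall x, twice_differentiable (c x))
  (tau : R) (tau0 : 0 < tau)
  (hrho : compact (supp rho)) (hnu : TI tau nu)
  (eps : R) (eps0 : 0 < eps)
  (pi : probability (borel X * borel 'rV[R]_d)%type R)
  (hpi : unique_eot_minimizer c eps rho nu pi)
  (phi : X -> R) (psi : 'rV[R]_d -> R)
  (mphi : measurable_fun (setT : set (borel X)) phi)
  (mpsi : measurable_fun (setT : set (borel 'rV[R]_d)) psi)
  (dpi : has_gibbs_density c eps rho nu phi psi pi)
  (phi0 : X -> R) (hphi0 : admissible_init c eps rho nu phi0)
  (pin : nat -> probability (borel X * borel 'rV[R]_d)%type R)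
  (hpin : sinkhorn_plans c eps rho nu phi0 pin) :
  (forall (Sigma : 'M[R]_d) (g : X -> 'rV[R]_d),
     (forall x y, hess (c x) y = Sigma) ->
     (forall x y, g x = grad (c x) y - y *m Sigma^T) ->
     (Linfty_norm rho g < +oo)%E ->
     let G := fine (Linfty_norm rho g) in
     converges_exponentially pi pin /\
     (eps <= Num.sqrt tau * G ->
      converges_with_rate pi pin
        (1 - eps ^+ 2 / (eps ^+ 2 + tau * G ^+ 2))))
  /\
  (forall l L : R,
     compact (supp nu) ->
     (forall x y, supp rho x -> supp nu y ->
        semidef_le l%:M (hess (c x) y) /\ semidef_le (hess (c x) y) L%:M) ->
     (Linfty_norm (prod_proba rho nu) (fun z => grad (c z.1) z.2) < +oo)%E ->
     let M := fine (Linfty_norm (prod_proba rho nu)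
                      (fun z => grad (c z.1) z.2)) in
     converges_exponentially pi pin /\
     (eps <= (tau * (L - l) +
              Num.sqrt (tau ^+ 2 * (L - l) ^+ 2 + 4 * tau * M ^+ 2)) / 2 ->
      converges_with_rate pi pin
        (1 - eps ^+ 2 / (eps ^+ 2 + tau * eps * (L - l) + tau * M ^+ 2)))).
Proof.
have cpl := hpi.1; split=> [Sigma g _ gE gfin G|l L cS hess_lL fin M].
  have G0 : 0 <= G by rewrite fine_ge0// Linfty_norm_ge0.
  have incr : increments_bounded c rho setT G.
    exact: (increments_constant_hess (fun x y => (dc x y).1) gE gfin).
  have conv := rate_of_increments mc eps0 tau0 hnu mphi mpsi dpi cpl hphi0 hpin
    measurableT (probability_setT nu) G0 incr.
  split.
    exact: (exponential_of_increments mc eps0 tau0 hnu mphi mpsi dpi cpl hphi0 hpin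
      measurableT (probability_setT nu) G0 incr).
  move=> epsG; have Gp : 0 < G.
    by have := lt_le_trans eps0 epsG; rewrite pmulr_rgt0// sqrtr_gt0.
  have K0 : 0 < tau * G ^+ 2 / eps ^+ 2 by rewrite divr_gt0 ?exprn_gt0// mulr_gt0 ?exprn_gt0.
  have -> : eps ^+ 2 / (eps ^+ 2 + tau * G ^+ 2) = (1 + tau * G ^+ 2 / eps ^+ 2)^-1.
    by field; rewrite !gt_eqF ?addr_gt0 ?mulr_gt0 ?exprn_gt0.
  by apply: conv => //; lra.
have M0 : 0 <= M by rewrite fine_ge0// Linfty_norm_ge0.
have [mS nuS incr] := increments_compact_supp mc dc cS fin.
have conv := rate_of_increments mc eps0 tau0 hnu mphi mpsi dpi cpl hphi0 hpin mS nuS M0 incr.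
split.
  exact: (exponential_of_increments mc eps0 tau0 hnu mphi mpsi dpi cpl hphi0 hpin mS nuS M0 incr).
move=> epsM.
have lL : l <= L.
  have [x Sx] := supp_nonempty rho sX.
  have [y Sy] := supp_nonempty nu (@rV_second_countable R d).
  have [hl hL] := hess_lL x y Sx Sy.
  (* in dimension 0 the norms vanish and [L < l] would make the bound on [eps] negative *)
  have [[i _]|d0] := pselect (exists i : 'I_d, True).
    have := le_trans (semidef_le_diag i hl) (semidef_le_diag i hL).
    by rewrite !mxE eqxx !mulr1n.
  have e0 (v : 'rV[R]_d) : enorm v = 0.
    by rewrite /enorm big1 ?sqrtr0// => i _; case: d0; exists i.
  have M00 : M = 0.
    apply/eqP; rewrite eq_le M0 andbT -lee_fin fineK ?ge0_fin_numE ?Linfty_norm_ge0//.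
    by apply: ess_sup_ler => z; rewrite e0.
  rewrite leNgt; apply/negP => Ll; move: epsM.
  rewrite M00 expr0n/= mulr0 addr0 -exprMn sqrtr_sqr ler0_norm; last first.
    by rewrite pmulr_rle0// subr_le0 ltW.
  by rewrite subrr mul0r leNgt eps0.
have e20 : 0 < eps ^+ 2 by rewrite exprn_gt0.
have K1 : 0 <= tau * (L - l) / eps by rewrite divr_ge0 ?(ltW eps0)// mulr_ge0 ?(ltW tau0)// subr_ge0.
have K2 : 0 <= tau * M ^+ 2 / eps ^+ 2 by rewrite divr_ge0 ?(ltW e20)// mulr_ge0 ?(ltW tau0)// sqr_ge0.
have Kpos : 0 < tau * (L - l) / eps + tau * M ^+ 2 / eps ^+ 2.
  have [lL'|Ll] := ltP l L.
    by apply: ltr_pwDl K2; rewrite divr_gt0// mulr_gt0// subr_gt0.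
  have [Mp|Mn] := ltP 0 M.
    by apply: ltr_wpDl K1 _; rewrite divr_gt0// mulr_gt0// exprn_gt0.
  have M00 : M = 0 by apply/eqP; rewrite eq_le M0 Mn.
  have lL0 : L - l = 0 by apply/eqP; rewrite subr_eq0 eq_le lL Ll.
  by move: epsM; rewrite M00 lL0 expr0n/= !mulr0 addr0 sqrtr0 addr0 mul0r leNgt eps0.
have -> : eps ^+ 2 / (eps ^+ 2 + tau * eps * (L - l) + tau * M ^+ 2) =
    (1 + (tau * (L - l) / eps + tau * M ^+ 2 / eps ^+ 2))^-1.
  have E : eps ^+ 2 + tau * eps * (L - l) + tau * M ^+ 2 =
      eps ^+ 2 * (1 + (tau * (L - l) / eps + tau * M ^+ 2 / eps ^+ 2)).
    by field; rewrite gt_eqF.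
  have D0 : 1 + (tau * (L - l) / eps + tau * M ^+ 2 / eps ^+ 2) != 0.
    by rewrite gt_eqF// addr_gt0.
  by rewrite E invfM mulrA divff ?gt_eqF// mul1r.
apply: conv; first by rewrite ltrDl.
by rewrite lerD2l lerDr.
Qed.
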